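(* Let $\nu\in\mathbb{C}\setminus(1+2\mathbb{Z})$. There is a bijective linear map $A^\nu_{-\omega}(\mathrm{PSL}_2(\mathbb{Z}))\to\Psi_{\mathrm{mod}}(\nu)$, $\alpha\mapsto\psi_\alpha$.
   Context: Let $G=\mathrm{PSL}_2(\mathbb{R})$, elements written by representatives $\begin{pmatrix}a&b\\c&d\end{pmatrix}\in\mathrm{SL}_2(\mathbb{R})$, acting on $\mathbb{P}^1(\mathbb{C})$ by $g\cdot\tau=\frac{a\tau+b}{c\tau+d}$. Let $T=\mathbb{P}^1(\mathbb{R})=\mathbb{R}\cup\{\infty\}$, the common boundary of the upper half plane $\mathfrak{H}^+$ and the lower half plane $\mathfrak{H}^-$. A hyperfunction on an open set $U\subset T$ is an element of $\mathcal{O}(W\setminus U)/\mathcal{O}(W)$, where $W$ is an open neighborhood of $U$ in $\mathbb{P}^1(\mathbb{C})$ and $\mathcal{O}$ denotes holomorphic functions (this does not depend on $W$); a holomorphic function on $W\setminus U$ representing it is a representative. For $\nu\in\mathbb{C}$ let $M^\nu_{-\omega}$ be the space of hyperfunctions on $T$ with the action of $G$ defined on representatives by $(\pi_\nu(g)h)(\tau)=\Big(\frac{1+\tau^2}{(c\tau-a)^2+(d\tau-b)^2}\Big)^{(1+\nu)/2}h\Big(\frac{d\tau-b}{-c\tau+a}\Big)$ for $g=\begin{pmatrix}a&b\\c&d\end{pmatrix}$, where the power is the branch that is positive on $T$, continued holomorphically to a neighborhood of $T$. For a subgroup $\Gamma\subset G$, $A^\nu_{-\omega}(\Gamma)=\{\alpha\in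 M^\nu_{-\omega}:\pi_\nu(\gamma)\alpha=\alpha\ \forall\gamma\in\Gamma\}$ (automorphic hyperfunctions). $\Psi_{\mathrm{mod}}(\nu)$ is the space of holomorphic functions $\psi:\mathbb{C}\setminus(-\infty,0]\to\mathbb{C}$ such that $\psi(\tau)=\psi(\tau+1)+(\tau+1)^{-\nu-1}\psi\big(\frac{\tau}{\tau+1}\big)$ and such that both limits in $\lim_{\mathrm{Im}\tau\to\infty}\big(\psi(\tau)+\tau^{-1-\nu}\psi(-1/\tau)\big)+\lim_{\mathrm{Im}\tau\to-\infty}\big(\psi(\tau)+\tau^{-1-\nu}\psi(-1/\tau)\big)=0$ exist and the equality holds; powers use the principal branch of $\log$ on $\mathbb{C}\setminus(-\infty,0]$. *)

(* Defs.v *)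
From Coquelicot Require Import Coquelicot.
From Stdlib Require Import Reals ZArith ClassicalEpsilon.

Open Scope C_scope.

Notation CC := Complex.C.

Definition holo_on (U : CC -> Prop) (f : CC -> CC) : Prop :=
  open (T := C_UniformSpace) U /\
  forall z, U z -> @ex_derive C_AbsRing C_NormedModule f z.

Definition off_T (z : CC) : Prop := Im z <> 0%R.

(** [W] is the finite part W \ {oo} of an open neighbourhood of
    T = R u {oo} in P^1(C): open, contains R, contains {|z| > M}. *)
Definition nbhdT (W : CC -> Prop) : Prop :=
  open (T := C_UniformSpace) W /\
  (forall x : R, W (RtoC x)) /\
  exists M : R, forall z, (M < Cmod z)%R -> W z.

Definition chart_oo (c : CC) (g : CC -> CC) (u : CC) : CC :=
  if excluded_middle_informative (u = 0) then c else g (/ u).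

(** g is in O(W u {oo}): holomorphic on W and holomorphic at oo. *)
Definition holo_ext (W : CC -> Prop) (g : CC -> CC) : Prop :=
  holo_on W g /\
  exists (c : CC) (r : R), (0 < r)%R /\
    holo_on (fun u => (Cmod u < r)%R) (chart_oo c g).

(** f represents a hyperfunction on T: it is holomorphic on W \ T for some
    open neighbourhood W of T in P^1(C). *)
Definition is_rep (f : CC -> CC) : Prop :=
  exists W, nbhdT W /\ holo_on (fun z => W z /\ off_T z) f.

(** Two representatives define the same hyperfunction: their difference
    extends holomorphically to some neighbourhood V of T in P^1(C)
    (the direct limit of O(W \ T)/O(W), independent of W). *)
Definition hyp_eq (f1 f2 : CC -> CC) : Prop :=
  exists (V : CC -> Prop) (g : CC -> CC),
    nbhdT V /\ holo_ext V g /\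
    forall z, V z -> off_T z -> f1 z - f2 z = g z.

Definition Cexp (z : CC) : CC :=
  (exp (Re z) * cos (Im z), exp (Re z) * sin (Im z))%R.

Definition slit (z : CC) : Prop := Im z <> 0%R \/ (0 < Re z)%R.

(** Principal branch of log on C \ (-oo,0]: ln|z| + i Arg z with
    Arg z = 2 atan (Im z / (|z| + Re z)) in (-pi, pi). *)
Definition Clog (z : CC) : CC :=
  (ln (Cmod z), 2 * atan (Im z / (Cmod z + Re z)))%R.

Definition cpow (z w : CC) : CC := Cexp (w * Clog z).

Definition ZC (n : Z) : CC := RtoC (IZR n).

Definition jfac (a b c d : Z) (t : CC) : CC :=
  (1 + t * t) /
  ((ZC c * t - ZC a) * (ZC c * t - ZC a) + (ZC d * t - ZC b) * (ZC d * t - ZC b)).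

Definition pi_nu (nu : CC) (a b c d : Z) (h : CC -> CC) (t : CC) : CC :=
  cpow (jfac a b c d t) ((1 + nu) / 2) *
  h ((ZC d * t - ZC b) / (- ZC c * t + ZC a)).

(** Automorphic hyperfunctions for PSL_2(Z) (given by a representative):
    pi_nu(gamma) alpha = alpha for every gamma; PSL_2(Z) elements are given
    by SL_2(Z) representatives (the action is insensitive to the sign). *)
Definition automorphic (nu : CC) (f : CC -> CC) : Prop :=
  is_rep f /\
  forall a b c d : Z, (a * d - b * c = 1)%Z ->
    hyp_eq (pi_nu nu a b c d f) f.

Definition Scomb (nu : CC) (psi : CC -> CC) (t : CC) : CC :=
  psi t + cpow t (- (1 + nu)) * psi (- / t).

Definition in_Psi_mod (nu : CC) (psi : CC -> CC) : Prop :=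
  holo_on slit psi /\
  (forall t, slit t ->
     psi t = psi (t + 1) + cpow (t + 1) (- nu - 1) * psi (t / (t + 1))) /\
  exists L1 L2 : CC,
    (forall eps : R, (0 < eps)%R -> exists M : R, forall t, (M < Im t)%R ->
       (Cmod (Scomb nu psi t - L1) < eps)%R) /\
    (forall eps : R, (0 < eps)%R -> exists M : R, forall t, (Im t < - M)%R ->
       (Cmod (Scomb nu psi t - L2) < eps)%R) /\
    L1 + L2 = 0.

(* Main.v *)
(** In the line model [phi = (1 + t^2)^(-(1+nu)/2) h], an automorphic hyperfunction restricted to the real line
    is invariant under [t -> t + 1], hence has a 1-periodic representative [P], holomorphic on [C \ R]:
    minus the Cauchy integral of [phi] against the periodic kernel [1 / (exp (2 pi i (x - z)) - 1)] over the
    boundary of a period rectangle, with the two vertical sides merged into the integral of the jump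
    [phi(t+1) - phi(t)], which is holomorphic across [R]. It is unique up to a constant if it is required to have
    limits at [+- i oo], and unique if a linear relation between the two limits is imposed, as [nu] is not odd.
    The period function is [psi(t) = P(t) - t^(-1-nu) P(-1/t)]: invariance under [t -> -1/t] extends it across
    [(0,oo)], and periodicity of [P] is the three-term equation. Since
    [psi(t) + t^(-1-nu) psi(-1/t) = (1 - exp (-+ i pi (1+nu))) P(t)] for [+- Im t > 0], [psi] determines [P] when
    [nu] is not odd. Conversely this formula defines a periodic [P] from [psi]; gluing the hyperfunction [P] on [R]
    to its transform under [t -> -1/t] near [oo] (a Cousin problem at [1] and, by symmetry, at [-1]) gives an automorphic
    hyperfunction, invariance at [oo] being again the three-term equation. *)

Require Import Defs.
From Coquelicot Require Import Coquelicot.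
From Stdlib Require Import Reals ZArith Lra Lia ClassicalEpsilon.
Open Scope C_scope.

(** * Continuity and complex differentiability *)

(** Everything is done with germs: [ext D x] says that the hyperfunction germ of [D] at [x]
    vanishes, and [hyp_eq] amounts to [ext] at each real point and at infinity ([hyp_eq_local]). The
    obstacle is the branch of the power in [pi_nu]: principal powers multiply only while arguments
    stay small, so cocycle identities may fail away from the boundary. The homogeneous lift [Phi]
    removes it: near a boundary point the action is a linear substitution, and invariance is stated
    for all unimodular frames, so that products and inverses need no further branch computation. The
    complex analysis rests on Goursat's theorem for rectangles. Cauchy's formula is needed only in
    width one, where the integral of the periodic kernel is read off from its limits at both ends;
    the ordinary Cauchy kernel is then compared with the periodic one. The relation imposed on the
    limits of [P] is [kappa_up * L1 + kappa_low * L2 = 0], the limit condition on [psi] in disguise.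
    Adding a constant c to [P] changes its left side by (kappa_up + kappa_low) c, and that sum
    equals the product of the two multipliers, which are nonzero when [nu] is not odd. *)

Definition rcont {T : UniformSpace} (f : T -> R) (x : T) : Prop :=
  continuous (U := R_UniformSpace) f x.

Lemma rcont_plus {T : UniformSpace} (f g : T -> R) x :
  rcont f x -> rcont g x -> rcont (fun t => f t + g t)%R x.
Proof. exact (continuous_plus (V := R_NormedModule) f g x). Qed.

Lemma rcont_opp {T : UniformSpace} (f : T -> R) x :
  rcont f x -> rcont (fun t => - f t)%R x.
Proof. exact (continuous_opp (V := R_NormedModule) f x). Qed.

Lemma rcont_minus {T : UniformSpace} (f g : T -> R) x :
  rcont f x -> rcont g x -> rcont (fun t => f t - g t)%R x.
Proof. exact (continuous_minus (V := R_NormedModule) f g x). Qed.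

Lemma rcont_mult {T : UniformSpace} (f g : T -> R) x :
  rcont f x -> rcont g x -> rcont (fun t => f t * g t)%R x.
Proof. exact (continuous_mult (K := R_AbsRing) f g x). Qed.

Lemma rcont_comp {T : UniformSpace} (h : R -> R) (f : T -> R) x :
  rcont f x -> continuity_pt h (f x) -> rcont (fun t => h (f t)) x.
Proof.
intros Hf Hh. apply (continuous_comp (V := R_UniformSpace) (W := R_UniformSpace)); [exact Hf|].
now apply continuity_pt_filterlim.
Qed.

Lemma rcont_const {T : UniformSpace} (c : R) (x : T) : rcont (fun _ => c) x.
Proof. exact (continuous_const (V := R_UniformSpace) c x). Qed.

Lemma rcont_inv {T : UniformSpace} (f : T -> R) x :
  rcont f x -> f x <> 0%R -> rcont (fun t => / f t)%R x.
Proof.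
intros Hf Hx. apply (rcont_comp Rinv); [exact Hf|].
apply continuity_pt_filterlim, continuous_Rinv; exact Hx.
Qed.

(** Continuity through the two coordinates reduces sums, products and inverses to the real rules; it
    is equivalent to [continuous] into [C_UniformSpace] by the two conversions below. *)
Definition ccont {T : UniformSpace} (f : T -> CC) (x : T) : Prop :=
  rcont (fun t => Re (f t)) x /\ rcont (fun t => Im (f t)) x.

Lemma ccont_const {T : UniformSpace} (c : CC) (x : T) : ccont (fun _ => c) x.
Proof. split; apply rcont_const. Qed.

Lemma ccont_plus {T : UniformSpace} (f g : T -> CC) x :
  ccont f x -> ccont g x -> ccont (fun t => f t + g t) x.
Proof. intros [H1 H2] [H3 H4]; split; now apply rcont_plus. Qed.

Lemma ccont_opp {T : UniformSpace} (f : T -> CC) x :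
  ccont f x -> ccont (fun t => - f t) x.
Proof. intros [H1 H2]; split; now apply rcont_opp. Qed.

Lemma ccont_minus {T : UniformSpace} (f g : T -> CC) x :
  ccont f x -> ccont g x -> ccont (fun t => f t - g t) x.
Proof. intros Hf Hg; apply ccont_plus; [|apply ccont_opp]; assumption. Qed.

Lemma ccont_mult {T : UniformSpace} (f g : T -> CC) x :
  ccont f x -> ccont g x -> ccont (fun t => f t * g t) x.
Proof.
intros [H1 H2] [H3 H4]; split; [apply rcont_minus|apply rcont_plus]; now apply rcont_mult.
Qed.

Lemma Cnorm2_neq0 (z : CC) : z <> 0 -> (fst z ^ 2 + snd z ^ 2 <> 0)%R.
Proof.
intros Hz H. apply Hz. destruct z as [x y]; simpl in H.
assert (x = 0%R) by nra. assert (y = 0%R) by nra. subst; reflexivity.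
Qed.

Lemma rcont_pow2 {T : UniformSpace} (f : T -> R) x :
  rcont f x -> rcont (fun t => f t ^ 2)%R x.
Proof.
intros Hf. apply (rcont_comp (fun y => y ^ 2)%R); [exact Hf|]. reg.
Qed.

Lemma ccont_inv {T : UniformSpace} (f : T -> CC) x :
  ccont f x -> f x <> 0 -> ccont (fun t => / f t) x.
Proof.
intros [H1 H2] Hx. apply Cnorm2_neq0 in Hx.
split; apply rcont_mult; try apply rcont_opp; try assumption; apply rcont_inv; try assumption;
  apply rcont_plus; apply rcont_pow2; assumption.
Qed.

Lemma ccont_div {T : UniformSpace} (f g : T -> CC) x :
  ccont f x -> ccont g x -> g x <> 0 -> ccont (fun t => f t / g t) x.
Proof. intros Hf Hg Hx; apply ccont_mult; [|apply ccont_inv]; assumption. Qed.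

Lemma ccont_continuous {T : UniformSpace} (f : T -> CC) x :
  ccont f x -> continuous (U := C_UniformSpace) f x.
Proof.
intros [H1 H2].
assert (H : continuous (U := C_UniformSpace) (fun t => (Re (f t), Im (f t))) x).
{ unfold continuous.
  intros P HP.
  assert (HP' : exists e : posreal, forall y, ball (M := C_UniformSpace) (f x) e y -> P y).
  { destruct HP as [e He]. exists e. intros y Hy. apply He.
    destruct (f x); exact Hy. }
  destruct HP' as [e He].
  assert (L1 := proj1 (filterlim_locally _ _) H1 e).
  assert (L2 := proj1 (filterlim_locally _ _) H2 e).
  unfold filtermap. generalize (filter_and _ _ L1 L2). apply filter_imp.
  intros t [A B]. apply He. split; assumption. }
revert H. apply continuous_ext. intros t. now destruct (f t).
Qed.

Lemma continuous_ccont {T : UniformSpace} (f : T -> CC) x :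
  continuous (U := C_UniformSpace) f x -> ccont f x.
Proof.
intros H.
assert (G : forall e : posreal, locally x (fun t => ball (M := C_UniformSpace) (f x) e (f t))).
{ exact (proj1 (filterlim_locally _ _) H). }
split; apply filterlim_locally; intros e; generalize (G e); apply filter_imp; intros t [A B]; assumption.
Qed.

Lemma ccont_comp {T : UniformSpace} (f : CC -> CC) (g : T -> CC) x :
  ccont (T := C_UniformSpace) f (g x) -> ccont g x -> ccont (fun t => f (g t)) x.
Proof.
intros Hf Hg. apply continuous_ccont.
apply (continuous_comp (V := C_UniformSpace) (W := C_UniformSpace)); now apply ccont_continuous.
Qed.

Lemma rcont_comp_C {T : UniformSpace} (f : CC -> R) (g : T -> CC) x :
  rcont (T := C_UniformSpace) f (g x) -> ccont g x -> rcont (fun t => f (g t)) x.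
Proof.
intros Hf Hg.
apply (continuous_comp (V := C_UniformSpace) (W := R_UniformSpace)); [now apply ccont_continuous|exact Hf].
Qed.

Notation ccontC := (ccont (T := C_UniformSpace)).
Notation rcontC := (rcont (T := C_UniformSpace)).
Notation ccontR := (ccont (T := R_UniformSpace)).
Notation nearC z P := (locally (T := C_UniformSpace) (z%C : CC) (P%C : CC -> Prop)).

Ltac near_by H := generalize H; apply filter_imp.

Lemma ccont_id (z : CC) : ccontC (fun w => w) z.
Proof. apply continuous_ccont, continuous_id. Qed.

Lemma ccont_ext_loc {T : UniformSpace} (f g : T -> CC) x :
  locally x (fun t => f t = g t) -> ccont f x -> ccont g x.
Proof.
intros H Hf. apply continuous_ccont.
apply continuous_ext_loc with (2 := ccont_continuous _ _ Hf).
near_by H; auto.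
Qed.

Lemma rcont_Re (z : CC) : rcontC Re z.
Proof. apply (ccont_id z). Qed.
Lemma rcont_Im (z : CC) : rcontC Im z.
Proof. apply (ccont_id z). Qed.

Lemma Cmod_le_ReIm (z : CC) : (Cmod z <= Rabs (Re z) + Rabs (Im z))%R.
Proof.
apply Rle_trans with (Cmod (RtoC (Re z)) + Cmod (RtoC (Im z) * Ci))%R.
- eapply Rle_trans; [|apply Cmod_triangle]. right; f_equal. destruct z; cbv [Re Im Cplus Cmult RtoC Ci fst snd]; f_equal; ring.
- rewrite Cmod_mult, !Cmod_R, Cmod_Ci. lra.
Qed.

Lemma Re_le_Cmod z : (Rabs (Re z) <= Cmod z)%R.
Proof. apply re_le_Cmod. Qed.

Lemma Im_le_Cmod z : (Rabs (Im z) <= Cmod z)%R.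
Proof. eapply Rle_trans; [|apply Rmax_Cmod]. apply Rmax_r. Qed.

(** Balls of [C_UniformSpace] are squares; comparing the modulus with the coordinates turns them
    into discs, at the price of a factor 2. *)
Lemma nearC_spec (z : CC) (P : CC -> Prop) :
  nearC z P <-> exists d : R, (0 < d)%R /\ forall w, (Cmod (w - z) < d)%R -> P w.
Proof.
split.
- intros [e He]. exists e. split; [apply cond_pos|]. intros w Hw. apply He.
  split; unfold ball; simpl; unfold AbsRing_ball, abs, minus, plus, opp; simpl.
  + eapply Rle_lt_trans; [apply (Re_le_Cmod (w - z))|exact Hw].
  + eapply Rle_lt_trans; [apply (Im_le_Cmod (w - z))|exact Hw].
- intros [d [Hd H]].
  assert (Hd2 : (0 < d / 2)%R) by lra. exists (mkposreal _ Hd2). intros w [H1 H2].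
  apply H. eapply Rle_lt_trans; [apply Cmod_le_ReIm|].
  unfold ball in H1, H2; simpl in H1, H2; unfold AbsRing_ball, abs, minus, plus, opp in H1, H2; simpl in H1, H2.
  change (Re (w - z)) with (fst w + - fst z)%R. change (Im (w - z)) with (snd w + - snd z)%R.
  lra.
Qed.

Lemma ccont_spec (f : CC -> CC) (z : CC) :
  ccontC f z <-> forall e : R, (0 < e)%R -> nearC z (fun w => (Cmod (f w - f z) < e)%R).
Proof.
split.
- intros H e He. apply ccont_continuous in H.
  apply (H (fun y => (Cmod (y - f z) < e)%R)). apply nearC_spec. exists e; split; auto.
- intros H. apply continuous_ccont. intros P HP. apply nearC_spec in HP. destruct HP as [d [Hd HP]].
  unfold filtermap. near_by (H d Hd). auto.
Qed.

Lemma rcont_near {T : UniformSpace} (f : T -> R) x c :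
  rcont f x -> (c < f x)%R -> locally x (fun t => (c < f t)%R).
Proof.
intros Hf Hc. apply Hf. exists (mkposreal (f x - c) ltac:(lra)).
intros y Hy. unfold ball in Hy; simpl in Hy; unfold AbsRing_ball, abs, minus, plus, opp in Hy; simpl in Hy.
apply Rabs_def2 in Hy. lra.
Qed.

Lemma rcont_near_lt {T : UniformSpace} (f : T -> R) x c :
  rcont f x -> (f x < c)%R -> locally x (fun t => (f t < c)%R).
Proof.
intros Hf Hc. assert (H := rcont_near (fun t => - f t)%R x (- c) (rcont_opp _ _ Hf)).
near_by (H ltac:(lra)); intros; lra.
Qed.

Lemma nearC_gt (f : CC -> R) (z : CC) c : rcontC f z -> (c < f z)%R -> nearC z (fun w => (c < f w)%R).
Proof. exact (rcont_near (T := C_UniformSpace) f z c). Qed.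

Lemma nearC_lt (f : CC -> R) (z : CC) c : rcontC f z -> (f z < c)%R -> nearC z (fun w => (f w < c)%R).
Proof. exact (rcont_near_lt (T := C_UniformSpace) f z c). Qed.

Lemma rcont_Cmod (z : CC) : rcontC Cmod z.
Proof.
apply (rcont_comp (T := C_UniformSpace) sqrt (fun w => fst w ^ 2 + snd w ^ 2)%R).
- apply rcont_plus; apply rcont_pow2; [apply rcont_Re|apply rcont_Im].
- apply continuity_pt_filterlim. apply continuous_sqrt.
Qed.

(** Caratheodory's form of complex differentiability: products, quotients and compositions
    reduce to continuity of the slope. *)
Definition hol (f : CC -> CC) (z : CC) : Prop :=
  exists q : CC -> CC, ccontC q z /\ forall w, f w = f z + q w * (w - z).

Lemma hol_cont f z : hol f z -> ccontC f z.
Proof.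
intros [q [Hq Hf]].
apply ccont_ext_loc with (fun w => f z + q w * (w - z)).
- apply filter_forall. intros; now rewrite <- Hf.
- apply ccont_plus; [apply ccont_const|apply ccont_mult; [exact Hq|]].
  apply ccont_minus; [apply ccont_id|apply ccont_const].
Qed.

Lemma hol_const c z : hol (fun _ => c) z.
Proof. exists (fun _ => 0). split; [apply ccont_const|intros; ring]. Qed.

Lemma hol_id z : hol (fun w => w) z.
Proof. exists (fun _ => 1). split; [apply ccont_const|intros; ring]. Qed.

Lemma hol_plus f g z : hol f z -> hol g z -> hol (fun w => f w + g w) z.
Proof.
intros [q [Hq Hf]] [r [Hr Hg]]. exists (fun w => q w + r w). split; [now apply ccont_plus|].
intros w. rewrite (Hf w), (Hg w). ring.
Qed.

Lemma hol_mult f g z : hol f z -> hol g z -> hol (fun w => f w * g w) z.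
Proof.
intros Hf0 Hg0. assert (Hf1 := hol_cont _ _ Hf0).
destruct Hf0 as [q [Hq Hf]]. destruct Hg0 as [r [Hr Hg]].
exists (fun w => q w * g z + f w * r w). split.
- apply ccont_plus; apply ccont_mult; try assumption. apply ccont_const.
- intros w. rewrite (Hg w), (Hf w). ring.
Qed.

Lemma hol_opp f z : hol f z -> hol (fun w => - f w) z.
Proof.
intros [q [Hq Hf]]. exists (fun w => - q w). split; [now apply ccont_opp|].
intros w. rewrite (Hf w). ring.
Qed.

Lemma hol_minus f g z : hol f z -> hol g z -> hol (fun w => f w - g w) z.
Proof. intros Hf Hg. apply hol_plus; [|apply hol_opp]; assumption. Qed.

Lemma hol_comp f g z : hol f (g z) -> hol g z -> hol (fun w => f (g w)) z.
Proof.
intros [q [Hq Hf]] Hg0. assert (Hg1 := hol_cont _ _ Hg0). destruct Hg0 as [r [Hr Hg]].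
exists (fun w => q (g w) * r w). split.
- apply ccont_mult; [|assumption]. now apply (ccont_comp q g).
- intros w. rewrite (Hf (g w)). rewrite (Hg w) at 2. ring.
Qed.

Lemma ccont_neq0 {T : UniformSpace} (f : T -> CC) x : ccont f x -> f x <> 0 -> locally x (fun w => f w <> 0).
Proof.
intros Hf Hx. apply Cmod_gt_0 in Hx.
assert (H := rcont_near (fun t => Cmod (f t)) x 0).
near_by (H (rcont_comp_C _ _ _ (rcont_Cmod _) Hf) Hx).
intros t Ht. now apply Cmod_gt_0.
Qed.

Ltac holo := repeat first [assumption | apply hol_const | apply hol_id | apply hol_opp
  | apply hol_minus | apply hol_plus | apply hol_mult]; auto.

(** The slope identity in [hol] holds for all w, so a function changed away from [z] needs a new
    slope: the difference quotient of [g], completed by [q z] at [z]. It agrees with [q] near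
    [z]. *)
Lemma hol_ext_loc f g z : nearC z (fun w => f w = g w) -> hol f z -> hol g z.
Proof.
intros H [q [Hq Hf]].
assert (Hz := locally_singleton _ _ H).
exists (fun w => if Ceq_dec w z then q z else (g w - g z) / (w - z)). split.
- apply ccont_ext_loc with q; [|assumption].
  near_by H. intros w Hw.
  destruct (Ceq_dec w z) as [->|Hn]; [reflexivity|].
  rewrite <- Hw, <- Hz, (Hf w). field. intros E. apply Hn. now apply Ceq_minus.
- intros w. destruct (Ceq_dec w z) as [->|Hn]; [ring|]. field.
  intros E. apply Hn. now apply Ceq_minus.
Qed.

Lemma hol_inv f z : hol f z -> f z <> 0 -> hol (fun w => / f w) z.
Proof.
intros Hf0 Hz. assert (Hf1 := hol_cont _ _ Hf0). destruct Hf0 as [q [Hq Hf]].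
assert (Hn : nearC z (fun w => f w <> 0)) by now apply ccont_neq0.
(* The slope must be total, so a vanishing value of [f] is replaced by 1; near [z] nothing
   changes. *)
apply hol_ext_loc with (fun w => / f z - (q w / ((if Ceq_dec (f w) 0 then 1 else f w) * f z)) * (w - z)).
- near_by Hn. intros w Hw. destruct (Ceq_dec (f w) 0) as [E|_]; [easy|].
  assert (E : q w * (w - z) = f w - f z) by (rewrite (Hf w); ring).
  replace (q w / (f w * f z) * (w - z)) with ((q w * (w - z)) / (f w * f z)) by (field; auto).
  rewrite E. field. auto.
- exists (fun w => - (q w / ((if Ceq_dec (f w) 0 then 1 else f w) * f z))). split.
  + apply ccont_opp, ccont_ext_loc with (fun w => q w / (f w * f z)).
    * near_by Hn. intros w Hw. now destruct (Ceq_dec (f w) 0).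
    * apply ccont_div; [assumption| |now apply Cmult_neq_0].
      apply ccont_mult; [assumption|apply ccont_const].
  + intros w. ring.
Qed.

Lemma hol_div f g z : hol f z -> hol g z -> g z <> 0 -> hol (fun w => f w / g w) z.
Proof. intros Hf Hg Hz. apply hol_mult; [|apply hol_inv]; assumption. Qed.

(** The slope is the difference quotient, with the prescribed value [l] at [z]. Keeping that value
    visible is what later makes the residue of the kernel computable. *)
Lemma hol_of_bound f z l :
  (forall e : R, (0 < e)%R ->
    nearC z (fun w => (Cmod (f w - f z - l * (w - z)) <= e * Cmod (w - z))%R)) ->
  exists q, ccontC q z /\ q z = l /\ forall w, f w = f z + q w * (w - z).
Proof.
intros Hl.
exists (fun w => if Ceq_dec w z then l else (f w - f z) / (w - z)). split; [|split].
- apply ccont_spec. intros e He. near_by (Hl (e / 2)%R ltac:(lra)). intros w Hw.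
  destruct (Ceq_dec z z) as [_|]; [|easy].
  destruct (Ceq_dec w z) as [->|Hn].
  + replace (l - l) with (RtoC 0) by ring. now rewrite Cmod_0.
  + assert (Hn' := Cminus_eq_contra _ _ Hn).
    replace ((f w - f z) / (w - z) - l) with ((f w - f z - l * (w - z)) / (w - z)) by (field; auto).
    rewrite Cmod_div by assumption. assert (0 < Cmod (w - z))%R by now apply Cmod_gt_0.
    apply Rle_lt_trans with (e / 2)%R; [|lra].
    apply (Rmult_le_reg_r (Cmod (w - z))); [assumption|]. unfold Rdiv at 1.
    rewrite Rmult_assoc, Rinv_l; lra.
- now destruct (Ceq_dec z z).
- intros w. destruct (Ceq_dec w z) as [->|Hn]; [ring|]. field.
  now apply Cminus_eq_contra.
Qed.

Lemma hol_spec f z :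
  hol f z <-> exists l, forall e : R, (0 < e)%R ->
    nearC z (fun w => (Cmod (f w - f z - l * (w - z)) <= e * Cmod (w - z))%R).
Proof.
split.
- intros [q [Hq Hf]]. exists (q z). intros e He.
  near_by (proj1 (ccont_spec q z) Hq e He). intros w Hw.
  rewrite (Hf w). replace (f z + q w * (w - z) - f z - q z * (w - z)) with ((q w - q z) * (w - z)) by ring.
  rewrite Cmod_mult. apply Rmult_le_compat_r; [apply Cmod_ge_0|lra].
- intros [l Hl]. destruct (hol_of_bound f z l Hl) as [q [Hq [_ Hf]]]. now exists q.
Qed.

(** Bridge to the derivative of the definitions: its neighbourhood filter comes from the modulus and
    not from the product structure, and [locally_C] identifies the two. *)
Lemma hol_ex_derive f z :
  @ex_derive C_AbsRing C_NormedModule f z <-> hol f z.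
Proof.
split.
- intros [l [_ H]]. apply hol_spec. exists l. intros e He.
  specialize (H z (fun P HP => HP) (mkposreal e He)). apply locally_C in H.
  revert H. apply filter_imp. intros w Hw. simpl in Hw.
  rewrite (Cmult_comm l). exact Hw.
- intros H. apply hol_spec in H. destruct H as [l Hl]. exists l. split.
  + apply (is_linear_scal_l (K := C_AbsRing) (V := C_NormedModule) l).
  + intros x Hx. assert (x = z) as ->.
    { symmetry. apply (is_filter_lim_locally_unique (K := C_AbsRing) (V := AbsRing_NormedModule C_AbsRing) z x Hx). }
    intros e. apply locally_C. near_by (Hl e (cond_pos e)). intros w Hw.
    rewrite (Cmult_comm l) in Hw. exact Hw.
Qed.

(** * Boundary integrals over rectangles and Goursat's theorem *)

Definition CInt (f : R -> CC) (a b : R) : CC :=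
  (RInt (fun t => Re (f t)) a b, RInt (fun t => Im (f t)) a b).

Definition cont_seg (f : R -> CC) (a b : R) : Prop :=
  forall t, (a <= t <= b)%R -> ccontR f t.

Lemma rcont_ex_RInt (f : R -> R) a b : (a <= b)%R ->
  (forall t, (a <= t <= b)%R -> rcont (T := R_UniformSpace) f t) -> ex_RInt f a b.
Proof.
intros Hab H. apply (ex_RInt_continuous (V := R_CompleteNormedModule)).
rewrite Rmin_left, Rmax_right by assumption. exact H.
Qed.

Lemma cont_seg_Re f a b : (a <= b)%R -> cont_seg f a b -> ex_RInt (fun t => Re (f t)) a b.
Proof. intros Hab H. apply rcont_ex_RInt; [assumption|]. intros t Ht. apply (H t Ht). Qed.

Lemma cont_seg_Im f a b : (a <= b)%R -> cont_seg f a b -> ex_RInt (fun t => Im (f t)) a b.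
Proof. intros Hab H. apply rcont_ex_RInt; [assumption|]. intros t Ht. apply (H t Ht). Qed.

Lemma C_eq (z w : CC) : Re z = Re w -> Im z = Im w -> z = w.
Proof. destruct z, w; simpl; intros -> ->; reflexivity. Qed.

Lemma CInt_ext f g a b : (a <= b)%R ->
  (forall t, (a <= t <= b)%R -> f t = g t) -> CInt f a b = CInt g a b.
Proof.
intros Hab H. unfold CInt. f_equal; apply RInt_ext; intros t Ht;
  rewrite Rmin_left, Rmax_right in Ht by assumption; rewrite H; auto; lra.
Qed.

Lemma CInt_const c a b : CInt (fun _ => c) a b = RtoC (b - a) * c.
Proof.
unfold CInt. rewrite !RInt_const. destruct c; unfold scal, mult, Cmult, RtoC; simpl; unfold mult; simpl; f_equal; ring.
Qed.

Lemma CInt_plus f g a b : (a <= b)%R -> cont_seg f a b -> cont_seg g a b ->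
  CInt (fun t => f t + g t) a b = CInt f a b + CInt g a b.
Proof.
intros Hab Hf Hg. unfold CInt, Cplus; simpl. f_equal.
- apply (RInt_plus (V := R_CompleteNormedModule) (fun t => Re (f t)) (fun t => Re (g t)));
    now apply cont_seg_Re.
- apply (RInt_plus (V := R_CompleteNormedModule) (fun t => Im (f t)) (fun t => Im (g t)));
    now apply cont_seg_Im.
Qed.

Lemma CInt_scal c f a b : (a <= b)%R -> cont_seg f a b ->
  CInt (fun t => c * f t) a b = c * CInt f a b.
Proof.
intros Hab Hf. assert (H1 := cont_seg_Re _ _ _ Hab Hf). assert (H2 := cont_seg_Im _ _ _ Hab Hf).
assert (S1 : forall k, RInt (fun t => k * Re (f t))%R a b = (k * RInt (fun t => Re (f t)) a b)%R)
  by (intros k; exact (RInt_scal (V := R_CompleteNormedModule) (fun t => Re (f t)) a b k H1)).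
assert (S2 : forall k, RInt (fun t => k * Im (f t))%R a b = (k * RInt (fun t => Im (f t)) a b)%R)
  by (intros k; exact (RInt_scal (V := R_CompleteNormedModule) (fun t => Im (f t)) a b k H2)).
assert (X1 : forall k, ex_RInt (fun t => k * Re (f t))%R a b)
  by (intros k; exact (ex_RInt_scal (V := R_NormedModule) _ a b k H1)).
assert (X2 : forall k, ex_RInt (fun t => k * Im (f t))%R a b)
  by (intros k; exact (ex_RInt_scal (V := R_NormedModule) _ a b k H2)).
unfold CInt, Cmult; simpl. f_equal.
- rewrite <- S1, <- S2. exact (RInt_minus (V := R_CompleteNormedModule) _ _ a b (X1 _) (X2 _)).
- rewrite <- S1, <- S2, Rplus_comm. rewrite <- (RInt_plus (V := R_CompleteNormedModule) _ _ a b (X1 _) (X2 _)).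
  apply RInt_ext. intros. apply Rplus_comm.
Qed.

Lemma cont_seg_const c a b : cont_seg (fun _ => c) a b.
Proof. intros t _. apply ccont_const. Qed.

Lemma cont_seg_scal c f a b : cont_seg f a b -> cont_seg (fun t => c * f t) a b.
Proof. intros H t Ht. apply ccont_mult; [apply ccont_const|auto]. Qed.

Lemma CInt_minus f g a b : (a <= b)%R -> cont_seg f a b -> cont_seg g a b ->
  CInt (fun t => f t - g t) a b = CInt f a b - CInt g a b.
Proof.
intros Hab Hf Hg.
rewrite (CInt_ext _ (fun t => f t + (-(1)) * g t)) by (auto; intros; ring).
rewrite CInt_plus, CInt_scal; auto using cont_seg_scal. ring.
Qed.

Lemma CInt_Chasles f a b c : (a <= b)%R -> (b <= c)%R -> cont_seg f a c ->
  CInt f a c = CInt f a b + CInt f b c.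
Proof.
intros Hab Hbc Hf.
assert (H1 : cont_seg f a b) by (intros t Ht; apply Hf; lra).
assert (H2 : cont_seg f b c) by (intros t Ht; apply Hf; lra).
unfold CInt, Cplus; simpl. f_equal; symmetry.
- apply (RInt_Chasles (V := R_CompleteNormedModule) (fun t => Re (f t))); now apply cont_seg_Re.
- apply (RInt_Chasles (V := R_CompleteNormedModule) (fun t => Im (f t))); now apply cont_seg_Im.
Qed.

(** The factor 2 comes from bounding the two components separately. *)
Lemma CInt_bound f a b M : (a <= b)%R -> cont_seg f a b ->
  (forall t, (a <= t <= b)%R -> (Cmod (f t) <= M)%R) -> (Cmod (CInt f a b) <= 2 * M * (b - a))%R.
Proof.
intros Hab Hf HM. eapply Rle_trans; [apply Cmod_le_ReIm|]. unfold CInt; simpl.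
assert (Rabs (RInt (fun t => Re (f t)) a b) <= (b - a) * M)%R.
{ apply abs_RInt_le_const; [assumption|now apply cont_seg_Re|].
  intros t Ht. eapply Rle_trans; [apply Re_le_Cmod|auto]. }
assert (Rabs (RInt (fun t => Im (f t)) a b) <= (b - a) * M)%R.
{ apply abs_RInt_le_const; [assumption|now apply cont_seg_Im|].
  intros t Ht. eapply Rle_trans; [apply Im_le_Cmod|auto]. }
lra.
Qed.

Lemma CInt_shift f a b u : (a <= b)%R -> cont_seg f (a + u) (b + u) ->
  CInt (fun t => f (t + u)%R) a b = CInt f (a + u) (b + u).
Proof.
intros Hab Hf.
assert (Hab' : (a + u <= b + u)%R) by lra.
unfold CInt. f_equal.
- assert (H := RInt_comp_lin (V := R_CompleteNormedModule) (fun t => Re (f t)) 1 u a b).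
  rewrite !Rmult_1_l in H. rewrite <- H by now apply cont_seg_Re.
  apply RInt_ext. intros t _. change (Re (f (t + u)%R) = 1 * Re (f (1 * t + u)%R))%R. now rewrite !Rmult_1_l.
- assert (H := RInt_comp_lin (V := R_CompleteNormedModule) (fun t => Im (f t)) 1 u a b).
  rewrite !Rmult_1_l in H. rewrite <- H by now apply cont_seg_Im.
  apply RInt_ext. intros t _. change (Im (f (t + u)%R) = 1 * Im (f (1 * t + u)%R))%R. now rewrite !Rmult_1_l.
Qed.

Lemma rcontR_id (x : R) : rcont (T := R_UniformSpace) (fun t : R => t) x.
Proof. exact (continuous_id (U := R_UniformSpace) x). Qed.

Lemma ccont_hline (y t : R) : ccontR (fun t => (t, y) : CC) t.
Proof. split; simpl; [apply rcontR_id|apply rcont_const]. Qed.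

Lemma ccont_vline (x t : R) : ccontR (fun t => (x, t) : CC) t.
Proof. split; simpl; [apply rcont_const|apply rcontR_id]. Qed.

Lemma cont_hseg f a b y : (forall t, (a <= t <= b)%R -> ccontC f (t, y)) ->
  cont_seg (fun t => f (t, y)) a b.
Proof. intros H t Ht. apply (ccont_comp f (fun t => (t, y))); [now apply H|apply ccont_hline]. Qed.

Lemma cont_vseg f x c d : (forall t, (c <= t <= d)%R -> ccontC f (x, t)) ->
  cont_seg (fun t => f (x, t)) c d.
Proof. intros H t Ht. apply (ccont_comp f (fun t => (x, t))); [now apply H|apply ccont_vline]. Qed.

(** Counterclockwise boundary integral over [[a,b] x [c,d]]. *)
Definition box (f : CC -> CC) (a b c d : R) : CC :=
  CInt (fun t => f (t, c)) a b - CInt (fun t => f (t, d)) a b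
  + Ci * (CInt (fun t => f (b, t)) c d - CInt (fun t => f (a, t)) c d).

Definition bdry (a b c d : R) (z : CC) : Prop :=
  (a <= Re z <= b /\ c <= Im z <= d /\ (Re z = a \/ Re z = b \/ Im z = c \/ Im z = d))%R.

Definition cont_bdry f a b c d : Prop := forall z, bdry a b c d z -> ccontC f z.

Lemma cont_bdry_bot f a b c d : (a <= b)%R -> (c <= d)%R -> cont_bdry f a b c d ->
  cont_seg (fun t => f (t, c)) a b.
Proof. intros Hab Hcd H. apply cont_hseg. intros t Ht. apply H. unfold bdry; simpl; lra. Qed.
Lemma cont_bdry_top f a b c d : (a <= b)%R -> (c <= d)%R -> cont_bdry f a b c d ->
  cont_seg (fun t => f (t, d)) a b.
Proof. intros Hab Hcd H. apply cont_hseg. intros t Ht. apply H. unfold bdry; simpl; lra. Qed.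
Lemma cont_bdry_left f a b c d : (a <= b)%R -> (c <= d)%R -> cont_bdry f a b c d ->
  cont_seg (fun t => f (a, t)) c d.
Proof. intros Hab Hcd H. apply cont_vseg. intros t Ht. apply H. unfold bdry; simpl; lra. Qed.
Lemma cont_bdry_right f a b c d : (a <= b)%R -> (c <= d)%R -> cont_bdry f a b c d ->
  cont_seg (fun t => f (b, t)) c d.
Proof. intros Hab Hcd H. apply cont_vseg. intros t Ht. apply H. unfold bdry; simpl; lra. Qed.

Global Hint Resolve cont_bdry_bot cont_bdry_top cont_bdry_left cont_bdry_right : cbd.

Lemma box_ext f g a b c d : (a <= b)%R -> (c <= d)%R ->
  (forall z, bdry a b c d z -> f z = g z) -> box f a b c d = box g a b c d.
Proof.
intros Hab Hcd H. unfold box.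
rewrite (CInt_ext (fun t => f (t, c)) (fun t => g (t, c))), (CInt_ext (fun t => f (t, d)) (fun t => g (t, d))),
  (CInt_ext (fun t => f (b, t)) (fun t => g (b, t))), (CInt_ext (fun t => f (a, t)) (fun t => g (a, t)));
  try reflexivity; try assumption; intros t Ht; apply H; unfold bdry; simpl; lra.
Qed.

Lemma box_plus f g a b c d : (a <= b)%R -> (c <= d)%R -> cont_bdry f a b c d -> cont_bdry g a b c d ->
  box (fun z => f z + g z) a b c d = box f a b c d + box g a b c d.
Proof.
intros Hab Hcd Hf Hg. unfold box.
rewrite (CInt_plus (fun t => f (t, c))), (CInt_plus (fun t => f (t, d))),
  (CInt_plus (fun t => f (b, t))), (CInt_plus (fun t => f (a, t))); eauto with cbd. ring.
Qed.

Lemma box_scal k f a b c d : (a <= b)%R -> (c <= d)%R -> cont_bdry f a b c d ->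
  box (fun z => k * f z) a b c d = k * box f a b c d.
Proof.
intros Hab Hcd Hf. unfold box.
rewrite (CInt_scal k (fun t => f (t, c))), (CInt_scal k (fun t => f (t, d))),
  (CInt_scal k (fun t => f (b, t))), (CInt_scal k (fun t => f (a, t))); eauto with cbd. ring.
Qed.

Lemma cont_bdry_scal k f a b c d : cont_bdry f a b c d -> cont_bdry (fun z => k * f z) a b c d.
Proof. intros H z Hz. apply ccont_mult; [apply ccont_const|auto]. Qed.

Lemma box_minus f g a b c d : (a <= b)%R -> (c <= d)%R -> cont_bdry f a b c d -> cont_bdry g a b c d ->
  box (fun z => f z - g z) a b c d = box f a b c d - box g a b c d.
Proof.
intros Hab Hcd Hf Hg.
rewrite (box_ext _ (fun z => f z + (-(1)) * g z)) by (auto; intros; ring).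
rewrite box_plus, box_scal; auto using cont_bdry_scal. ring.
Qed.

Lemma box_bound f a b c d M : (a <= b)%R -> (c <= d)%R -> cont_bdry f a b c d ->
  (forall z, bdry a b c d z -> (Cmod (f z) <= M)%R) ->
  (Cmod (box f a b c d) <= 4 * M * ((b - a) + (d - c)))%R.
Proof.
intros Hab Hcd Hf HM. unfold box.
assert (T1 := CInt_bound (fun t => f (t, c)) a b M Hab). assert (T2 := CInt_bound (fun t => f (t, d)) a b M Hab).
assert (T3 := CInt_bound (fun t => f (b, t)) c d M Hcd). assert (T4 := CInt_bound (fun t => f (a, t)) c d M Hcd).
assert (B : forall z1 z2 z3 z4 : CC, (Cmod (z1 - z2 + Ci * (z3 - z4)) <= Cmod z1 + Cmod z2 + Cmod z3 + Cmod z4)%R).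
{ intros. eapply Rle_trans; [apply Cmod_triangle|]. rewrite Cmod_mult, Cmod_Ci, Rmult_1_l.
  assert (Q1 := Cmod_triangle z1 (- z2)). assert (Q2 := Cmod_triangle z3 (- z4)).
  rewrite Cmod_opp in Q1, Q2. unfold Cminus. lra. }
eapply Rle_trans; [apply B|].
assert (Cmod (CInt (fun t => f (t, c)) a b) <= 2 * M * (b - a))%R.
{ apply T1; eauto with cbd. intros t Ht; apply HM; unfold bdry; simpl; lra. }
assert (Cmod (CInt (fun t => f (t, d)) a b) <= 2 * M * (b - a))%R.
{ apply T2; eauto with cbd. intros t Ht; apply HM; unfold bdry; simpl; lra. }
assert (Cmod (CInt (fun t => f (b, t)) c d) <= 2 * M * (d - c))%R.
{ apply T3; eauto with cbd. intros t Ht; apply HM; unfold bdry; simpl; lra. }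
assert (Cmod (CInt (fun t => f (a, t)) c d) <= 2 * M * (d - c))%R.
{ apply T4; eauto with cbd. intros t Ht; apply HM; unfold bdry; simpl; lra. }
lra.
Qed.

Lemma box_split_x f a m b c d : (a <= m)%R -> (m <= b)%R -> (c <= d)%R ->
  cont_bdry f a m c d -> cont_bdry f m b c d ->
  box f a b c d = box f a m c d + box f m b c d.
Proof.
intros H1 H2 Hcd Hf Hg. unfold box.
rewrite (CInt_Chasles (fun t => f (t, c)) a m b), (CInt_Chasles (fun t => f (t, d)) a m b); try assumption.
- ring.
- intros t Ht. destruct (Rle_dec t m); [apply (cont_bdry_top f a m c d)|apply (cont_bdry_top f m b c d)]; auto; lra.
- intros t Ht. destruct (Rle_dec t m); [apply (cont_bdry_bot f a m c d)|apply (cont_bdry_bot f m b c d)]; auto; lra.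
Qed.

Lemma box_split_y f a b c m d : (a <= b)%R -> (c <= m)%R -> (m <= d)%R ->
  cont_bdry f a b c m -> cont_bdry f a b m d ->
  box f a b c d = box f a b c m + box f a b m d.
Proof.
intros Hab H1 H2 Hf Hg. unfold box.
rewrite (CInt_Chasles (fun t => f (b, t)) c m d), (CInt_Chasles (fun t => f (a, t)) c m d); try assumption.
- ring.
- intros t Ht. destruct (Rle_dec t m); [apply (cont_bdry_left f a b c m)|apply (cont_bdry_left f a b m d)]; auto; lra.
- intros t Ht. destruct (Rle_dec t m); [apply (cont_bdry_right f a b c m)|apply (cont_bdry_right f a b m d)]; auto; lra.
Qed.

(** Opposite sides are translates of each other, so the integrand differs by a constant on each
    pair; the two resulting multiples of (b - a) (d - c) i cancel. *)
Lemma box_affine (al be : CC) a b c d : (a <= b)%R -> (c <= d)%R ->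
  box (fun z => al + be * z) a b c d = 0.
Proof.
intros Hab Hcd. unfold box.
assert (K : forall g : R -> CC, (forall t, ccontR g t) -> forall u v, cont_seg (fun t => al + be * g t) u v).
{ intros g Hg u v t _. apply ccont_plus; [apply ccont_const|apply ccont_mult; [apply ccont_const|apply Hg]]. }
rewrite <- (CInt_minus (fun t => al + be * (t, c)) (fun t => al + be * (t, d)) a b Hab)
  by (apply K; intros; apply ccont_hline).
rewrite <- (CInt_minus (fun t => al + be * (b, t)) (fun t => al + be * (a, t)) c d Hcd)
  by (apply K; intros; apply ccont_vline).
rewrite (CInt_ext _ (fun _ => be * (RtoC (c - d) * Ci)) a b Hab).
2:{ intros t _. replace ((t, c) : CC) with ((t, d) + RtoC (c - d) * Ci); [ring|].
    unfold Cplus, Cmult, RtoC, Ci; simpl; f_equal; ring. }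
rewrite (CInt_ext _ (fun _ => be * RtoC (b - a)) c d Hcd).
2:{ intros t _. replace ((b, t) : CC) with ((a, t) + RtoC (b - a)); [ring|].
    unfold Cplus, Cmult, RtoC, Ci; simpl; f_equal; ring. }
rewrite !CInt_const. rewrite !RtoC_minus. ring.
Qed.

Definition hol_rect f a b c d : Prop :=
  forall z, (a <= Re z <= b)%R -> (c <= Im z <= d)%R -> hol f z.

Lemma hol_rect_bdry f a b c d : hol_rect f a b c d -> cont_bdry f a b c d.
Proof. intros H z [H1 [H2 _]]. apply hol_cont. now apply H. Qed.

Lemma hol_rect_sub f a b c d a' b' c' d' : (a <= a')%R -> (b' <= b)%R -> (c <= c')%R -> (d' <= d)%R ->
  hol_rect f a b c d -> hol_rect f a' b' c' d'.
Proof. intros ? ? ? ? H z H1 H2. apply H; lra. Qed.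

(** The common point is the limit of the increasing left ends; it stays below every right end
    because these decrease. *)
Lemma nested_intervals (a : nat -> R) (w : R) :
  (forall n, a n <= a (S n))%R -> (forall n, a (S n) + w / 2 ^ (S n) <= a n + w / 2 ^ n)%R -> (0 <= w)%R ->
  exists l, forall n, (a n <= l <= a n + w / 2 ^ n)%R.
Proof.
intros H1 H2 Hw.
assert (Hpos : forall n, (0 <= w / 2 ^ n)%R).
{ intros n. apply Rmult_le_pos; [assumption|]. left. apply Rinv_0_lt_compat, pow_lt; lra. }
assert (U : forall k n, (a (k + n)%nat + w / 2 ^ (k + n) <= a n + w / 2 ^ n)%R).
{ induction k as [|k IH]; intros n; simpl Nat.add; [lra|]. eapply Rle_trans; [apply H2|]. apply IH. }
assert (L : forall k n, (a n <= a (k + n)%nat)%R).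
{ induction k as [|k IH]; intros n; simpl Nat.add; [lra|]. eapply Rle_trans; [apply IH|]. apply H1. }
destruct (ex_finite_lim_seq_incr a (a O + w / 2 ^ 0)%R H1) as [l Hl].
{ intros n. specialize (U n O). rewrite !Nat.add_0_r in U. specialize (Hpos n). lra. }
exists l. intros n. split.
- apply (is_lim_seq_incr_compare a l Hl H1).
- assert (Hl' : is_lim_seq (fun k => a (k + n)%nat) l) by now apply is_lim_seq_incr_n.
  apply (is_lim_seq_le (fun k => a (k + n)%nat) (fun _ => a n + w / 2 ^ n)%R l (a n + w / 2 ^ n)%R); auto.
  + intros k. specialize (U k n). specialize (Hpos (k + n)%nat). lra.
  + apply is_lim_seq_const.
Qed.

(** * Goursat's theorem by bisection *)

Section Goursat.
Variables (f : CC -> CC) (a0 c0 w h e : R).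
Hypotheses (Hw : (0 <= w)%R) (Hh : (0 <= h)%R) (He : (0 < e)%R).
Hypothesis Hf : hol_rect f a0 (a0 + w) c0 (c0 + h).

Let W n := (w / 2 ^ n)%R.
Let H n := (h / 2 ^ n)%R.

(** A subrectangle of depth [n], given by its lower left corner, with too large a boundary integral.
    The threshold is quadratic in the size, e (2u + 2v)^2 = 4 e (u + v)^2, so one of four quarters
    of a bad rectangle is bad. *)
Let bad (n : nat) (p : R * R) : Prop :=
  (a0 <= fst p /\ fst p + W n <= a0 + w /\ c0 <= snd p /\ snd p + H n <= c0 + h /\
   e * (W n + H n) ^ 2 < Cmod (box f (fst p) (fst p + W n) (snd p) (snd p + H n)))%R.

Lemma goursat_step n p : bad n p -> exists q, bad (S n) q /\
  (fst p <= fst q /\ fst q + W (S n) <= fst p + W n /\ snd p <= snd q /\ snd q + H (S n) <= snd p + H n)%R.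
Proof.
intros [B1 [B2 [B3 [B4 B5]]]]. destruct p as [a c]; simpl in *.
assert (P2 : (0 < 2 ^ n)%R) by (apply pow_lt; lra).
assert (EW : (W n = 2 * W (S n))%R) by (unfold W; simpl; field; lra).
assert (EH : (H n = 2 * H (S n))%R) by (unfold H; simpl; field; lra).
assert (PW : (0 <= W (S n))%R).
{ unfold W. apply Rmult_le_pos; [assumption|]. left. apply Rinv_0_lt_compat, pow_lt; lra. }
assert (PH : (0 <= H (S n))%R).
{ unfold H. apply Rmult_le_pos; [assumption|]. left. apply Rinv_0_lt_compat, pow_lt; lra. }
set (u := W (S n)) in *. set (v := H (S n)) in *. rewrite EW, EH in *.
destruct (excluded_middle_informative (exists q, bad (S n) q /\
  (a <= fst q /\ fst q + u <= a + 2 * u /\ c <= snd q /\ snd q + v <= c + 2 * v)%R)) as [Y|N]; [exact Y|].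
exfalso.
assert (G : forall x y, (a <= x)%R -> (x + u <= a + 2 * u)%R -> (c <= y)%R -> (y + v <= c + 2 * v)%R ->
  (Cmod (box f x (x + u) y (y + v)) <= e * (u + v) ^ 2)%R).
{ intros x y X1 X2 Y1 Y2. apply Rnot_lt_le. intros Hlt. apply N. exists (x, y).
  unfold bad; simpl. fold u v. repeat split; try lra. }
assert (Hc : forall a' b' c' d', (a <= a')%R -> (b' <= a + 2 * u)%R -> (c <= c')%R -> (d' <= c + 2 * v)%R ->
  cont_bdry f a' b' c' d').
{ intros. apply hol_rect_bdry. apply hol_rect_sub with (5 := Hf); lra. }
rewrite (box_split_x f a (a + u) (a + 2 * u)) in B5; try lra; try (apply Hc; lra).
rewrite (box_split_y f a (a + u) c (c + v) (c + 2 * v)) in B5; try lra; try (apply Hc; lra).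
rewrite (box_split_y f (a + u) (a + 2 * u) c (c + v) (c + 2 * v)) in B5; try lra; try (apply Hc; lra).
assert (G1 := G a c ltac:(lra) ltac:(lra) ltac:(lra) ltac:(lra)).
assert (G2 := G a (c + v)%R ltac:(lra) ltac:(lra) ltac:(lra) ltac:(lra)).
assert (G3 := G (a + u)%R c ltac:(lra) ltac:(lra) ltac:(lra) ltac:(lra)).
assert (G4 := G (a + u)%R (c + v)%R ltac:(lra) ltac:(lra) ltac:(lra) ltac:(lra)).
replace (c + v + v)%R with (c + 2 * v)%R in * by ring.
replace (a + u + u)%R with (a + 2 * u)%R in * by ring.
assert (T : forall z1 z2 z3 z4 : CC, (Cmod (z1 + z2 + (z3 + z4)) <= Cmod z1 + Cmod z2 + Cmod z3 + Cmod z4)%R).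
{ intros. eapply Rle_trans; [apply Cmod_triangle|].
  assert (Q1 := Cmod_triangle z1 z2). assert (Q2 := Cmod_triangle z3 z4). lra. }
apply (Rlt_irrefl (e * (2 * u + 2 * v) ^ 2)).
eapply Rlt_le_trans; [exact B5|]. eapply Rle_trans; [apply T|].
replace (e * (2 * u + 2 * v) ^ 2)%R with (4 * (e * (u + v) ^ 2))%R by ring. lra.
Qed.

Let next n (s : {p | bad n p}) : {p | bad (S n) p} :=
  let t := constructive_indefinite_description _ (goursat_step n (proj1_sig s) (proj2_sig s)) in
  exist _ (proj1_sig t) (proj1 (proj2_sig t)).

Lemma goursat_bound : (Cmod (box f a0 (a0 + w) c0 (c0 + h)) <= e * (w + h) ^ 2)%R.
Proof.
apply Rnot_lt_le. intros Hbad.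
assert (E0 : bad 0 (a0, c0)).
{ unfold bad, W, H; simpl. rewrite !Rdiv_1_r. repeat split; try lra. }
pose (s := fix s n : {p | bad n p} := match n with O => exist _ _ E0 | S n => next n (s n) end).
assert (St : forall n, (fst (proj1_sig (s n)) <= fst (proj1_sig (s (S n))) /\
   fst (proj1_sig (s (S n))) + W (S n) <= fst (proj1_sig (s n)) + W n /\
   snd (proj1_sig (s n)) <= snd (proj1_sig (s (S n))) /\
   snd (proj1_sig (s (S n))) + H (S n) <= snd (proj1_sig (s n)) + H n)%R).
{ intros n. simpl s. unfold next.
  destruct (constructive_indefinite_description _ (goursat_step n (proj1_sig (s n)) (proj2_sig (s n)))) as [q Hq].
  simpl. apply Hq. }
destruct (nested_intervals (fun n => fst (proj1_sig (s n))) w) as [x Hx]; [apply St|apply St|assumption|].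
destruct (nested_intervals (fun n => snd (proj1_sig (s n))) h) as [y Hy]; [apply St|apply St|assumption|].
assert (Hp : hol f (x, y)).
{ assert (X := Hx O). assert (Y := Hy O). simpl in X, Y. rewrite Rdiv_1_r in X, Y. apply Hf; simpl; lra. }
(* The factor 4 of [box_bound] is absorbed here, so that the final bound is exactly the threshold of
   [bad]. *)
apply hol_spec in Hp. destruct Hp as [l Hl]. specialize (Hl (e / 4)%R ltac:(lra)).
apply nearC_spec in Hl. destruct Hl as [d [Hd Hl]].
destruct (Req_dec (w + h) 0) as [Z|Z].
{ assert (W0 : w = 0%R) by lra. assert (H0 : h = 0%R) by lra.
  rewrite W0, H0, !Rplus_0_r in Hbad.
  assert (Bx : box f a0 a0 c0 c0 = 0).
  { unfold box, CInt. rewrite !RInt_point. unfold zero; simpl. unfold Cminus, Cplus, Cmult, Copp, Ci, RtoC; simpl. f_equal; ring. }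
  rewrite Bx, Cmod_0 in Hbad. lra. }
destruct (is_lim_seq_spec (fun n => (w + h) * (/ 2) ^ n)%R 0) as [_ Lim].
assert (L0 : is_lim_seq (fun n => (w + h) * (/ 2) ^ n)%R 0).
{ replace (Finite 0) with (Rbar_mult (w + h)%R 0%R) by (simpl; f_equal; ring).
  apply is_lim_seq_scal_l. apply is_lim_seq_geom. rewrite Rabs_pos_eq; lra. }
destruct (Lim L0 (mkposreal d Hd)) as [n Hn]. specialize (Hn n (le_n _)). simpl in Hn.
rewrite Rminus_0_r, pow_inv in Hn. apply Rabs_def2 in Hn.
assert (P2 : (0 < / 2 ^ n)%R) by (apply Rinv_0_lt_compat, pow_lt; lra).
destruct (s n) as [[a c] [B1 [B2 [B3 [B4 B5]]]]] eqn:Es. simpl in B1, B2, B3, B4, B5.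
specialize (Hx n). specialize (Hy n). rewrite Es in Hx, Hy. simpl in Hx, Hy. fold (W n) in Hx. fold (H n) in Hy.
assert (PW : (0 <= W n)%R) by (unfold W, Rdiv; apply Rmult_le_pos; lra).
assert (PH : (0 <= H n)%R) by (unfold H, Rdiv; apply Rmult_le_pos; lra).
assert (SWH : (W n + H n = (w + h) * / 2 ^ n)%R) by (unfold W, H, Rdiv; ring).
assert (Pd : forall z, bdry a (a + W n) c (c + H n) z -> (Cmod (z - (x, y)) <= W n + H n)%R).
{ intros z [Z1 [Z2 _]]. eapply Rle_trans; [apply Cmod_le_ReIm|].
  change (Re (z - (x, y))) with (Re z - x)%R. change (Im (z - (x, y))) with (Im z - y)%R.
  apply Rplus_le_compat; apply Rabs_le; lra. }
assert (Cf : cont_bdry f a (a + W n) c (c + H n)).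
{ apply hol_rect_bdry. apply hol_rect_sub with (5 := Hf); lra. }
assert (Ca : cont_bdry (fun z => (f (x, y) - l * (x, y)) + l * z) a (a + W n) c (c + H n)).
{ intros z _. apply ccont_plus; [apply ccont_const|]. apply ccont_mult; [apply ccont_const|apply ccont_id]. }
(* The affine part has zero boundary integral, so only the first-order remainder at the limit point
   contributes. *)
assert (Bd : (Cmod (box (fun z => f z - ((f (x, y) - l * (x, y)) + l * z))%C a (a + W n) c (c + H n))
   <= 4 * (e / 4 * (W n + H n)) * ((a + W n - a) + (c + H n - c)))%R).
{ apply box_bound; try lra.
  - intros z Hz. apply ccont_minus; [apply Cf|apply Ca]; assumption.
  - intros z Hz. specialize (Pd z Hz).
    replace (f z - (f (x, y) - l * (x, y) + l * z)) with (f z - f (x, y) - l * (z - (x, y))) by ring.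
    eapply Rle_trans; [apply Hl; lra|]. apply Rmult_le_compat_l; lra. }
rewrite box_minus in Bd; try assumption; try lra. rewrite box_affine in Bd by lra.
replace (box f a (a + W n) c (c + H n) - 0) with (box f a (a + W n) c (c + H n)) in Bd by ring.
replace (4 * (e / 4 * (W n + H n)) * ((a + W n - a) + (c + H n - c)))%R with (e * (W n + H n) ^ 2)%R in Bd by field.
lra.
Qed.
End Goursat.

Lemma Cmod_le_all_0 (z : CC) (K : R) : (forall e, (0 < e)%R -> (Cmod z <= e * K)%R) -> z = 0.
Proof.
intros H. apply Cmod_eq_0. apply Rle_antisym; [|apply Cmod_ge_0].
apply Rnot_lt_le. intros Hz.
assert (HK : (0 < K)%R).
{ specialize (H 1%R ltac:(lra)). lra. }
specialize (H (Cmod z / (2 * K))%R).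
assert (0 < Cmod z / (2 * K))%R by (apply Rdiv_lt_0_compat; lra).
specialize (H H0). replace (Cmod z / (2 * K) * K)%R with (Cmod z / 2)%R in H by (field; lra). lra.
Qed.

Theorem goursat f a b c d : (a <= b)%R -> (c <= d)%R -> hol_rect f a b c d -> box f a b c d = 0.
Proof.
intros Hab Hcd Hf. apply (Cmod_le_all_0 _ (((b - a) + (d - c)) ^ 2)). intros e He.
assert (G := goursat_bound f a c (b - a) (d - c) e).
replace (a + (b - a))%R with b in G by ring. replace (c + (d - c))%R with d in G by ring.
apply G; auto; lra.
Qed.

(** Removable singularity: Goursat disposes of everything but a small square of half side n about
    [z0]. On its boundary |f| is at most e / n, and [box_bound] gives 4 (e / n) (4 n) = 16 e. *)
Lemma box_exceptional f r z0 a b c d :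
  (a < Re z0 < b)%R -> (c < Im z0 < d)%R ->
  (forall z, (a <= Re z <= b)%R -> (c <= Im z <= d)%R -> z <> z0 -> hol f z) ->
  ccontC r z0 -> r z0 = 0 ->
  nearC z0 (fun z => z <> z0 -> f z * (z - z0) = r z) ->
  box f a b c d = 0.
Proof.
intros Ha Hc Hf Hr Hr0 Hfr. apply (Cmod_le_all_0 _ 16). intros e He.
assert (N := filter_and _ _ Hfr (proj1 (ccont_spec _ _) Hr e He)).
apply nearC_spec in N. destruct N as [dl [Hdl N]].
set (x := Re z0) in *. set (y := Im z0) in *.
assert (Hz0 : z0 = (x, y)) by (unfold x, y; now destruct z0).
(* Quarters keep the square strictly inside the rectangle and, its points being within 2 n of [z0],
   inside the disc of radius [dl]. *)
pose (n := (Rmin (Rmin (x - a) (b - x)) (Rmin (Rmin (y - c) (d - y)) dl) / 4)%R).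
assert (Hn : (0 < n /\ n <= (x - a) / 4 /\ n <= (b - x) / 4 /\ n <= (y - c) / 4 /\ n <= (d - y) / 4 /\ n <= dl / 4)%R).
{ assert (Q1 := Rmin_l (Rmin (x - a) (b - x)) (Rmin (Rmin (y - c) (d - y)) dl)).
  assert (Q2 := Rmin_r (Rmin (x - a) (b - x)) (Rmin (Rmin (y - c) (d - y)) dl)).
  assert (Q3 := Rmin_l (x - a) (b - x)). assert (Q4 := Rmin_r (x - a) (b - x)).
  assert (Q5 := Rmin_l (Rmin (y - c) (d - y)) dl). assert (Q6 := Rmin_r (Rmin (y - c) (d - y)) dl).
  assert (Q7 := Rmin_l (y - c) (d - y)). assert (Q8 := Rmin_r (y - c) (d - y)).
  unfold n. split; [|lra].
  apply Rdiv_lt_0_compat; [|lra]. repeat apply Rmin_pos; lra. }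
destruct Hn as [Hn [N1 [N2 [N3 [N4 N5]]]]]. clearbody n.
assert (HG : forall a' b' c' d', (a <= a')%R -> (b' <= b)%R -> (c <= c')%R -> (d' <= d)%R ->
   (b' < x \/ x < a' \/ d' < y \/ y < c')%R -> hol_rect f a' b' c' d').
{ intros a' b' c' d' ? ? ? ? Ho z Z1 Z2. apply Hf; try lra. intros ->. fold x y in Z1, Z2. lra. }
assert (HB : forall a' b' c' d', (a <= a')%R -> (b' <= b)%R -> (c <= c')%R -> (d' <= d)%R ->
   (x <> a' /\ x <> b' /\ y <> c' /\ y <> d')%R -> cont_bdry f a' b' c' d').
{ intros a' b' c' d' ? ? ? ? Ho z [Z1 [Z2 Z3]]. apply hol_cont, Hf; try lra. intros ->. fold x y in Z1, Z2, Z3. lra. }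
rewrite (box_split_x f a (x - n) b), (box_split_x f (x - n) (x + n) b),
  (box_split_y f (x - n) (x + n) c (y - n) d), (box_split_y f (x - n) (x + n) (y - n) (y + n) d);
  try lra; try (apply HB; lra).
rewrite (goursat f a), (goursat f (x + n) b), (goursat f _ _ c), (goursat f _ _ _ d); try lra; try (apply HG; lra).
assert (B : (Cmod (box f (x - n) (x + n) (y - n) (y + n)) <= 4 * (e / n) * ((x + n - (x - n)) + (y + n - (y - n))))%R).
{ apply box_bound; try lra.
  - apply HB; lra.
  - intros z [Z1 [Z2 Z3]].
    assert (E1 : Re (z - z0) = (Re z - x)%R) by reflexivity.
    assert (E2 : Im (z - z0) = (Im z - y)%R) by reflexivity.
    assert (M1 : (Cmod (z - z0) <= 2 * n)%R).
    { eapply Rle_trans; [apply Cmod_le_ReIm|]. rewrite E1, E2.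
      assert (Rabs (Re z - x) <= n)%R by (apply Rabs_le; lra).
      assert (Rabs (Im z - y) <= n)%R by (apply Rabs_le; lra). lra. }
    assert (M2 : (n <= Cmod (z - z0))%R).
    { assert (T1 := Re_le_Cmod (z - z0)). assert (T2 := Im_le_Cmod (z - z0)). rewrite E1 in T1. rewrite E2 in T2.
      destruct Z3 as [Z|[Z|[Z|Z]]]; rewrite Z in *.
      - replace (x - n - x)%R with (- n)%R in T1 by ring. rewrite Rabs_Ropp, Rabs_pos_eq in T1; lra.
      - replace (x + n - x)%R with n in T1 by ring. rewrite Rabs_pos_eq in T1; lra.
      - replace (y - n - y)%R with (- n)%R in T2 by ring. rewrite Rabs_Ropp, Rabs_pos_eq in T2; lra.
      - replace (y + n - y)%R with n in T2 by ring. rewrite Rabs_pos_eq in T2; lra. }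
    destruct (N z ltac:(lra)) as [P1 P2].
    assert (Hne : z <> z0).
    { intros ->. replace (z0 - z0) with (RtoC 0) in M2 by ring. rewrite Cmod_0 in M2. lra. }
    specialize (P1 Hne). rewrite Hr0 in P2. replace (r z - 0) with (r z) in P2 by ring.
    rewrite <- P1, Cmod_mult in P2.
    apply (Rmult_le_reg_r n); [assumption|]. unfold Rdiv. rewrite Rmult_assoc, Rinv_l, Rmult_1_r by lra.
    apply Rle_trans with (Cmod (f z) * Cmod (z - z0))%R; [|lra].
    apply Rmult_le_compat_l; [apply Cmod_ge_0|lra]. }
replace (4 * (e / n) * ((x + n - (x - n)) + (y + n - (y - n))))%R with (e * 16)%R in B by (field; lra).
match goal with |- (Cmod ?u <= _)%R => replace u with (box f (x - n) (x + n) (y - n) (y + n)) by ring end.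
exact B.
Qed.

(** * The exponential and the periodic Cauchy kernel *)

Lemma Cexp_plus a b : Cexp (a + b) = Cexp a * Cexp b.
Proof.
destruct a as [a1 a2], b as [b1 b2]. unfold Cexp, Cplus, Cmult; simpl.
rewrite exp_plus, cos_plus, sin_plus. f_equal; ring.
Qed.

Lemma Cexp_0 : Cexp 0 = 1.
Proof. unfold Cexp, RtoC; simpl. rewrite exp_0, cos_0, sin_0. f_equal; ring. Qed.

Lemma Cexp_opp a : Cexp (- a) * Cexp a = 1.
Proof. rewrite <- Cexp_plus. replace (- a + a) with (RtoC 0) by ring. apply Cexp_0. Qed.

Lemma Cexp_neq0 a : Cexp a <> 0.
Proof.
intros H. assert (E := Cexp_opp a). rewrite H, Cmult_0_r in E. apply (f_equal fst) in E. simpl in E. lra.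
Qed.

Lemma Cmod_Cexp a : Cmod (Cexp a) = exp (Re a).
Proof.
unfold Cmod, Cexp; simpl.
replace ((exp (Re a) * cos (Im a)) * ((exp (Re a) * cos (Im a)) * 1) +
   (exp (Re a) * sin (Im a)) * ((exp (Re a) * sin (Im a)) * 1))%R
  with (exp (Re a) * exp (Re a) * ((sin (Im a))² + (cos (Im a))²))%R by (unfold Rsqr; ring).
rewrite sin2_cos2, Rmult_1_r. apply sqrt_square. left. apply exp_pos.
Qed.

Lemma Cexp_eq_1 a : Cexp a = 1 -> Re a = 0%R /\ exists k : Z, Im a = (2 * IZR k * PI)%R.
Proof.
intros H. assert (M := Cmod_Cexp a). rewrite H, Cmod_1 in M.
assert (R0 : Re a = 0%R) by (apply exp_inv; rewrite exp_0; lra).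
split; [assumption|].
unfold Cexp in H. rewrite R0, exp_0 in H. apply (f_equal fst) in H. simpl in H. rewrite Rmult_1_l in H.
assert (S : sin (Im a / 2) = 0%R).
{ replace (Im a) with (2 * (Im a / 2))%R in H by field. rewrite cos_2a_sin in H.
  assert (sin (Im a / 2) * sin (Im a / 2) = 0)%R by lra. nra. }
apply sin_eq_0_0 in S. destruct S as [k Hk]. exists k. lra.
Qed.

Lemma Cexp_inj a b : Cexp a = Cexp b -> (Rabs (Im a - Im b) < 2 * PI)%R -> a = b.
Proof.
intros H Hd. assert (E : Cexp (a - b) = 1).
{ unfold Cminus. rewrite Cexp_plus, H, Cmult_comm. apply Cexp_opp. }
apply Cexp_eq_1 in E. destruct E as [E1 [k Hk]].
change (Re (a - b)) with (Re a - Re b)%R in E1. change (Im (a - b)) with (Im a - Im b)%R in Hk.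
rewrite Hk in Hd. assert (P := PI_RGT_0).
assert (k = 0%Z) as ->.
{ apply Rabs_def2 in Hd.
  assert (IZR k < 1)%R by nra. assert (-1 < IZR k)%R by nra. apply lt_IZR in H0. apply lt_IZR in H1. lia. }
apply C_eq; lra.
Qed.

Lemma derive_bound0 f l : derivable_pt_lim f 0 l -> forall e, (0 < e)%R -> exists d, (0 < d)%R /\
  forall h, (Rabs h < d)%R -> (Rabs (f h - f 0 - l * h) <= e * Rabs h)%R.
Proof.
intros H e He. destruct (H e He) as [d Hd]. exists d. split; [apply cond_pos|].
intros h Hh. destruct (Req_dec h 0) as [->|Hn].
- replace (f 0 - f 0 - l * 0)%R with 0%R by ring. rewrite Rabs_R0. lra.
- specialize (Hd h Hn Hh). rewrite Rplus_0_l in Hd.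
  replace (f h - f 0 - l * h)%R with (((f h - f 0) / h - l) * h)%R by (field; assumption).
  rewrite Rabs_mult. apply Rmult_le_compat_r; [apply Rabs_pos|lra].
Qed.

Lemma Cexp_bound0 e : (0 < e)%R -> nearC 0 (fun w => (Cmod (Cexp w - 1 - w) <= e * Cmod w)%R).
Proof.
(* Six copies of e' |w| are collected at the end, hence e / 6; the minimum with 1 serves to keep exp
   x at most 2. *)
intros He. set (e' := (Rmin (e / 6) 1)%R).
assert (He' : (0 < e' /\ e' <= e / 6 /\ e' <= 1)%R).
{ unfold e'. split; [apply Rmin_pos; lra|]. split; [apply Rmin_l|apply Rmin_r]. }
destruct He' as [E1 [E2 E3]].
destruct (derive_bound0 exp 1 ltac:(replace 1%R with (exp 0) by apply exp_0; apply derivable_pt_lim_exp) e' E1) as [d1 [D1 H1]].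
destruct (derive_bound0 cos 0 ltac:(replace 0%R with (- sin 0)%R at 2 by (rewrite sin_0; ring); apply derivable_pt_lim_cos) e' E1) as [d2 [D2 H2]].
destruct (derive_bound0 sin 1 ltac:(replace 1%R with (cos 0) by apply cos_0; apply derivable_pt_lim_sin) e' E1) as [d3 [D3 H3]].
apply nearC_spec. set (dd := Rmin (Rmin d1 d2) (Rmin d3 (e' / 3))).
assert (Hdd : (0 < dd /\ dd <= d1 /\ dd <= d2 /\ dd <= d3 /\ dd <= e' / 3)%R).
{ unfold dd. split; [repeat apply Rmin_pos; lra|].
  assert (Q1 := Rmin_l (Rmin d1 d2) (Rmin d3 (e' / 3))). assert (Q2 := Rmin_r (Rmin d1 d2) (Rmin d3 (e' / 3))).
  assert (Q3 := Rmin_l d1 d2). assert (Q4 := Rmin_r d1 d2).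
  assert (Q5 := Rmin_l d3 (e' / 3)). assert (Q6 := Rmin_r d3 (e' / 3)). lra. }
clearbody dd. exists dd. split; [apply Hdd|]. intros w Hw. replace (w - 0) with w in Hw by ring.
set (x := Re w). set (y := Im w).
assert (X := Re_le_Cmod w). assert (Y := Im_le_Cmod w). fold x in X. fold y in Y.
specialize (H1 x ltac:(lra)). specialize (H2 y ltac:(lra)). specialize (H3 y ltac:(lra)).
rewrite exp_0 in H1. rewrite cos_0 in H2. rewrite sin_0 in H3.
assert (A1 : Re (Cexp w - 1 - w) = ((exp x - 1 - 1 * x) + exp x * (cos y - 1 - 0 * y))%R)
  by (unfold Cexp, x, y; simpl; unfold Re; ring).
assert (A2 : Im (Cexp w - 1 - w) = (exp x * (sin y - 0 - 1 * y) + (exp x - 1) * y)%R)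
  by (unfold Cexp, x, y; simpl; unfold Im; ring).
assert (X3 : (e' * Rabs x <= Rabs x)%R) by (assert (U := Rabs_pos x); nra).
assert (Bx : (Rabs (exp x - 1) <= e')%R).
{ replace (exp x - 1)%R with ((exp x - 1 - 1 * x) + x)%R by ring.
  eapply Rle_trans; [apply Rabs_triang|]. lra. }
assert (Bx2 : (Rabs (exp x) <= 2)%R).
{ replace (exp x)%R with ((exp x - 1) + 1)%R by ring.
  eapply Rle_trans; [apply Rabs_triang|]. rewrite Rabs_R1. lra. }
eapply Rle_trans; [apply Cmod_le_ReIm|]. rewrite A1, A2.
assert (T1 := Rabs_triang (exp x - 1 - 1 * x) (exp x * (cos y - 1 - 0 * y))).
assert (T2 := Rabs_triang (exp x * (sin y - 0 - 1 * y)) ((exp x - 1) * y)).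
rewrite Rabs_mult in T1. rewrite !Rabs_mult in T2.
assert (U1 := Rabs_pos x). assert (U2 := Rabs_pos y). assert (U3 := Rabs_pos (exp x)).
assert (V1 : (Rabs (exp x) * Rabs (cos y - 1 - 0 * y) <= 2 * (e' * Rabs y))%R).
{ apply Rmult_le_compat; auto; apply Rabs_pos. }
assert (V2 : (Rabs (exp x) * Rabs (sin y - 0 - 1 * y) <= 2 * (e' * Rabs y))%R).
{ apply Rmult_le_compat; auto; apply Rabs_pos. }
assert (V3 : (Rabs (exp x - 1) * Rabs y <= e' * Rabs y)%R).
{ apply Rmult_le_compat_r; auto. }
assert (V4 : (e' * Rabs y <= e / 6 * Cmod w)%R) by (apply Rmult_le_compat; lra).
assert (V5 : (e' * Rabs x <= e / 6 * Cmod w)%R) by (apply Rmult_le_compat; lra).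
lra.
Qed.

(** Besides holomorphy this records the derivative as the value of the slope, which [ker_slope] and
    [hol_Clog] need. *)
Lemma Cexp_slope z : exists q, ccontC q z /\ q z = Cexp z /\ forall w, Cexp w = Cexp z + q w * (w - z).
Proof.
apply hol_of_bound. intros e He.
assert (Hm : (0 < Cmod (Cexp z))%R) by (apply Cmod_gt_0, Cexp_neq0).
assert (B := Cexp_bound0 (e / Cmod (Cexp z))%R ltac:(now apply Rdiv_lt_0_compat)).
apply nearC_spec in B. destruct B as [d [Hd B]]. apply nearC_spec. exists d. split; [assumption|].
intros w Hw. specialize (B (w - z)). replace (w - z - 0) with (w - z) in B by ring. specialize (B Hw).
replace (Cexp w) with (Cexp z * Cexp (w - z)) by (rewrite <- Cexp_plus; f_equal; ring).
replace (Cexp z * Cexp (w - z) - Cexp z - Cexp z * (w - z)) with (Cexp z * (Cexp (w - z) - 1 - (w - z))) by ring.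
rewrite Cmod_mult.
replace (e * Cmod (w - z))%R with (Cmod (Cexp z) * (e / Cmod (Cexp z) * Cmod (w - z)))%R by (field; lra).
apply Rmult_le_compat_l; lra.
Qed.

Lemma hol_Cexp z : hol Cexp z.
Proof. destruct (Cexp_slope z) as [q [H1 [_ H2]]]. now exists q. Qed.

Definition twopii : CC := RtoC (2 * PI) * Ci.

Lemma twopii_neq0 : twopii <> 0.
Proof.
apply Cmult_neq_0; [|apply Ci_nz]. intros H. apply (f_equal fst) in H. simpl in H. assert (P := PI_RGT_0). lra.
Qed.

Definition qexp (z : CC) : CC := Cexp (twopii * z).

Lemma Re_twopii_mult z : Re (twopii * z) = (- (2 * PI * Im z))%R.
Proof. unfold twopii; destruct z; simpl; unfold Re, Im; simpl. ring. Qed.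
Lemma Im_twopii_mult z : Im (twopii * z) = (2 * PI * Re z)%R.
Proof. unfold twopii; destruct z; simpl; unfold Re, Im; simpl. ring. Qed.

Lemma qexp_neq0 z : qexp z <> 0.
Proof. apply Cexp_neq0. Qed.

Lemma qexp_period z : qexp (z + 1) = qexp z.
Proof.
unfold qexp. rewrite Cmult_plus_distr_l, Cexp_plus.
replace (Cexp (twopii * 1)) with (RtoC 1); [ring|].
unfold Cexp. rewrite Re_twopii_mult, Im_twopii_mult. simpl.
rewrite Rmult_0_r, Ropp_0, exp_0, Rmult_1_r, cos_2PI, sin_2PI. unfold RtoC; f_equal; ring.
Qed.

Lemma Cmod_qexp z : Cmod (qexp z) = exp (- (2 * PI * Im z)).
Proof. unfold qexp. now rewrite Cmod_Cexp, Re_twopii_mult. Qed.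

Lemma qexp_eq_Im z w : qexp z = qexp w -> Im z = Im w.
Proof.
intros H. apply (f_equal Cmod) in H. rewrite !Cmod_qexp in H. apply exp_inv in H. assert (P := PI_RGT_0). nra.
Qed.

Lemma qexp_inj z w : qexp z = qexp w -> (Rabs (Re z - Re w) < 1)%R -> z = w.
Proof.
intros H Hd. apply Cexp_inj in H.
- assert (T := twopii_neq0). replace z with (twopii * z / twopii) by (field; assumption).
  rewrite H. field; assumption.
- rewrite !Im_twopii_mult. replace (2 * PI * Re z - 2 * PI * Re w)%R with (2 * PI * (Re z - Re w))%R by ring.
  assert (P := PI_RGT_0). rewrite Rabs_mult, (Rabs_pos_eq (2 * PI)) by lra.
  rewrite <- (Rmult_1_r (2 * PI)) at 2. apply Rmult_lt_compat_l; lra.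
Qed.

Lemma hol_qexp z : hol qexp z.
Proof. apply (hol_comp Cexp (fun z => twopii * z)); [apply hol_Cexp|]. holo. Qed.

Lemma qexp_slope z : exists q, ccontC q z /\ q z = twopii * qexp z /\ forall w, qexp w - qexp z = q w * (w - z).
Proof.
destruct (Cexp_slope (twopii * z)) as [q [H1 [H2 H3]]].
exists (fun w => twopii * q (twopii * w)). split; [|split].
- apply ccont_mult; [apply ccont_const|]. apply (ccont_comp q (fun w => twopii * w)); [exact H1|].
  apply ccont_mult; [apply ccont_const|apply ccont_id].
- rewrite H2. reflexivity.
- intros w. unfold qexp. rewrite (H3 (twopii * w)). ring.
Qed.

(** The 1-periodic Cauchy kernel [1 / (exp (2 pi i (x - z)) - 1)], with residue [1 / (2 pi i)] at [x = z]. *)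
Definition ker (z x : CC) : CC := qexp z / (qexp x - qexp z).

Lemma hol_ker z x : qexp x <> qexp z -> hol (ker z) x.
Proof.
intros H. apply hol_div; [apply hol_const| |now apply Cminus_eq_contra].
apply hol_minus; [apply hol_qexp|apply hol_const].
Qed.

Lemma ker_period z x : ker z (x + 1) = ker z x.
Proof. unfold ker. now rewrite qexp_period. Qed.

Lemma ker_period_z z x : ker (z + 1) x = ker z x.
Proof. unfold ker. now rewrite qexp_period. Qed.

(** Exchanging the two arguments interchanges the limits -1 and 0 of the kernel, which reduces
    [ker_below] to [ker_above]. *)
Lemma ker_sym z x : qexp x <> qexp z -> ker z x = - (1 + ker x z).
Proof.
intros H. unfold ker. field. split; apply Cminus_eq_contra; auto.
Qed.

Lemma ker_above e : (0 < e)%R -> exists M, (0 < M)%R /\ forall z x, (M < Im x - Im z)%R -> (Cmod (ker z x + 1) < e)%R.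
Proof.
(* With m the difference of heights, r = |qexp x / qexp z| = exp (- 2 pi m) < 1 / m, which is below
   both 1/2 and e / 2; then |ker + 1| is at most r / (1 - r) < e. *)
intros He. exists (2 / e + 2)%R.
assert (H2 : (0 < 2 / e)%R) by (apply Rdiv_lt_0_compat; lra).
split; [lra|]. intros z x Hm. set (m := (Im x - Im z)%R) in *.
assert (P := PI_RGT_0). assert (P2 := PI2_1).
assert (Hr : (exp (- (2 * PI * m)) < / m)%R).
{ rewrite exp_Ropp. apply Rinv_lt_contravar; [apply Rmult_lt_0_compat; [lra|apply exp_pos]|].
  apply Rlt_le_trans with (1 + 2 * PI * m)%R; [nra|]. left. apply exp_ineq1. nra. }
assert (M1 : (/ m < / 2)%R) by (apply Rinv_lt_contravar; lra).
assert (M2 : (/ m < e / 2)%R).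
{ replace (e / 2)%R with (/ (2 / e))%R by (field; lra). apply Rinv_lt_contravar; [apply Rmult_lt_0_compat; lra|lra]. }
assert (Ex : Cmod (qexp x) = (Cmod (qexp z) * exp (- (2 * PI * m)))%R).
{ rewrite !Cmod_qexp, <- exp_plus. f_equal. unfold m. ring. }
set (r := exp (- (2 * PI * m))) in *.
assert (Hz : (0 < Cmod (qexp z))%R) by (apply Cmod_gt_0, qexp_neq0).
assert (Hr0 : (0 < r)%R) by apply exp_pos.
assert (T : (Cmod (qexp z) * (1 - r) <= Cmod (qexp x - qexp z))%R).
{ assert (T := Cmod_triangle (qexp x) (- (qexp x - qexp z))). replace (qexp x + - (qexp x - qexp z)) with (qexp z) in T by ring.
  rewrite Cmod_opp, Ex in T. lra. }
assert (Hn : qexp x - qexp z <> 0).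
{ intros Q. rewrite Q, Cmod_0 in T. nra. }
unfold ker. replace (qexp z / (qexp x - qexp z) + 1) with (qexp x / (qexp x - qexp z)) by (field; assumption).
rewrite Cmod_div by assumption. rewrite Ex.
assert (0 < Cmod (qexp x - qexp z))%R by now apply Cmod_gt_0.
apply (Rmult_lt_reg_r (Cmod (qexp x - qexp z))); [assumption|].
unfold Rdiv. rewrite Rmult_assoc, Rinv_l, Rmult_1_r by lra.
apply Rlt_le_trans with (e * (Cmod (qexp z) * (1 - r)))%R; [|apply Rmult_le_compat_l; lra].
replace (e * (Cmod (qexp z) * (1 - r)))%R with (Cmod (qexp z) * (e * (1 - r)))%R by ring.
apply Rmult_lt_compat_l; [assumption|]. nra.
Qed.

Lemma ker_below e : (0 < e)%R -> exists M, (0 < M)%R /\ forall z x, (M < Im z - Im x)%R -> (Cmod (ker z x) < e)%R.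
Proof.
intros He. destruct (ker_above e He) as [M [HM H]]. exists M. split; [assumption|]. intros z x Hm.
rewrite ker_sym by (intros Q; apply qexp_eq_Im in Q; lra). rewrite Cmod_opp, Cplus_comm. now apply H.
Qed.

Lemma box_periodic f a c d : (forall z, f (z + 1) = f z) ->
  box f a (a + 1) c d = CInt (fun t => f (t, c)) a (a + 1) - CInt (fun t => f (t, d)) a (a + 1).
Proof.
intros H. unfold box.
replace (CInt (fun t => f ((a + 1)%R, t)) c d) with (CInt (fun t => f (a, t)) c d); [ring|].
assert (Q : forall t, f (a, t) = f ((a + 1)%R, t)).
{ intros t. rewrite <- (H (a, t)). f_equal. unfold Cplus, RtoC; simpl. f_equal; ring. }
unfold CInt. f_equal; apply RInt_ext; intros t _; now rewrite Q.
Qed.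

Lemma hol_rect_ker z a b c d : (d < Im z \/ Im z < c)%R -> hol_rect (ker z) a b c d.
Proof. intros H x X1 X2. apply hol_ker. intros Q. apply qexp_eq_Im in Q. lra. Qed.

Lemma cont_hseg_ker z a b y : (y <> Im z)%R -> cont_seg (fun t => ker z (t, y)) a b.
Proof.
intros H. apply cont_hseg. intros t _. apply hol_cont, hol_ker. intros Q. apply qexp_eq_Im in Q. simpl in Q. lra.
Qed.

(** Goursat and periodicity move the segment arbitrarily far up, where the kernel is uniformly close
    to -1. With the analogous value 0 below, this replaces residue calculus for [ker]. *)
Lemma ker_int_above z a y : (Im z < y)%R -> CInt (fun t => ker z (t, y)) a (a + 1) = - (1).
Proof.
intros Hy. apply Ceq_minus. apply (Cmod_le_all_0 _ 2). intros e He.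
destruct (ker_above e He) as [M [HM H]].
assert (G := goursat (ker z) a (a + 1) y (y + (M + 1)) ltac:(lra) ltac:(lra) (hol_rect_ker z _ _ _ _ (or_intror Hy))).
rewrite box_periodic in G by apply ker_period. apply Ceq_minus in G. rewrite G.
replace (CInt (fun t => ker z (t, (y + (M + 1))%R)) a (a + 1) - - (1)) with
  (CInt (fun t => ker z (t, (y + (M + 1))%R) + 1) a (a + 1)).
- eapply Rle_trans; [apply (CInt_bound _ a (a + 1) e)|]; try lra.
  + intros t Ht. apply ccont_plus; [|apply ccont_const]. apply (cont_hseg_ker z a (a + 1)); [lra|assumption].
  + intros t Ht. left. apply H. simpl. lra.
- rewrite CInt_plus; try lra.
  + rewrite CInt_const. replace (a + 1 - a)%R with 1%R by ring. ring.
  + apply cont_hseg_ker. lra.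
  + apply cont_seg_const.
Qed.

Lemma ker_int_below z a y : (y < Im z)%R -> CInt (fun t => ker z (t, y)) a (a + 1) = 0.
Proof.
intros Hy. apply (Cmod_le_all_0 _ 2). intros e He.
destruct (ker_below e He) as [M [HM H]].
assert (G := goursat (ker z) a (a + 1) (y - (M + 1)) y ltac:(lra) ltac:(lra) (hol_rect_ker z _ _ _ _ (or_introl Hy))).
rewrite box_periodic in G by apply ker_period. apply Ceq_minus in G. rewrite <- G.
eapply Rle_trans; [apply (CInt_bound _ a (a + 1) e)|]; try lra.
+ apply (cont_hseg_ker z a (a + 1)); lra.
+ intros t Ht. left. apply H. simpl. lra.
Qed.

Lemma box_ker z a c d : (c < Im z < d)%R -> box (ker z) a (a + 1) c d = 1.
Proof.
intros H. rewrite box_periodic by apply ker_period. rewrite (ker_int_above z a d), (ker_int_below z a c) by lra. ring.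
Qed.

Lemma ker_slope z : exists r, ccontC r z /\ r z = / twopii /\
  nearC z (fun x => x <> z -> ker z x * (x - z) = r x).
Proof.
destruct (qexp_slope z) as [q [H1 [H2 H3]]].
assert (Hq : q z <> 0).
{ rewrite H2. apply Cmult_neq_0; [apply twopii_neq0|apply qexp_neq0]. }
exists (fun x => qexp z / q x). split; [|split].
- apply ccont_div; auto. apply ccont_const.
- rewrite H2. field. split; [apply twopii_neq0|apply qexp_neq0].
- near_by (ccont_neq0 q z H1 Hq). intros x Hx Hn.
  unfold ker. rewrite H3. field. split; [assumption|]. now apply Cminus_eq_contra.
Qed.

Lemma hol_ker_strip z x a : (a < Re z < a + 1)%R -> (a <= Re x <= a + 1)%R -> x <> z -> hol (ker z) x.
Proof.
intros H1 H2 Hn. apply hol_ker. intros Q. apply qexp_inj in Q; [easy|]. apply Rabs_def1; lra.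
Qed.

Lemma bdry_neq a b c d z x : (a < Re z < b)%R -> (c < Im z < d)%R -> bdry a b c d x -> x <> z.
Proof. intros H1 H2 [H3 [H4 H5]] ->. lra. Qed.

(** Subtracting [f z] makes the pole removable, and [box_ker] integrates the rest. Periodicity of
    [f] is not assumed: a rectangle of width one around [z] contains a single pole of the kernel. *)
Lemma box_mul_ker f z a c d : hol_rect f a (a + 1) c d -> (a < Re z < a + 1)%R -> (c < Im z < d)%R ->
  box (fun x => f x * ker z x) a (a + 1) c d = f z.
Proof.
intros Hf Ha Hc.
assert (Bd : box (fun x => (f x - f z) * ker z x) a (a + 1) c d = 0).
{ destruct (ker_slope z) as [r [H1 [H2 H3]]].
  apply (box_exceptional _ (fun x => (f x - f z) * r x) z); auto.
  - intros x X1 X2 Hn. apply hol_mult.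
    + holo.
    + apply (hol_ker_strip z x a); auto.
  - apply ccont_mult; [|assumption]. apply ccont_minus; [apply hol_cont, Hf; lra|apply ccont_const].
  - ring.
  - near_by H3. intros x Hx Hn. rewrite <- Hx by assumption. ring. }
rewrite (box_ext _ (fun x => f x * ker z x - f z * ker z x)) in Bd; try lra; [|intros; ring].
assert (Ck : cont_bdry (ker z) a (a + 1) c d).
{ intros x Hx. apply hol_cont, (hol_ker_strip z x a); auto; [apply Hx|]. now apply (bdry_neq a (a + 1) c d). }
rewrite box_minus, box_scal, box_ker in Bd; auto; try lra.
- apply Ceq_minus. rewrite <- Bd. ring.
- intros x Hx. apply ccont_mult; [apply hol_cont, Hf; apply Hx|auto].
- now apply cont_bdry_scal.
Qed.

(** The ordinary Cauchy kernel minus 2 pi i times the periodic one has a removable singularity at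
    [z], so the formula is inherited from [box_mul_ker]. *)
Lemma box_cauchy f z a c d : hol_rect f a (a + 1) c d -> (a < Re z < a + 1)%R -> (c < Im z < d)%R ->
  box (fun x => f x / (x - z)) a (a + 1) c d = twopii * f z.
Proof.
intros Hf Ha Hc. assert (T := twopii_neq0).
assert (Hinv : forall x, x <> z -> hol (fun x => / (x - z)) x).
{ intros x Hn. apply hol_inv; [apply hol_minus; [apply hol_id|apply hol_const]|]. now apply Cminus_eq_contra. }
assert (Bd : box (fun x => f x / (x - z) - twopii * (f x * ker z x)) a (a + 1) c d = 0).
{ destruct (ker_slope z) as [r [H1 [H2 H3]]].
  apply (box_exceptional _ (fun x => f x * (1 - twopii * r x)) z); auto.
  - intros x X1 X2 Hn. apply hol_minus; [apply hol_mult; [now apply Hf|now apply Hinv]|].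
    apply hol_mult; [apply hol_const|]. apply hol_mult; [now apply Hf|apply (hol_ker_strip z x a); auto].
  - apply ccont_mult; [apply hol_cont, Hf; lra|]. apply ccont_minus; [apply ccont_const|].
    apply ccont_mult; [apply ccont_const|assumption].
  - rewrite H2. field. assumption.
  - near_by H3. intros x Hx Hn. rewrite <- Hx by assumption. field. now apply Cminus_eq_contra. }
assert (Ck : cont_bdry (fun x => f x * ker z x) a (a + 1) c d).
{ intros x Hx. apply ccont_mult; [apply hol_cont, Hf; apply Hx|].
  apply hol_cont, (hol_ker_strip z x a); auto; [apply Hx|]. now apply (bdry_neq a (a + 1) c d). }
rewrite box_minus, box_scal, box_mul_ker in Bd; auto; try lra.
- apply Ceq_minus. exact Bd.
- intros x Hx. apply ccont_mult; [apply hol_cont, Hf; apply Hx|]. apply hol_cont, Hinv. now apply (bdry_neq a (a + 1) c d).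
- now apply cont_bdry_scal.
Qed.

(** * Integrals of Cauchy type *)

Lemma cont_seg_Cmod f a b : cont_seg f a b -> forall t, (a <= t <= b)%R -> continuity_pt (fun t => Cmod (f t)) t.
Proof.
intros H t Ht. apply continuity_pt_filterlim.
exact (rcont_comp_C Cmod f t (rcont_Cmod _) (H t Ht)).
Qed.

Lemma cont_seg_bounded f a b : (a <= b)%R -> cont_seg f a b ->
  exists H, (0 < H)%R /\ forall t, (a <= t <= b)%R -> (Cmod (f t) <= H)%R.
Proof.
intros Hab Hf. destruct (continuity_ab_maj (fun t => Cmod (f t)) a b Hab (cont_seg_Cmod _ _ _ Hf)) as [m [H1 H2]].
exists (Cmod (f m) + 1)%R. split; [assert (H := Cmod_ge_0 (f m)); lra|].
intros t Ht. specialize (H1 t Ht). lra.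
Qed.

Lemma cont_seg_away f a b z : (a <= b)%R -> cont_seg f a b -> (forall t, (a <= t <= b)%R -> f t <> z) ->
  exists m, (0 < m)%R /\ forall t, (a <= t <= b)%R -> (m <= Cmod (f t - z))%R.
Proof.
intros Hab Hf Hz.
assert (C : cont_seg (fun t => f t - z) a b) by (intros t Ht; apply ccont_minus; [auto|apply ccont_const]).
destruct (continuity_ab_min (fun t => Cmod (f t - z)) a b Hab (cont_seg_Cmod _ _ _ C)) as [m [H1 H2]].
exists (Cmod (f m - z)). split; [|auto]. apply Cmod_gt_0, Cminus_eq_contra. auto.
Qed.

Lemma near_avoid f a b z : (a <= b)%R -> cont_seg f a b -> (forall t, (a <= t <= b)%R -> f t <> z) ->
  nearC z (fun w => forall t, (a <= t <= b)%R -> f t <> w).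
Proof.
intros Hab Hf Hz. destruct (cont_seg_away f a b z Hab Hf Hz) as [m [Hm H]].
apply nearC_spec. exists m. split; [assumption|]. intros w Hw t Ht Heq. specialize (H t Ht). rewrite Heq in H. lra.
Qed.

Lemma cont_seg_div h f a b z : cont_seg h a b -> cont_seg f a b -> (forall t, (a <= t <= b)%R -> f t <> z) ->
  cont_seg (fun t => h t / (f t - z)) a b.
Proof.
intros Hh Hf Hz t Ht. apply ccont_div; [auto| |now apply Cminus_eq_contra, Hz].
apply ccont_minus; [auto|apply ccont_const].
Qed.

Lemma hol_cauchy_int h g a b z0 : (a <= b)%R -> cont_seg h a b -> cont_seg g a b ->
  (forall t, (a <= t <= b)%R -> g t <> z0) ->
  hol (fun z => CInt (fun t => h t / (g t - z)) a b) z0.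
Proof.
intros Hab Hh Hg Hz.
destruct (cont_seg_away g a b z0 Hab Hg Hz) as [m [Hm Hm']].
destruct (cont_seg_bounded h a b Hab Hh) as [H [HH HH']].
apply hol_spec. exists (CInt (fun t => h t / (g t - z0) / (g t - z0)) a b). intros e He.
apply nearC_spec.
(* The remainder of the integrand is h (w - z0)^2 / ((g - w) (g - z0)^2), at most 2 H |w - z0|^2 /
   m^3 when |w - z0| < m / 2; [b - a + 1] avoids a zero denominator. *)
assert (Hd0 : (0 < e * (m * m * m) / (4 * H * (b - a + 1)))%R).
{ apply Rdiv_lt_0_compat; repeat apply Rmult_lt_0_compat; lra. }
exists (Rmin (m / 2) (e * (m * m * m) / (4 * H * (b - a + 1)))). split; [apply Rmin_pos; lra|].
intros w Hw. set (dw := Cmod (w - z0)) in *.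
assert (W1 : (dw < m / 2)%R) by (eapply Rlt_le_trans; [exact Hw|apply Rmin_l]).
assert (W2 : (dw < e * (m * m * m) / (4 * H * (b - a + 1)))%R) by (eapply Rlt_le_trans; [exact Hw|apply Rmin_r]).
assert (Hgw : forall t, (a <= t <= b)%R -> (m / 2 <= Cmod (g t - w))%R).
{ intros t Ht. assert (T := Cmod_triangle (g t - w) (w - z0)).
  replace (g t - w + (w - z0)) with (g t - z0) in T by ring. specialize (Hm' t Ht). fold dw in T. lra. }
assert (Hgn : forall t, (a <= t <= b)%R -> g t <> w).
{ intros t Ht Q. specialize (Hgw t Ht). rewrite Q in Hgw. replace (w - w) with (RtoC 0) in Hgw by ring.
  rewrite Cmod_0 in Hgw. lra. }
assert (C1 := cont_seg_div h g a b w Hh Hg Hgn).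
assert (C2 := cont_seg_div h g a b z0 Hh Hg Hz).
assert (C3 := cont_seg_div _ g a b z0 C2 Hg Hz).
replace (CInt (fun t => h t / (g t - w)) a b - CInt (fun t => h t / (g t - z0)) a b
   - CInt (fun t => h t / (g t - z0) / (g t - z0)) a b * (w - z0))
  with (CInt (fun t => h t / (g t - w) - h t / (g t - z0) - (w - z0) * (h t / (g t - z0) / (g t - z0))) a b).
2:{ rewrite CInt_minus; auto using cont_seg_scal.
    - rewrite CInt_minus, CInt_scal; auto. ring.
    - intros t Ht. apply ccont_minus; auto. }
assert (Hd : (0 <= dw)%R) by apply Cmod_ge_0.
eapply Rle_trans; [apply (CInt_bound _ a b (H * (dw * dw) * (2 / (m * m * m))) Hab)|].
- intros t Ht. apply ccont_minus; [apply ccont_minus; auto|apply cont_seg_scal with (1 := C3); auto].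
- intros t Ht.
  assert (N1 := Cminus_eq_contra _ _ (Hgn t Ht)). assert (N2 := Cminus_eq_contra _ _ (Hz t Ht)).
  replace (h t / (g t - w) - h t / (g t - z0) - (w - z0) * (h t / (g t - z0) / (g t - z0)))
    with (h t * ((w - z0) * (w - z0)) / ((g t - w) * ((g t - z0) * (g t - z0)))) by (field; auto).
  rewrite Cmod_div by (repeat apply Cmult_neq_0; assumption). rewrite !Cmod_mult. fold dw.
  specialize (Hm' t Ht). specialize (Hgw t Ht). specialize (HH' t Ht).
  unfold Rdiv. apply Rmult_le_compat.
  + apply Rmult_le_pos; [apply Cmod_ge_0|nra].
  + left. apply Rinv_0_lt_compat. repeat apply Rmult_lt_0_compat; lra.
  + apply Rmult_le_compat_r; [nra|assumption].
  + replace (2 * / (m * m * m))%R with (/ (m / 2 * (m * m)))%R by (field; lra).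
    apply Rinv_le_contravar; [repeat apply Rmult_lt_0_compat; lra|].
    apply Rmult_le_compat; try nra.
- replace (2 * (H * (dw * dw) * (2 / (m * m * m))) * (b - a))%R
    with ((4 * H * (b - a) / (m * m * m) * dw) * dw)%R by (field; lra).
  apply Rmult_le_compat_r; [assumption|].
  apply Rle_trans with (4 * H * (b - a) / (m * m * m) * (e * (m * m * m) / (4 * H * (b - a + 1))))%R.
  + apply Rmult_le_compat_l; [|lra]. apply Rmult_le_pos; [nra|].
    left. apply Rinv_0_lt_compat. repeat apply Rmult_lt_0_compat; lra.
  + replace (4 * H * (b - a) / (m * m * m) * (e * (m * m * m) / (4 * H * (b - a + 1))))%R
      with (e * ((b - a) / (b - a + 1)))%R by (field; lra).
    rewrite <- (Rmult_1_r e) at 2. apply Rmult_le_compat_l; [lra|].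
    apply (Rmult_le_reg_r (b - a + 1)); [lra|]. unfold Rdiv. rewrite Rmult_assoc, Rinv_l; lra.
Qed.

Lemma cont_seg_qexp g a b : cont_seg g a b -> cont_seg (fun t => qexp (g t)) a b.
Proof. intros H t Ht. apply (ccont_comp qexp g); [apply hol_cont, hol_qexp|auto]. Qed.

Lemma cont_seg_mul_ker h g a b z : cont_seg h a b -> cont_seg g a b ->
  (forall t, (a <= t <= b)%R -> qexp (g t) <> qexp z) -> cont_seg (fun t => h t * ker z (g t)) a b.
Proof.
intros Hh Hg Hz t Ht. apply ccont_mult; [auto|]. apply (ccont_comp (ker z) g); [|auto].
apply hol_cont, hol_ker. auto.
Qed.

(** Once the factor [qexp z] is pulled out, what remains is a Cauchy integral in the variable
    [qexp z]. *)
Lemma hol_ker_int h g a b z0 : (a <= b)%R -> cont_seg h a b -> cont_seg g a b ->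
  (forall t, (a <= t <= b)%R -> qexp (g t) <> qexp z0) ->
  hol (fun z => CInt (fun t => h t * ker z (g t)) a b) z0.
Proof.
intros Hab Hh Hg Hz. assert (HgE := cont_seg_qexp g a b Hg).
apply hol_ext_loc with (fun z => qexp z * CInt (fun t => h t / (qexp (g t) - qexp z)) a b).
- assert (N := near_avoid (fun t => qexp (g t)) a b (qexp z0) Hab HgE Hz).
  assert (CE : continuous (T := C_UniformSpace) (U := C_UniformSpace) qexp z0) by apply ccont_continuous, hol_cont, hol_qexp.
  generalize (CE _ N). unfold filtermap. apply filter_imp. intros z Hz'.
  rewrite <- CInt_scal; [|assumption|now apply (cont_seg_div h (fun t => qexp (g t)))].
  apply CInt_ext; [assumption|]. intros t Ht. unfold ker. field. apply Cminus_eq_contra. auto.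
- apply hol_mult; [apply hol_qexp|].
  apply (hol_comp (fun w => CInt (fun t => h t / (qexp (g t) - w)) a b) qexp); [|apply hol_qexp].
  now apply hol_cauchy_int.
Qed.

(** In the coordinate u = 1/z the integrand is - u (h/g) / (1/g - u): again of Cauchy type, over the
    inverted path, which avoids 0. *)
Lemma cauchy_int_oo h g a b : (a <= b)%R -> cont_seg h a b -> cont_seg g a b ->
  (forall t, (a <= t <= b)%R -> g t <> 0) ->
  exists k, nearC 0 (fun u => hol k u) /\
    nearC 0 (fun u : CC => u <> 0 -> CInt (fun t => h t / (g t - / u)) a b = k u).
Proof.
intros Hab Hh Hg H0.
assert (Hi : cont_seg (fun t => / g t) a b) by (intros t Ht; apply ccont_inv; auto).
assert (Hq : cont_seg (fun t => h t / g t) a b) by (intros t Ht; apply ccont_div; auto).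
assert (Hi0 : forall t, (a <= t <= b)%R -> / g t <> 0).
{ intros t Ht Q. apply C1_nz. rewrite <- (Cinv_r (g t)) by auto. rewrite Q. ring. }
assert (N := near_avoid _ a b 0 Hab Hi Hi0).
exists (fun u => - u * CInt (fun t => h t / g t / (/ g t - u)) a b). split.
- near_by N. intros u Hu. holo.
  now apply (hol_cauchy_int (fun t => h t / g t) (fun t => / g t)).
- near_by N. intros u Hu Hn.
  rewrite <- CInt_scal; [|assumption|now apply (cont_seg_div (fun t => h t / g t) (fun t => / g t))].
  apply CInt_ext; [assumption|]. intros t Ht.
  assert (Q := Cminus_eq_contra _ _ (Hu t Ht)).
  assert (Q2 : g t * u - 1 <> 0).
  { intros Q2. apply Q. replace (/ g t - u) with (- (g t * u - 1) / g t) by (field; auto). rewrite Q2. field. auto. }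
  assert (Q3 : 1 - u * g t <> 0).
  { intros Q3. apply Q2. replace (g t * u - 1) with (- (1 - u * g t)) by ring. rewrite Q3. ring. }
  field. repeat split; auto.
Qed.

(** Limit at [+i oo] ([s = 1]) or at [-i oo] ([s = -1]). *)
Definition ilim (s : R) (P : CC -> CC) (L : CC) : Prop :=
  forall e : R, (0 < e)%R -> exists M : R, forall t, (M < s * Im t)%R -> (Cmod (P t - L) < e)%R.

Lemma ilim_ext s c P1 P2 L : (forall z, (c < s * Im z)%R -> P1 z = P2 z) -> ilim s P1 L -> ilim s P2 L.
Proof.
intros H H1 e He. destruct (H1 e He) as [M K]. exists (Rmax M c). intros t Ht.
apply Rmax_Rlt in Ht. rewrite <- H; [apply K|]; lra.
Qed.

Lemma ilim_const s c : ilim s (fun _ => c) c.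
Proof. intros e He. exists 0%R. intros. replace (c - c) with (RtoC 0) by ring. now rewrite Cmod_0. Qed.

Lemma ilim_lin s l P1 P2 L1 L2 : ilim s P1 L1 -> ilim s P2 L2 -> ilim s (fun z => l * P1 z + P2 z) (l * L1 + L2).
Proof.
intros H1 H2 e He. assert (Q := Cmod_ge_0 l).
destruct (H1 (e / (2 * (Cmod l + 1)))%R ltac:(apply Rdiv_lt_0_compat; lra)) as [M1 K1].
destruct (H2 (e / 2)%R ltac:(lra)) as [M2 K2]. exists (Rmax M1 M2). intros t Ht.
apply Rmax_Rlt in Ht. specialize (K1 t ltac:(lra)). specialize (K2 t ltac:(lra)).
replace (l * P1 t + P2 t - (l * L1 + L2)) with (l * (P1 t - L1) + (P2 t - L2)) by ring.
eapply Rle_lt_trans; [apply Cmod_triangle|]. rewrite Cmod_mult.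
assert (Cmod l * Cmod (P1 t - L1) <= e / 2)%R; [|lra].
apply Rle_trans with ((Cmod l + 1) * (e / (2 * (Cmod l + 1))))%R.
- apply Rmult_le_compat; try apply Cmod_ge_0; lra.
- right. field. lra.
Qed.

Lemma ilim_scal s l P L : ilim s P L -> ilim s (fun z => l * P z) (l * L).
Proof.
intros H. replace (l * L) with (l * L + 0) by ring.
apply ilim_ext with (2 := ilim_lin s l P _ L 0 H (ilim_const s 0)) (c := 0%R). intros; ring.
Qed.

(** Integrate [(p - p z) ker z] over a period rectangle whose horizontal sides tend to [+- i oo]:
    [ker z] tends to [-1] at the top and to [0] at the bottom. *)
Lemma periodic_entire_top p L1 L2 : (forall z, hol p z) -> (forall z, p (z + 1) = p z) ->
  ilim 1 p L1 -> ilim (-1) p L2 -> forall z, p z = L1.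
Proof.
intros Hp Hper Ht Hb z. symmetry. apply Ceq_minus.
set (a := (Re z - / 2)%R). set (H := fun x => (p x - p z) * ker z x).
assert (BH : forall c d, (c < Im z < d)%R -> CInt (fun t => H (t, c)) a (a + 1) = CInt (fun t => H (t, d)) a (a + 1)).
{ intros c d Hcd. apply Ceq_minus. rewrite <- (box_periodic H).
  2:{ intros x. unfold H. now rewrite Hper, ker_period. }
  assert (Bm := box_mul_ker (fun x => p x - p z) z a c d). cbv beta in Bm. replace (p z - p z) with (RtoC 0) in Bm by ring.
  apply Bm; [|unfold a; lra|assumption].
  intros x _ _. holo. }
assert (CH : forall y, (y <> Im z)%R -> cont_seg (fun t => H (t, y)) a (a + 1)).
{ intros y Hy t Ht0. apply (ccont_mult (fun t => p (t, y) - p z) (fun t => ker z (t, y))).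
  - apply ccont_minus; [|apply ccont_const]. apply (ccont_comp p (fun t => (t, y))); [apply hol_cont, Hp|apply ccont_hline].
  - now apply (cont_hseg_ker z a (a + 1)). }
(* At the bottom the kernel is small and boundedness of [p - p z] by [B] suffices; at the top both
   [p - L1] and [ker + 1] are small. *)
set (B := (Cmod L2 + 1 + Cmod (p z))%R).
apply (Cmod_le_all_0 _ (2 * (B + (3 + Cmod (L1 - p z))))). intros e0 He0.
set (e := Rmin e0 1).
assert (He : (0 < e /\ e <= e0 /\ e <= 1)%R) by (unfold e; split; [apply Rmin_pos; lra|split; [apply Rmin_l|apply Rmin_r]]).
destruct (ker_above e) as [M1 [HM1 K1]]; [lra|]. destruct (ker_below e) as [M2 [HM2 K2]]; [lra|].
destruct (Ht e) as [M3 P3]; [lra|]. destruct (Hb 1%R) as [M4 P4]; [lra|].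
set (d := (Rmax (Im z + M1) M3 + 1)%R). set (c := (- (Rmax (M2 - Im z) M4 + 1))%R).
assert (D1 : (Im z + M1 < d /\ M3 < d)%R) by (apply Rmax_Rlt; unfold d; lra).
assert (D3 : (M2 - Im z < - c /\ M4 < - c)%R) by (apply Rmax_Rlt; unfold c; lra).
clearbody d c. specialize (BH c d ltac:(lra)).
assert (PB : (0 <= B)%R) by (unfold B; assert (Q1 := Cmod_ge_0 L2); assert (Q2 := Cmod_ge_0 (p z)); lra).
assert (U1 : (Cmod (CInt (fun t => H (t, c)) a (a + 1)) <= 2 * (B * e) * (a + 1 - a))%R).
{ apply CInt_bound; [lra|apply CH; lra|]. intros t Ht'. unfold H. rewrite Cmod_mult.
  apply Rmult_le_compat; try apply Cmod_ge_0.
  - assert (Q1 := P4 (t, c) ltac:(simpl; lra)). assert (Q2 := Cmod_triangle (p (t, c) - L2) L2).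
    assert (Q3 := Cmod_triangle (p (t, c)) (- p z)). rewrite Cmod_opp in Q3.
    replace (p (t, c) - L2 + L2) with (p (t, c)) in Q2 by ring.
    unfold B, Cminus. lra.
  - left. apply K2. simpl. lra. }
assert (U2 : (Cmod (CInt (fun t => H (t, d) + (L1 - p z))%C a (a + 1)) <= 2 * ((3 + Cmod (L1 - p z)) * e) * (a + 1 - a))%R).
{ apply CInt_bound; [lra| |].
  - intros t Ht'. apply ccont_plus; [apply (CH d); [lra|assumption]|apply ccont_const].
  - intros t Ht'.
    replace (H (t, d) + (L1 - p z)) with ((p (t, d) - L1) * ker z (t, d) + (L1 - p z) * (ker z (t, d) + 1)) by (unfold H; ring).
    eapply Rle_trans; [apply Cmod_triangle|]. rewrite !Cmod_mult.
    assert (Q1 := P3 (t, d) ltac:(simpl; lra)). assert (Q2 := K1 z (t, d) ltac:(simpl; lra)).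
    assert (Q3 := Cmod_triangle (ker z (t, d) + 1) (- (1))). rewrite Cmod_opp, Cmod_1 in Q3.
    replace (ker z (t, d) + 1 + - (1)) with (ker z (t, d)) in Q3 by ring.
    assert (Cmod (p (t, d) - L1) * Cmod (ker z (t, d)) <= e * 3)%R by (apply Rmult_le_compat; try apply Cmod_ge_0; lra).
    assert (Cmod (L1 - p z) * Cmod (ker z (t, d) + 1) <= Cmod (L1 - p z) * e)%R by (apply Rmult_le_compat_l; [apply Cmod_ge_0|lra]).
    lra. }
rewrite CInt_plus, CInt_const in U2; [|lra|apply CH; lra|apply cont_seg_const].
rewrite <- BH in U2. replace (a + 1 - a)%R with 1%R in U1, U2 by ring.
set (I := CInt (fun t => H (t, c)) a (a + 1)) in *.
assert (T := Cmod_triangle (I + RtoC 1 * (L1 - p z)) (- I)). rewrite Cmod_opp in T.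
replace (I + RtoC 1 * (L1 - p z) + - I) with (L1 - p z) in T by ring.
apply Rle_trans with (e * (2 * (B + (3 + Cmod (L1 - p z)))))%R; [lra|].
apply Rmult_le_compat_r; [|lra]. assert (Q := Cmod_ge_0 (L1 - p z)). lra.
Qed.

(** * An additive Cousin problem on the unit square centred at 1 *)

Section Cousin.
Variable d : CC -> CC.
Hypothesis Hd : hol_rect d (/ 2) (/ 2 + 1) (- / 2) (/ 2).

Let bot z := CInt (fun t => d (t, - / 2)%R / ((t, - / 2)%R - z)) (/ 2) (/ 2 + 1).
Let top z := CInt (fun t => d (t, / 2)%R / ((t, / 2)%R - z)) (/ 2) (/ 2 + 1).
Let right z := CInt (fun t => d ((/ 2 + 1)%R, t) / (((/ 2 + 1)%R, t) - z)) (- / 2) (/ 2).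
Let left z := CInt (fun t => d ((/ 2)%R, t) / (((/ 2)%R, t) - z)) (- / 2) (/ 2).

(** Cauchy's formula for the square is split: [a1] is the integral over the right side, [a2] minus
    the integral over the other three. Their difference is [d] inside and 0 outside. The split lets
    [a1] be holomorphic on the closed unit disc, and [a2] across the real axis right of 1/2 and at
    infinity. *)
Lemma cousin : exists a1 a2 : CC -> CC,
  (forall z, (Re z <> / 2 + 1 \/ / 2 < Rabs (Im z))%R -> hol a1 z) /\
  (forall z, ((/ 2 < Re z /\ - / 2 < Im z < / 2) \/ Re z < / 2 \/ / 2 + 1 < Re z \/ / 2 < Rabs (Im z))%R -> hol a2 z) /\
  (forall z, (/ 2 < Re z < / 2 + 1)%R -> (- / 2 < Im z < / 2)%R -> a1 z - a2 z = d z) /\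
  (forall z, (Re z < / 2 \/ / 2 + 1 < Re z \/ / 2 < Rabs (Im z))%R -> a1 z = a2 z) /\
  (exists k, nearC 0 (fun u => hol k u) /\ nearC 0 (fun u : CC => u <> 0 -> a2 (/ u) = k u)).
Proof.
assert (T := twopii_neq0).
assert (CB : cont_bdry d (/ 2) (/ 2 + 1) (- / 2) (/ 2)) by now apply hol_rect_bdry.
assert (C1 := cont_bdry_bot d (/ 2) (/ 2 + 1) (- / 2) (/ 2) ltac:(lra) ltac:(lra) CB).
assert (C2 := cont_bdry_top d (/ 2) (/ 2 + 1) (- / 2) (/ 2) ltac:(lra) ltac:(lra) CB).
assert (C3 := cont_bdry_left d (/ 2) (/ 2 + 1) (- / 2) (/ 2) ltac:(lra) ltac:(lra) CB).
assert (C4 := cont_bdry_right d (/ 2) (/ 2 + 1) (- / 2) (/ 2) ltac:(lra) ltac:(lra) CB).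
assert (L1 : forall y a b, cont_seg (fun t => (t, y) : CC) a b) by (intros y a b t _; apply ccont_hline).
assert (L2 : forall x a b, cont_seg (fun t => (x, t) : CC) a b) by (intros x a b t _; apply ccont_vline).
exists (fun z => Ci / twopii * right z), (fun z => / twopii * (top z - bot z + Ci * left z)).
assert (BX : forall z, Ci / twopii * right z - / twopii * (top z - bot z + Ci * left z)
   = / twopii * box (fun x => d x / (x - z)) (/ 2) (/ 2 + 1) (- / 2) (/ 2)).
{ intros z. unfold box. fold (bot z) (top z) (right z) (left z). field. assumption. }
assert (AB : forall r, (/ 2 < Rabs r)%R -> (- / 2 <= r <= / 2)%R -> False).
{ intros r H1 H2. assert (Rabs r <= / 2)%R by (apply Rabs_le; lra). lra. }
split; [|split; [|split; [|split]]].
- intros z Hz. holo.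
  apply (hol_cauchy_int (fun t => d ((/ 2 + 1)%R, t)) (fun t => ((/ 2 + 1)%R, t))); auto; [lra|].
  intros t Ht <-. simpl in Hz. destruct Hz as [Hz|Hz]; [lra|eauto].
- intros z Hz. apply hol_mult; [apply hol_const|]. holo.
  + apply (hol_cauchy_int (fun t => d (t, / 2)%R) (fun t => (t, / 2)%R)); auto; [lra|].
    intros t Ht <-. simpl in Hz. destruct Hz as [Hz|[Hz|[Hz|Hz]]]; try lra. apply (AB _ Hz). lra.
  + apply (hol_cauchy_int (fun t => d (t, - / 2)%R) (fun t => (t, - / 2)%R)); auto; [lra|].
    intros t Ht <-. simpl in Hz. destruct Hz as [Hz|[Hz|[Hz|Hz]]]; try lra. apply (AB _ Hz). lra.
  + apply (hol_cauchy_int (fun t => d ((/ 2)%R, t)) (fun t => ((/ 2)%R, t))); auto; [lra|].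
    intros t Ht <-. simpl in Hz. destruct Hz as [Hz|[Hz|[Hz|Hz]]]; try lra. apply (AB _ Hz). lra.
- intros z H1 H2. rewrite BX, box_cauchy by assumption. field. assumption.
- intros z Hz. apply Ceq_minus. rewrite BX, goursat; try lra; [ring|].
  intros x X1 X2. apply hol_div; [now apply Hd|apply hol_minus; [apply hol_id|apply hol_const]|].
  apply Cminus_eq_contra. intros ->. destruct Hz as [Hz|[Hz|Hz]]; try lra. apply (AB _ Hz). lra.
- destruct (cauchy_int_oo (fun t => d (t, / 2)%R) (fun t => (t, / 2)%R) (/ 2) (/ 2 + 1)) as [k1 [K1 E1]]; auto; [lra| |].
  { intros t Ht Q. apply (f_equal fst) in Q. simpl in Q. lra. }
  destruct (cauchy_int_oo (fun t => d (t, - / 2)%R) (fun t => (t, - / 2)%R) (/ 2) (/ 2 + 1)) as [k2 [K2 E2]]; auto; [lra| |].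
  { intros t Ht Q. apply (f_equal fst) in Q. simpl in Q. lra. }
  destruct (cauchy_int_oo (fun t => d ((/ 2)%R, t)) (fun t => ((/ 2)%R, t)) (- / 2) (/ 2)) as [k3 [K3 E3]]; auto; [lra| |].
  { intros t Ht Q. apply (f_equal fst) in Q. simpl in Q. lra. }
  exists (fun u => / twopii * (k1 u - k2 u + Ci * k3 u)). split.
  + near_by (filter_and _ _ K1 (filter_and _ _ K2 K3)). intros u [U1 [U2 U3]].
    apply hol_mult; [apply hol_const|]. holo.
  + near_by (filter_and _ _ E1 (filter_and _ _ E2 E3)). intros u [U1 [U2 U3]] Hu.
    unfold top, bot, left. now rewrite U1, U2, U3.
Qed.
End Cousin.

(** * Periodic representatives of translation-invariant hyperfunctions *)

(** A real point is approached vertically by nonreal ones. *)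
Lemma ccont_eq_off_T (f g : CC -> CC) (y : CC) : ccontC f y -> ccontC g y ->
  nearC y (fun z => off_T z -> f z = g z) -> f y = g y.
Proof.
intros Hf Hg N. destruct (Req_dec (Im y) 0) as [Hy|Hy].
2:{ exact (locally_singleton _ _ N Hy). }
destruct (Ceq_dec (f y) (g y)) as [Q|Q]; [exact Q|exfalso].
apply Cminus_eq_contra in Q.
assert (N2 := ccont_neq0 (fun z => f z - g z) y (ccont_minus _ _ _ Hf Hg) Q).
assert (N3 := filter_and _ _ N N2). apply nearC_spec in N3. destruct N3 as [d [Hd N3]].
destruct (N3 (y + RtoC (d / 2) * Ci)) as [P1 P2].
- replace (y + RtoC (d / 2) * Ci - y) with (RtoC (d / 2) * Ci) by ring.
  rewrite Cmod_mult, Cmod_R, Cmod_Ci, Rabs_pos_eq; lra.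
- apply P2. rewrite P1; [ring|]. unfold off_T. destruct y as [y1 y2]; simpl in *. lra.
Qed.

(** Vanishing of the hyperfunction germ of [D] at [x]. Values of [D] on the real line are ignored,
    while [g] is holomorphic on a full neighbourhood. *)
Definition ext (D : CC -> CC) (x : CC) : Prop :=
  exists g, nearC x (fun z => hol g z /\ (off_T z -> D z = g z)).

Lemma ext_hol g x : nearC x (fun z => hol g z) -> ext g x.
Proof. intros H. exists g. near_by H. auto. Qed.

Lemma ext_eq D1 D2 x : nearC x (fun z => off_T z -> D1 z = D2 z) -> ext D1 x -> ext D2 x.
Proof.
intros H [g Hg]. exists g. near_by (filter_and _ _ H Hg).
intros z [A [B1 B2]]. split; [assumption|]. intros Hz. rewrite <- A; auto.
Qed.

Lemma ext_plus D1 D2 x : ext D1 x -> ext D2 x -> ext (fun z => D1 z + D2 z) x.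
Proof.
intros [g Hg] [h Hh]. exists (fun z => g z + h z). near_by (filter_and _ _ Hg Hh).
intros z [[A1 A2] [B1 B2]]. split; [now apply hol_plus|]. intros Hz. now rewrite A2, B2.
Qed.

Lemma ext_mul k D x : nearC x (fun z => hol k z) -> ext D x -> ext (fun z => k z * D z) x.
Proof.
intros Hk [g Hg]. exists (fun z => k z * g z). near_by (filter_and _ _ Hk Hg).
intros z [A1 [B1 B2]]. split; [now apply hol_mult|]. intros Hz. now rewrite B2.
Qed.

Lemma ext_minus D1 D2 x : ext D1 x -> ext D2 x -> ext (fun z => D1 z - D2 z) x.
Proof.
intros H1 H2. apply ext_eq with (fun z => D1 z + (fun _ => - (1)) z * D2 z).
- apply filter_forall. intros; ring.
- apply ext_plus; [assumption|]. apply ext_mul; [|assumption].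
  apply filter_forall. intros; holo.
Qed.

Lemma near_comp (m : CC -> CC) (P : CC -> Prop) x : ccontC m x -> nearC (m x) P -> nearC x (fun z => P (m z)).
Proof. intros Hm HP. exact (ccont_continuous m x Hm P HP). Qed.

Lemma ext_comp D m x : nearC x (fun z => hol m z) -> nearC x (fun z => off_T z -> off_T (m z)) ->
  ext D (m x) -> ext (fun z => D (m z)) x.
Proof.
intros Hm Ho [g Hg]. exists (fun z => g (m z)).
assert (Hx := locally_singleton _ _ Hm).
near_by (filter_and _ _ Hm (filter_and _ _ Ho (near_comp m _ x (hol_cont _ _ Hx) Hg))).
intros z [A [B [C1 C2]]]. split; [now apply hol_comp|]. auto.
Qed.

(** At each real point of [X] the value is taken from an extension chosen there; by continuity any
    two local extensions agree on the real points they share. *)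
Lemma ext_glue_on D (X : R -> Prop) : (forall x : R, X x -> nearC x (fun z => X (Re z))) ->
  (forall x : R, X x -> ext D (RtoC x)) ->
  exists G, (forall x : R, X x -> nearC x (fun z => hol G z)) /\ (forall z, off_T z -> G z = D z).
Proof.
intros HX H.
pose (ge := fun x : R => match excluded_middle_informative (X x) with
  | left h => proj1_sig (constructive_indefinite_description _ (H x h)) (RtoC x) | right _ => 0 end).
exists (fun z => if Req_EM_T (Im z) 0 then ge (Re z) else D z). split.
2:{ intros z Hz. unfold off_T in Hz. now destruct (Req_EM_T (Im z) 0). }
intros x Hx. destruct (H x Hx) as [g Hg].
assert (Hg' := locally_locally _ _ Hg).
assert (Q : nearC x (fun z => g z = (if Req_EM_T (Im z) 0 then ge (Re z) else D z))).
{ near_by (filter_and _ _ Hg' (HX x Hx)). intros z [Hz HXz]. destruct (Req_EM_T (Im z) 0) as [E0|E0].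
  2:{ symmetry. now apply (locally_singleton _ _ Hz). }
  unfold ge. destruct (excluded_middle_informative (X (Re z))) as [h|h]; [|easy].
  destruct (constructive_indefinite_description _ (H (Re z) h)) as [k Hk]. simpl.
  assert (Ez : z = RtoC (Re z)) by (destruct z; simpl in *; unfold RtoC; f_equal; assumption).
  rewrite <- Ez in Hk |- *.
  apply ccont_eq_off_T.
  - apply hol_cont, (locally_singleton _ _ Hz).
  - apply hol_cont, (locally_singleton _ _ Hk).
  - near_by (filter_and _ _ Hk Hz). intros w [[_ A] [_ B]] Hw. rewrite <- A, <- B; auto. }
apply locally_locally in Q.
near_by (filter_and _ _ Q Hg). intros z [A [B _]].
now apply hol_ext_loc with g.
Qed.

Lemma ext_glue D : (forall x : R, ext D (RtoC x)) ->
  exists G, (forall x : R, nearC x (fun z => hol G z)) /\ (forall z, off_T z -> G z = D z).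
Proof.
intros H. destruct (ext_glue_on D (fun _ => True)) as [G [G1 G2]]; [intros; now apply filter_forall|auto|].
exists G. auto.
Qed.

Lemma tube (Q : CC -> Prop) a b : (forall x : R, nearC x Q) ->
  exists d, (0 < d)%R /\ forall z, (a <= Re z <= b)%R -> (Rabs (Im z) <= d)%R -> Q z.
Proof.
intros H.
assert (H' : forall x : R, exists e : posreal, forall z, (Cmod (z - RtoC x) < 2 * e)%R -> Q z).
{ intros x. destruct (proj1 (nearC_spec _ _) (H x)) as [d [Hd Hq]].
  exists (mkposreal (d / 2) ltac:(lra)). simpl. intros z Hz. apply Hq. lra. }
pose (dl := fun x => proj1_sig (constructive_indefinite_description _ (H' x))).
destruct (compactness_value_1d a b dl) as [d Hd].
exists (d / 2)%R. split; [assert (Q1 := cond_pos d); lra|].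
intros z Hz1 Hz2. destruct (excluded_middle_informative (Q z)) as [Y|N]; [exact Y|exfalso].
apply (Hd (Re z) Hz1). intros [t [Ht [H1 H2]]]. apply N.
unfold dl in H1, H2. destruct (constructive_indefinite_description _ (H' t)) as [e He]. simpl in H1, H2.
apply He. eapply Rle_lt_trans; [apply Cmod_le_ReIm|].
change (Re (z - RtoC t)) with (Re z - t)%R. replace (Im (z - RtoC t)) with (Im z) by (destruct z; simpl; ring).
assert (Q1 := cond_pos d). lra.
Qed.

Lemma off_T_abs (x y : R) : (0 < Rabs y)%R -> off_T (x, y).
Proof. intros H Q. simpl in Q. rewrite Q, Rabs_R0 in H. lra. Qed.

Lemma pair_plus1 (x y : R) : (x, y) + 1 = ((x + 1)%R, y) :> CC.
Proof. unfold Cplus, RtoC; simpl. f_equal; ring. Qed.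

(** * The periodic representative as an integral of Cauchy type *)

Section PeriodicRep.
Variables (phi G : CC -> CC) (d : R).
Hypothesis Hd : (0 < d)%R.
(** The range [-1, 3] contains the intervals [a, a + 1] with -1 <= a <= 1 and their translates by
    one. *)
Hypothesis Hphi : forall z, (-1 <= Re z <= 3)%R -> (Rabs (Im z) <= d)%R -> off_T z -> hol phi z.
Hypothesis HG : forall z, (-1 <= Re z <= 3)%R -> (Rabs (Im z) <= d)%R -> hol G z.
Hypothesis HGphi : forall z, off_T z -> G z = phi (z + 1) - phi z.

(** Boundary integral of [phi * ker z] over [[a, a+1] x [-e, e]], where the two vertical sides are merged
    into one integral of the jump [G], which is holomorphic across the real line. *)
Let J a e z := CInt (fun t => phi (t, - e)%R * ker z (t, - e)%R) a (a + 1)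
  - CInt (fun t => phi (t, e) * ker z (t, e)) a (a + 1)
  + Ci * CInt (fun t => G (a, t) * ker z (a, t)) (- e) e.

Let okz z x := qexp x <> qexp z.

Lemma cont_phi_ker_h a b y z : (-1 <= a)%R -> (b <= 3)%R -> (0 < Rabs y <= d)%R ->
  (forall t, (a <= t <= b)%R -> okz z (t, y)) -> cont_seg (fun t => phi (t, y) * ker z (t, y)) a b.
Proof.
intros Ha Hb Hy Ho. apply cont_hseg with (f := fun x => phi x * ker z x). intros t Ht. apply ccont_mult; apply hol_cont.
- apply Hphi; simpl; try lra. apply off_T_abs. lra.
- apply hol_ker, Ho, Ht.
Qed.

Lemma cont_G_ker_v x a b z : (-1 <= x <= 3)%R -> (- d <= a)%R -> (b <= d)%R ->
  (forall t, (a <= t <= b)%R -> okz z (x, t)) -> cont_seg (fun t => G (x, t) * ker z (x, t)) a b.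
Proof.
intros Hx Ha Hb Ho. apply cont_vseg with (f := fun w => G w * ker z w). intros t Ht. apply ccont_mult; apply hol_cont.
- apply HG; simpl; try lra. apply Rabs_le; lra.
- apply hol_ker, Ho, Ht.
Qed.

(** Off the real line [G] is the actual jump of [phi] and the kernel is periodic, so the merged form
    is the true boundary integral. *)
Lemma box_phi_ker a c e z : (-1 <= a <= 1)%R -> (c <= e)%R -> (- d <= c)%R -> (e <= d)%R -> (0 < c \/ e < 0)%R ->
  (forall x, bdry a (a + 1) c e x -> okz z x) ->
  box (fun x => phi x * ker z x) a (a + 1) c e =
  CInt (fun t => phi (t, c) * ker z (t, c)) a (a + 1) - CInt (fun t => phi (t, e) * ker z (t, e)) a (a + 1)
  + Ci * CInt (fun t => G (a, t) * ker z (a, t)) c e.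
Proof.
intros Ha Hce Hc He H0 Ho. unfold box. f_equal. f_equal.
assert (C : forall x, (x = a \/ x = a + 1)%R -> cont_seg (fun t => phi (x, t) * ker z (x, t)) c e).
{ intros x Hx. apply cont_vseg with (f := fun w => phi w * ker z w). intros t Ht. apply ccont_mult; apply hol_cont.
  - apply Hphi; simpl; [lra|apply Rabs_le; lra|unfold off_T; simpl; lra].
  - apply hol_ker, Ho. unfold bdry; simpl. lra. }
rewrite <- CInt_minus; [|assumption|apply C; lra|apply C; lra].
apply CInt_ext; [assumption|]. intros t Ht. rewrite HGphi by (unfold off_T; simpl; lra).
rewrite pair_plus1.
replace (ker z ((a + 1)%R, t)) with (ker z (a, t)); [ring|].
now rewrite <- ker_period, pair_plus1.
Qed.

Lemma J_diff a e e' z : (-1 <= a <= 1)%R -> (0 < e' < e)%R -> (e <= d)%R ->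
  (forall x, bdry a (a + 1) e' e x -> okz z x) -> (forall x, bdry a (a + 1) (- e) (- e') x -> okz z x) ->
  (forall t, (- e' <= t <= e')%R -> okz z (a, t)) ->
  J a e z = J a e' z + box (fun x => phi x * ker z x) a (a + 1) e' e
    + box (fun x => phi x * ker z x) a (a + 1) (- e) (- e').
Proof.
intros Ha He Hed O1 O2 O3.
rewrite !box_phi_ker; try assumption; try lra. unfold J.
assert (CG : cont_seg (fun t => G (a, t) * ker z (a, t)) (- e) e).
{ apply cont_G_ker_v; try lra. intros t Ht.
  destruct (Rle_dec t (- e')) as [T|T]; [apply O2; unfold bdry; simpl; lra|].
  destruct (Rle_dec e' t) as [T2|T2]; [apply O1; unfold bdry; simpl; lra|]. apply O3; lra. }
rewrite (CInt_Chasles (fun t => G (a, t) * ker z (a, t)) (- e) (- e') e) by (lra || exact CG).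
rewrite (CInt_Chasles (fun t => G (a, t) * ker z (a, t)) (- e') e' e); try lra.
- ring.
- intros t Ht. apply CG. lra.
Qed.

Lemma J_outside a e e' z : (-1 <= a <= 1)%R -> (0 < e' < e)%R -> (e <= d)%R -> (e < Rabs (Im z))%R -> J a e z = J a e' z.
Proof.
intros Ha He Hed Hz.
assert (O : forall x, (Rabs (Im x) <= e)%R -> okz z x).
{ intros x Hx Q. apply qexp_eq_Im in Q. rewrite Q in Hx. lra. }
rewrite (J_diff a e e'); auto.
- rewrite !goursat; try lra; [ring| |]; intros x X1 X2; (apply hol_mult; [apply Hphi|apply hol_ker, O]);
    try (apply Rabs_le; lra); try lra; unfold off_T; lra.
- intros x [X1 [X2 _]]. apply O. apply Rabs_le; lra.
- intros x [X1 [X2 _]]. apply O. apply Rabs_le; lra.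
- intros t Ht. apply O. simpl. apply Rabs_le; lra.
Qed.

(** The point lies in exactly one of the two added rectangles, whose integral is [phi z] by Cauchy's
    formula. Thus the large contour continues [phi] plus the small-contour integral across the real
    line. *)
Lemma J_inside a e e' z : (-1 <= a <= 1)%R -> (0 < e' < e)%R -> (e <= d)%R -> (e' < Rabs (Im z) < e)%R ->
  (a < Re z < a + 1)%R -> J a e z = J a e' z + phi z.
Proof.
intros Ha He Hed Hz Hza.
assert (O1 : forall x, (Rabs (Im x) = e \/ Rabs (Im x) <= e')%R -> okz z x).
{ intros x Hx Q. apply qexp_eq_Im in Q. rewrite Q in Hx. lra. }
assert (O2 : forall x, (Re x = a \/ Re x = a + 1)%R -> okz z x).
{ intros x Hx Q. apply qexp_inj in Q; [subst; lra|]. apply Rabs_def1; lra. }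
assert (Ob : forall x, bdry a (a + 1) e' e x -> okz z x).
{ intros x [X1 [X2 X3]]. destruct X3 as [X|[X|X]]; [apply O2; auto|apply O2; auto|]. apply O1.
  rewrite Rabs_pos_eq; lra. }
assert (Oc : forall x, bdry a (a + 1) (- e) (- e') x -> okz z x).
{ intros x [X1 [X2 X3]]. destruct X3 as [X|[X|X]]; [apply O2; auto|apply O2; auto|]. apply O1.
  rewrite Rabs_left1; lra. }
rewrite (J_diff a e e'); auto.
assert (Hp : forall c f, (0 < c \/ f < 0)%R -> (- d <= c)%R -> (f <= d)%R -> hol_rect phi a (a + 1) c f).
{ intros c f H0 Hc Hf x X1 X2. apply Hphi; [lra|apply Rabs_le; lra|unfold off_T; lra]. }
assert (Hk : forall c f, (f < Im z \/ Im z < c)%R -> hol_rect (ker z) a (a + 1) c f).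
{ intros c f H x X1 X2. apply hol_ker. intros Q. apply qexp_eq_Im in Q. lra. }
unfold Rabs in Hz. destruct (Rcase_abs (Im z)) as [N|N].
- rewrite (goursat _ _ _ e' e); try lra.
  + rewrite box_mul_ker; [ring|apply Hp; lra|assumption|lra].
  + intros x X1 X2. apply hol_mult; [apply (Hp e' e); lra|apply (Hk e' e); lra].
- rewrite (goursat _ _ _ (- e) (- e')); try lra.
  + rewrite box_mul_ker; [ring|apply Hp; lra|assumption|lra].
  + intros x X1 X2. apply hol_mult; [apply (Hp (- e)%R (- e')%R); lra|apply (Hk (- e)%R (- e')%R); lra].
Qed.

(** Moving the base point changes each horizontal integral by that of [G] times the kernel over
    [0, a], and Goursat for this product on [0, a] x [-e, e] compensates the change of the vertical
    term. *)
Lemma J_base a e z : (0 <= a <= 1)%R -> (0 < e)%R -> (e <= d)%R -> (e < Rabs (Im z))%R -> J a e z = J 0 e z.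
Proof.
intros Ha He Hed Hz.
assert (O : forall x, (Rabs (Im x) <= e)%R -> okz z x).
{ intros x Hx Q. apply qexp_eq_Im in Q. rewrite Q in Hx. lra. }
assert (Gb : box (fun x => G x * ker z x) 0 a (- e) e = 0).
{ apply goursat; try lra. intros x X1 X2. assert (Rabs (Im x) <= e)%R by (apply Rabs_le; lra).
  apply hol_mult; [apply HG; lra|apply hol_ker, O; assumption]. }
assert (Hy : forall y, (Rabs y = e)%R ->
  CInt (fun t => phi (t, y) * ker z (t, y)) a (a + 1) - CInt (fun t => phi (t, y) * ker z (t, y)) 0 1
  = CInt (fun t => G (t, y) * ker z (t, y)) 0 a).
{ intros y Hy.
  assert (C : cont_seg (fun t => phi (t, y) * ker z (t, y)) 0 (a + 1)).
  { apply cont_phi_ker_h; try lra. intros t Ht. apply O. simpl. lra. }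
  assert (S1 := CInt_Chasles _ 0 a (a + 1) ltac:(lra) ltac:(lra) C).
  assert (S2 := CInt_Chasles _ 0 1 (a + 1) ltac:(lra) ltac:(lra) C).
  assert (S3 := CInt_shift (fun t => phi (t, y) * ker z (t, y)) 0 a 1 ltac:(lra)). cbv beta in S3. rewrite Rplus_0_l in S3.
  rewrite (CInt_ext _ (fun t => phi ((t + 1)%R, y) * ker z ((t + 1)%R, y) - phi (t, y) * ker z (t, y)) 0 a); [|lra|].
  - rewrite CInt_minus; try lra.
    + rewrite S3 by (intros t Ht; apply C; lra).
      replace (CInt (fun t => phi (t, y) * ker z (t, y)) a (a + 1)) with
        (CInt (fun t => phi (t, y) * ker z (t, y)) 0 (a + 1) - CInt (fun t => phi (t, y) * ker z (t, y)) 0 a) by (rewrite S1; ring).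
      rewrite S2. ring.
    + intros t Ht. apply (ccont_mult (fun t => phi ((t + 1)%R, y)) (fun t => ker z ((t + 1)%R, y))).
      * apply (ccont_comp phi (fun t => ((t + 1)%R, y))).
        -- apply hol_cont, Hphi; simpl; try lra. apply off_T_abs. lra.
        -- split; simpl; [apply rcont_plus; [apply rcontR_id|apply rcont_const]|apply rcont_const].
      * apply (ccont_comp (ker z) (fun t => ((t + 1)%R, y))).
        -- apply hol_cont, hol_ker, O. simpl. lra.
        -- split; simpl; [apply rcont_plus; [apply rcontR_id|apply rcont_const]|apply rcont_const].
    + intros t Ht. apply C. lra.
  - intros t Ht. rewrite HGphi.
    2:{ apply off_T_abs. lra. }
    rewrite pair_plus1.
    replace (ker z ((t + 1)%R, y)) with (ker z (t, y)); [ring|].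
    now rewrite <- ker_period, pair_plus1. }
unfold box in Gb. unfold J.
rewrite <- (Hy (- e)%R), <- (Hy e) in Gb.
- rewrite Rplus_0_l. apply Ceq_minus. rewrite <- Gb. ring.
- apply Rabs_pos_eq; lra.
- rewrite Rabs_Ropp. apply Rabs_pos_eq; lra.
Qed.

Lemma hol_J a e z : (-1 <= a <= 1)%R -> (0 < e)%R -> (e <= d)%R ->
  (e < Rabs (Im z) \/ (Rabs (Im z) < e /\ a < Re z < a + 1))%R -> hol (J a e) z.
Proof.
intros Ha He Hed Hz.
assert (He1 : Rabs e = e) by (apply Rabs_pos_eq; lra).
assert (O1 : forall x, (Rabs (Im x) = e)%R -> okz z x).
{ intros x Hx Q. apply qexp_eq_Im in Q. rewrite Q in Hx. lra. }
assert (O2 : forall x, (Re x = a)%R -> (Rabs (Im x) <= e)%R -> okz z x).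
{ intros x Hx Hx2 Q. destruct Hz as [Hz|[_ Hz]]; [apply qexp_eq_Im in Q; rewrite Q in Hx2; lra|].
  apply qexp_inj in Q; [subst; lra|]. apply Rabs_def1; lra. }
assert (Cp : forall y, (Rabs y = e)%R -> cont_seg (fun t => phi (t, y)) a (a + 1)).
{ intros y Hy. apply cont_hseg. intros t Ht. apply hol_cont, Hphi; simpl; try lra.
  apply off_T_abs. lra. }
holo.
- apply (hol_ker_int (fun t => phi (t, - e)%R) (fun t => (t, - e)%R)); [lra| | |].
  + apply Cp. rewrite Rabs_Ropp; lra.
  + intros t _; apply ccont_hline.
  + intros t Ht. apply O1. simpl. rewrite Rabs_Ropp; lra.
- apply (hol_ker_int (fun t => phi (t, e)) (fun t => (t, e))); [lra|now apply Cp| |].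
  + intros t _; apply ccont_hline.
  + intros t Ht. now apply O1.
- apply (hol_ker_int (fun t => G (a, t)) (fun t => (a, t))); [lra| | |].
  + apply cont_vseg. intros t Ht. apply hol_cont, HG; simpl; [lra|apply Rabs_le; lra].
  + intros t _; apply ccont_vline.
  + intros t Ht. apply O2; simpl; [reflexivity|apply Rabs_le; lra].
Qed.

Lemma int_ker_ilim s k h g a b : Rabs s = 1%R ->
  (forall e, (0 < e)%R -> exists M, (0 < M)%R /\ forall z x, (M < s * (Im z - Im x))%R -> (Cmod (ker z x - k) < e)%R) ->
  (a <= b)%R -> cont_seg h a b -> cont_seg g a b -> (forall t, (a <= t <= b)%R -> (Rabs (Im (g t)) <= d)%R) ->
  ilim s (fun z => CInt (fun t => h t * ker z (g t)) a b) (k * CInt h a b).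
Proof.
intros Hs Hk Hab Hh Hg Hgd e He. destruct (cont_seg_bounded h a b Hab Hh) as [H [HH HH']].
assert (He' : (0 < e / (2 * H * (b - a + 1)))%R) by (apply Rdiv_lt_0_compat; [|apply Rmult_lt_0_compat]; lra).
destruct (Hk _ He') as [M [HM K]]. exists (M + d)%R. intros z Hz.
assert (Hi : forall t, (a <= t <= b)%R -> (M < s * (Im z - Im (g t)))%R).
{ intros t Ht. specialize (Hgd t Ht). assert (Q := Rle_abs (s * Im (g t))). rewrite Rabs_mult, Hs in Q. lra. }
assert (Cz : cont_seg (fun t => h t * ker z (g t)) a b).
{ apply cont_seg_mul_ker; auto. intros t Ht Q. apply qexp_eq_Im in Q. specialize (Hi t Ht). rewrite Q in Hi. lra. }
rewrite <- CInt_scal, <- CInt_minus by auto using cont_seg_scal.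
eapply Rle_lt_trans; [apply (CInt_bound _ a b (H * (e / (2 * H * (b - a + 1)))) Hab)|].
- intros t Ht. apply ccont_minus; [|apply cont_seg_scal with (1 := Hh)]; auto.
- intros t Ht. replace (h t * ker z (g t) - k * h t) with (h t * (ker z (g t) - k)) by ring.
  rewrite Cmod_mult. apply Rmult_le_compat; try apply Cmod_ge_0; auto. left. auto.
- replace (2 * (H * (e / (2 * H * (b - a + 1)))) * (b - a))%R with (e * ((b - a) / (b - a + 1)))%R by (field; lra).
  rewrite <- (Rmult_1_r e) at 2. apply Rmult_lt_compat_l; [lra|].
  apply (Rmult_lt_reg_r (b - a + 1)); [lra|]. unfold Rdiv. rewrite Rmult_assoc, Rinv_l; lra.
Qed.

Lemma J_ilim s k : Rabs s = 1%R ->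
  (forall e, (0 < e)%R -> exists M, (0 < M)%R /\ forall z x, (M < s * (Im z - Im x))%R -> (Cmod (ker z x - k) < e)%R) ->
  exists L, ilim s (fun z => - J 0 d z) L.
Proof.
intros Hs Hk.
assert (A : Rabs d = d) by (apply Rabs_pos_eq; lra). assert (A' : Rabs (- d) = d) by (rewrite Rabs_Ropp; apply A).
assert (Cp : forall y, (Rabs y = d)%R -> ilim s (fun z => CInt (fun t => phi (t, y) * ker z (t, y)) 0 (0 + 1))
  (k * CInt (fun t => phi (t, y)) 0 (0 + 1))).
{ intros y Hy. apply (int_ker_ilim s k (fun t => phi (t, y)) (fun t => (t, y))); auto; [lra| | |].
  - apply cont_hseg. intros t Ht. apply hol_cont, Hphi; simpl; try lra.
    apply off_T_abs. lra.
  - intros t _; apply ccont_hline.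
  - intros t _; simpl; lra. }
assert (CG : ilim s (fun z => CInt (fun t => G (0%R, t) * ker z (0%R, t)) (- d) d) (k * CInt (fun t => G (0%R, t)) (- d) d)).
{ apply (int_ker_ilim s k (fun t => G (0%R, t)) (fun t => (0%R, t))); auto; [lra| | |].
  - apply cont_vseg. intros t Ht. apply hol_cont, HG; simpl; [lra|apply Rabs_le; lra].
  - intros t _; apply ccont_vline.
  - intros t Ht; simpl; apply Rabs_le; lra. }
eexists. apply ilim_ext with (c := 0%R)
  (2 := ilim_lin s (- Ci) _ _ _ _ CG (ilim_lin s (- (1)) _ _ _ _ (Cp (- d)%R A') (Cp d A))).
intros z _. unfold J. ring.
Qed.

(** The contour height shrinks with |Im z|, so that one formula covers both half planes entirely;
    [J_outside] makes the choice immaterial. *)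
Let P z := - J 0 (Rmin d (Rabs (Im z) / 2)) z.

Lemma P_J e z : (0 < e <= d)%R -> (e < Rabs (Im z))%R -> P z = - J 0 e z.
Proof.
intros He Hz. unfold P. f_equal. set (m := Rmin d (Rabs (Im z) / 2)).
assert (Hm : (0 < m /\ m <= d /\ m <= Rabs (Im z) / 2)%R).
{ unfold m. split; [apply Rmin_pos; lra|]. split; [apply Rmin_l|apply Rmin_r]. }
destruct (Rtotal_order m e) as [H|[H|H]].
- symmetry. apply J_outside; lra.
- now rewrite H.
- apply J_outside; lra.
Qed.

Lemma near_Im_gt (z : CC) c : (c < Rabs (Im z))%R -> nearC z (fun w => (c < Rabs (Im w))%R).
Proof.
intros H. apply (nearC_gt (fun w => Rabs (Im w))); [|assumption].
apply (rcont_comp Rabs Im); [apply rcont_Im|apply Rcontinuity_abs].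
Qed.

Lemma near_Im_lt (z : CC) c : (Rabs (Im z) < c)%R -> nearC z (fun w => (Rabs (Im w) < c)%R).
Proof.
intros H. apply (nearC_lt (fun w => Rabs (Im w))); [|assumption].
apply (rcont_comp Rabs Im); [apply rcont_Im|apply Rcontinuity_abs].
Qed.

Lemma P_hol z : off_T z -> hol P z.
Proof.
intros Hz. assert (Hz' : (0 < Rabs (Im z))%R) by now apply Rabs_pos_lt.
set (m := Rmin d (Rabs (Im z) / 2)).
assert (Hm : (0 < m /\ m <= d /\ m <= Rabs (Im z) / 2)%R).
{ unfold m. split; [apply Rmin_pos; lra|]. split; [apply Rmin_l|apply Rmin_r]. }
apply hol_ext_loc with (fun w => - J 0 m w).
- near_by (near_Im_gt z m ltac:(lra)). intros w Hw. symmetry. apply P_J; lra.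
- apply hol_opp, hol_J; lra.
Qed.

Lemma P_period z : P (z + 1) = P z.
Proof.
unfold P. replace (Im (z + 1)) with (Im z) by (destruct z; simpl; ring).
unfold J. f_equal. f_equal; [f_equal|f_equal]; apply CInt_ext.
all: try lra.
all: try (intros t _; now rewrite ker_period_z).
assert (0 <= Rmin d (Rabs (Im z) / 2))%R; [|lra].
apply Rmin_glb; [lra|]. assert (Q := Rabs_pos (Im z)). lra.
Qed.

(** The extension is [J a d]: passing to a contour below |Im z| picks up [phi z], and what is left
    is [- P z] after moving the base to 0. *)
Lemma P_ext_in a x : (0 <= a <= 1)%R -> (a < x < a + 1)%R -> ext (fun z => phi z - P z) x.
Proof.
intros Ha Hx. exists (J a d).
assert (N1 := near_Im_lt (RtoC x) d ltac:(simpl; rewrite Rabs_R0; lra)).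
assert (N2 := nearC_gt Re (RtoC x) a (rcont_Re _) ltac:(simpl; lra)).
assert (N3 := nearC_lt Re (RtoC x) (a + 1) (rcont_Re _) ltac:(simpl; lra)).
near_by (filter_and _ _ N1 (filter_and _ _ N2 N3)). intros z [Z1 [Z2 Z3]]. split.
- apply hol_J; lra.
- intros Hz. assert (Hz' : (0 < Rabs (Im z))%R) by now apply Rabs_pos_lt.
  rewrite (P_J (Rabs (Im z) / 2)), <- (J_base a), (J_inside a d (Rabs (Im z) / 2)) by lra. ring.
Qed.

Lemma Im_plus_1 z : Im (z + 1) = Im z.
Proof. destruct z; simpl; ring. Qed.

(** [P] is periodic and [phi] changes by [G] under translation, so the germs at [x] and [x + 1]
    differ by a holomorphic one. *)
Lemma P_ext_shift (HGe : forall x : R, nearC x (fun z => hol G z)) (x : R) :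
  ext (fun z => phi z - P z) x <-> ext (fun z => phi z - P z) (RtoC (x + 1)).
Proof.
assert (Em : RtoC x + 1 = RtoC (x + 1)) by (now rewrite RtoC_plus).
assert (En : RtoC (x + 1) - 1 = RtoC x) by (rewrite RtoC_plus; ring).
assert (Ho : forall z, off_T z -> off_T (z - 1)).
{ intros z Hz. unfold off_T in *. rewrite <- (Im_plus_1 (z - 1)). now replace (z - 1 + 1) with z by ring. }
assert (Ho' : forall z, off_T z -> off_T (z + 1)) by (intros z Hz; unfold off_T in *; now rewrite Im_plus_1).
assert (Hm : forall z, hol (fun w => w - 1) z) by (intros; apply hol_minus; [apply hol_id|apply hol_const]).
assert (Hm' : forall z, hol (fun w => w + 1) z) by (intros; apply hol_plus; [apply hol_id|apply hol_const]).
assert (F1 : forall z, off_T z -> phi (z - 1) - P (z - 1) + G (z - 1) = phi z - P z).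
{ intros z Hz. rewrite HGphi by auto. rewrite <- (P_period (z - 1)). replace (z - 1 + 1) with z by ring. ring. }
assert (F2 : forall z, off_T z -> phi (z + 1) - P (z + 1) - G z = phi z - P z).
{ intros z Hz. rewrite HGphi by auto. rewrite P_period. ring. }
split; intros H.
- apply ext_eq with (fun z => (fun w => phi w - P w) (z - 1) + G (z - 1)); [apply filter_forall; exact F1|].
  apply ext_plus.
  + apply (ext_comp (fun z => phi z - P z) (fun z => z - 1)); [apply filter_forall; exact Hm|apply filter_forall; exact Ho|].
    now rewrite En.
  + apply ext_hol. specialize (HGe x). rewrite <- En in HGe.
    assert (N := near_comp (fun w => w - 1) _ (RtoC (x + 1)) (hol_cont _ _ (Hm _)) HGe).
    near_by N. intros z Hz. now apply (hol_comp G (fun w => w - 1)).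
- apply ext_eq with (fun z => (fun w => phi w - P w) (z + 1) - G z); [apply filter_forall; exact F2|].
  apply ext_minus; [|apply ext_hol, HGe].
  apply (ext_comp (fun z => phi z - P z) (fun z => z + 1)); [apply filter_forall; exact Hm'|apply filter_forall; exact Ho'|].
  now rewrite Em.
Qed.

Lemma P_ext (HGe : forall x : R, nearC x (fun z => hol G z)) (x : R) : ext (fun z => phi z - P z) x.
Proof.
assert (Hn : forall n : nat, forall y, ext (fun z => phi z - P z) (RtoC y) <-> ext (fun z => phi z - P z) (RtoC (y + INR n))).
{ induction n as [|n IH]; intros y; [simpl; now rewrite Rplus_0_r|].
  rewrite S_INR, <- Rplus_assoc. rewrite <- (P_ext_shift HGe). apply IH. }
(* For base 0 the point 1 lies on a vertical side, so base 1/2 is used there. *)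
assert (B : forall y, (0 < y <= 1)%R -> ext (fun z => phi z - P z) (RtoC y)).
{ intros y Hy. destruct (Req_dec y 1) as [->|Q]; [apply (P_ext_in (/ 2)); lra|apply (P_ext_in 0); lra]. }
set (k := (up x - 1)%Z). destruct (archimed x) as [A1 A2].
assert (Hk : (0 < x - (IZR k - 1) <= 2)%R) by (unfold k; rewrite minus_IZR; lra).
assert (B2 : exists m : Z, (0 < x - IZR m <= 1)%R).
{ destruct (Rle_dec (x - (IZR k - 1)) 1) as [L|L].
  - exists (k - 1)%Z. rewrite minus_IZR. lra.
  - exists k. lra. }
destruct B2 as [m Hm]. specialize (B _ Hm).
destruct (Z_le_dec 0 m) as [S|S].
- apply (Hn (Z.to_nat m)) in B. rewrite INR_IZR_INZ, Z2Nat.id in B by assumption.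
  now replace (x - IZR m + IZR m)%R with x in B by ring.
- apply (Hn (Z.to_nat (- m))). rewrite INR_IZR_INZ, Z2Nat.id, opp_IZR by lia. exact B.
Qed.
End PeriodicRep.

Lemma periodic_rep phi :
  (forall x : R, nearC x (fun z => off_T z -> hol phi z)) ->
  (forall x : R, ext (fun z => phi (z + 1) - phi z) x) ->
  exists P L1 L2, (forall z, off_T z -> hol P z) /\ (forall z, P (z + 1) = P z) /\
    (forall x : R, ext (fun z => phi z - P z) x) /\ ilim 1 P L1 /\ ilim (-1) P L2.
Proof.
intros H1 H2. destruct (ext_glue _ H2) as [G [HG1 HG2]].
destruct (tube (fun z => (off_T z -> hol phi z) /\ hol G z) (-1) 3) as [d [Hd Ht]].
{ intros x. apply filter_and; auto. }
assert (A1 : forall z, (-1 <= Re z <= 3)%R -> (Rabs (Im z) <= d)%R -> off_T z -> hol phi z).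
{ intros z Z1 Z2. apply (Ht z Z1 Z2). }
assert (A2 : forall z, (-1 <= Re z <= 3)%R -> (Rabs (Im z) <= d)%R -> hol G z).
{ intros z Z1 Z2. apply (Ht z Z1 Z2). }
(* Here [z] moves and the contour stays, so the kernel tends to 0 at the top and to -1 at the
   bottom. *)
destruct (J_ilim phi G d Hd A1 A2 1 0) as [L1 HL1].
{ apply Rabs_R1. }
{ intros e He. destruct (ker_below e He) as [M [HM K]]. exists M. split; [assumption|]. intros z x Hx.
  replace (ker z x - 0) with (ker z x) by ring. apply K. lra. }
destruct (J_ilim phi G d Hd A1 A2 (-1) (- (1))) as [L2 HL2].
{ rewrite Rabs_left; lra. }
{ intros e He. destruct (ker_above e He) as [M [HM K]]. exists M. split; [assumption|]. intros z x Hx.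
  replace (ker z x - - (1)) with (ker z x + 1) by ring. apply K. lra. }
eexists _, L1, L2. split; [|split; [|split; [|split]]].
- exact (P_hol phi G d Hd A1 A2 HG2).
- exact (P_period phi G d Hd).
- exact (P_ext phi G d Hd A1 A2 HG2 HG1).
- apply ilim_ext with (2 := HL1) (c := d). intros z Hz. symmetry. apply (P_J phi G d Hd A1 A2 HG2 d); [lra|].
  assert (Q3 := Rle_abs (Im z)). lra.
- apply ilim_ext with (2 := HL2) (c := d). intros z Hz. symmetry. apply (P_J phi G d Hd A1 A2 HG2 d); [lra|].
  assert (Q3 := Rle_abs (- Im z)). rewrite Rabs_Ropp in Q3. lra.
Qed.

(** * Logarithm and powers *)

Lemma Cmod_sqr z : (Cmod z * Cmod z = Re z * Re z + Im z * Im z)%R.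
Proof. assert (H := Cmod2_alt z). simpl in H. lra. Qed.

Lemma slit_neq0 z : slit z -> z <> 0.
Proof. intros H ->. unfold slit in H. simpl in H. lra. Qed.

Lemma slit_denom_pos z : slit z -> (0 < Cmod z + Re z)%R.
Proof.
intros H. assert (M := Cmod_ge_0 z). assert (Q := Cmod_sqr z). unfold slit in H.
destruct (Rlt_dec 0 (Re z)) as [P|P]; [lra|]. destruct H as [H|H]; [|lra].
assert (0 < Im z * Im z)%R by nra. nra.
Qed.

(** With r = |z|, z = x + i y and u = y / (r + x), the tangent of half the argument, one has 1 + u^2
    = 2 r / (r + x); double-angle formulas finish. *)
Lemma Cexp_Clog z : slit z -> Cexp (Clog z) = z.
Proof.
intros Hs. assert (Hd := slit_denom_pos z Hs).
assert (Hr : (0 < Cmod z)%R) by (apply Cmod_gt_0, slit_neq0; assumption).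
assert (Q := Cmod_sqr z).
unfold Cexp, Clog; simpl. rewrite exp_ln by assumption.
set (r := Cmod z) in *. set (x := Re z) in *. set (y := Im z) in *. set (u := (y / (r + x))%R).
rewrite cos_2a, sin_2a, cos_atan, sin_atan.
assert (P : (0 < 1 + u²)%R) by (assert (H := Rle_0_sqr u); lra).
assert (S : (sqrt (1 + u²) * sqrt (1 + u²) = 1 + u²)%R) by (apply sqrt_sqrt; lra).
assert (Sp : (0 < sqrt (1 + u²))%R) by now apply sqrt_lt_R0.
assert (U : (1 + u² = 2 * r / (r + x))%R).
{ unfold u, Rsqr. replace (1 + y / (r + x) * (y / (r + x)))%R with (((r + x) * (r + x) + y * y) / ((r + x) * (r + x)))%R by (field; lra).
  replace ((r + x) * (r + x) + y * y)%R with (2 * r * (r + x))%R by lra. field; lra. }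
rewrite (surjective_pairing z). f_equal.
- replace (r * (1 / sqrt (1 + u²) * (1 / sqrt (1 + u²)) - u / sqrt (1 + u²) * (u / sqrt (1 + u²))))%R
    with (r * (1 - u * u) / (sqrt (1 + u²) * sqrt (1 + u²)))%R by (field; lra).
  rewrite S, U. replace (1 - u * u)%R with (2 * x / (r + x))%R.
  + change (fst z) with x. field. lra.
  + unfold u. replace (1 - y / (r + x) * (y / (r + x)))%R with (((r + x) * (r + x) - y * y) / ((r + x) * (r + x)))%R by (field; lra).
    replace ((r + x) * (r + x) - y * y)%R with (2 * x * (r + x))%R by lra. field; lra.
- replace (r * (2 * (u / sqrt (1 + u²)) * (1 / sqrt (1 + u²))))%R
    with (2 * r * u / (sqrt (1 + u²) * sqrt (1 + u²)))%R by (field; lra).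
  rewrite S, U. unfold u. change (snd z) with y. field. lra.
Qed.

Lemma arg_bound z : (Rabs (Im (Clog z)) < PI)%R.
Proof. simpl. assert (H := atan_bound (Im z / (Cmod z + Re z))). apply Rabs_def1; lra. Qed.

Lemma Clog_Cexp w : (Rabs (Im w) < PI)%R -> slit (Cexp w) /\ Clog (Cexp w) = w.
Proof.
intros H.
assert (S : slit (Cexp w)).
{ unfold slit, Cexp; simpl. assert (Pe := exp_pos (Re w)). apply Rabs_def2 in H.
  destruct (Req_dec (Im w) 0) as [->|N].
  - right. rewrite cos_0. lra.
  - left. apply Rmult_integral_contrapositive. split; [lra|].
    destruct (Rlt_dec 0 (Im w)) as [P|P].
    + assert (0 < sin (Im w))%R by (apply sin_gt_0; lra). lra.
    + assert (0 < sin (- Im w))%R by (apply sin_gt_0; lra). rewrite sin_neg in H0. lra. }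
split; [assumption|]. apply Cexp_inj; [now apply Cexp_Clog|].
assert (B := arg_bound (Cexp w)). apply Rabs_def2 in B. apply Rabs_def2 in H. apply Rabs_def1; lra.
Qed.

(** The source of the logarithm identities below: exhibit some logarithm with imaginary part in
    (-pi, pi). *)
Lemma Clog_unique z w : Cexp w = z -> (Rabs (Im w) < PI)%R -> slit z /\ Clog z = w.
Proof. intros <-. apply Clog_Cexp. Qed.

Lemma Clog_mult x y : slit x -> slit y -> (Rabs (Im (Clog x) + Im (Clog y)) < PI)%R ->
  slit (x * y) /\ Clog (x * y) = Clog x + Clog y.
Proof.
intros Hx Hy H. apply Clog_unique; [|exact H]. now rewrite Cexp_plus, !Cexp_Clog.
Qed.

Lemma Clog_inv x : slit x -> slit (/ x) /\ Clog (/ x) = - Clog x.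
Proof.
intros Hx. apply Clog_unique.
- assert (E1 := Cexp_opp (Clog x)). rewrite (Cexp_Clog x Hx) in E1.
  rewrite <- (Cmult_1_l (/ x)), <- E1. field. now apply slit_neq0.
- change (Im (- Clog x)) with (- Im (Clog x))%R. rewrite Rabs_Ropp. apply arg_bound.
Qed.

Lemma Clog_div x y : slit x -> slit y -> (Rabs (Im (Clog x) - Im (Clog y)) < PI)%R ->
  slit (x / y) /\ Clog (x / y) = Clog x - Clog y.
Proof.
intros Hx Hy H. destruct (Clog_inv y Hy) as [H1 H2]. unfold Cdiv, Cminus. rewrite <- H2.
apply Clog_mult; auto. rewrite H2. exact H.
Qed.

Lemma cpow_mult x y a : slit x -> slit y -> (Rabs (Im (Clog x) + Im (Clog y)) < PI)%R ->
  cpow (x * y) a = cpow x a * cpow y a.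
Proof.
intros Hx Hy H. unfold cpow. rewrite (proj2 (Clog_mult x y Hx Hy H)), Cmult_plus_distr_l. apply Cexp_plus.
Qed.

Lemma cpow_inv x a : slit x -> cpow (/ x) a = cpow x (- a).
Proof. intros Hx. unfold cpow. rewrite (proj2 (Clog_inv x Hx)). f_equal. ring. Qed.

Lemma cpow_div x y a : slit x -> slit y -> (Rabs (Im (Clog x) - Im (Clog y)) < PI)%R ->
  cpow (x / y) a = cpow x a * cpow y (- a).
Proof.
intros Hx Hy H. unfold cpow. rewrite (proj2 (Clog_div x y Hx Hy H)), <- Cexp_plus. f_equal. ring.
Qed.

Lemma cpow_plus x a b : cpow x (a + b) = cpow x a * cpow x b.
Proof. unfold cpow. rewrite <- Cexp_plus. f_equal. ring. Qed.

Lemma cpow_opp x a : cpow x (- a) * cpow x a = 1.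
Proof. rewrite <- cpow_plus. replace (- a + a) with (RtoC 0) by ring. unfold cpow. rewrite Cmult_0_l. apply Cexp_0. Qed.

Lemma cpow_opp' x a : cpow x a * cpow x (- a) = 1.
Proof. rewrite Cmult_comm. apply cpow_opp. Qed.

Lemma Re_pos_slit z : (0 < Re z)%R -> slit z.
Proof. intros; now right. Qed.

Lemma arg_Re_pos z : (0 < Re z)%R -> (Rabs (Im (Clog z)) < PI / 2)%R.
Proof.
intros H. simpl. assert (Hd := slit_denom_pos z (Re_pos_slit z H)).
assert (B := Im_le_Cmod z).
assert (U : (-1 < Im z / (Cmod z + Re z) < 1)%R).
{ assert (Q := Rle_abs (Im z)). assert (Q2 := Rle_abs (- Im z)). rewrite Rabs_Ropp in Q2.
  split; [apply (Rmult_lt_reg_r (Cmod z + Re z))|apply (Rmult_lt_reg_r (Cmod z + Re z))]; try assumption;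
    unfold Rdiv; rewrite Rmult_assoc, Rinv_l; lra. }
destruct U as [U1 U2]. apply atan_increasing in U1. apply atan_increasing in U2.
replace (-1)%R with (- (1))%R in U1 by ring. rewrite atan_opp, atan_1 in U1. rewrite atan_1 in U2. apply Rabs_def1; lra.
Qed.

Lemma arg_Im_pos z : (0 < Im z)%R -> (0 < Im (Clog z))%R.
Proof.
intros H. simpl. assert (Hd := slit_denom_pos z (or_introl (Rgt_not_eq _ _ H))).
assert (U : (0 < Im z / (Cmod z + Re z))%R) by now apply Rdiv_lt_0_compat.
apply atan_increasing in U. rewrite atan_0 in U. lra.
Qed.

Lemma arg_Im_neg z : (Im z < 0)%R -> (Im (Clog z) < 0)%R.
Proof.
intros H. simpl. assert (Hd := slit_denom_pos z (or_introl (Rlt_not_eq _ _ H))).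
assert (U : (Im z / (Cmod z + Re z) < 0)%R).
{ assert (0 < / (Cmod z + Re z))%R by now apply Rinv_0_lt_compat. unfold Rdiv. nra. }
apply atan_increasing in U. rewrite atan_0 in U. lra.
Qed.

Lemma slit_near z : slit z -> nearC z slit.
Proof.
intros [H|H].
- destruct (Rlt_dec 0 (Im z)) as [P|P].
  + near_by (nearC_gt Im z 0 (rcont_Im z) P). intros w Hw. left. lra.
  + near_by (nearC_lt Im z 0 (rcont_Im z) ltac:(lra)). intros w Hw. left. lra.
- near_by (nearC_gt Re z 0 (rcont_Re z) H). intros w Hw. now right.
Qed.

Lemma ccont_Clog z : slit z -> ccontC Clog z.
Proof.
intros Hs. assert (Hr : (0 < Cmod z)%R) by (apply Cmod_gt_0, slit_neq0; assumption).
assert (Hd := slit_denom_pos z Hs). split.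
- apply (rcont_comp (T := C_UniformSpace) ln Cmod); [apply rcont_Cmod|].
  apply derivable_continuous_pt. exists (/ Cmod z)%R. now apply derivable_pt_lim_ln.
- apply (rcont_mult (T := C_UniformSpace) (fun _ => 2%R) (fun w => atan (Im w / (Cmod w + Re w)))); [apply rcont_const|].
  apply (rcont_comp (T := C_UniformSpace) atan (fun w => Im w / (Cmod w + Re w))%R).
  + apply rcont_mult; [apply rcont_Im|]. apply rcont_inv; [|lra]. apply rcont_plus; [apply rcont_Cmod|apply rcont_Re].
  + apply derivable_continuous_pt, derivable_pt_atan.
Qed.

(** The slope of the inverse function is the reciprocal of the slope of [Cexp], taken along
    [Clog]. *)
Lemma hol_Clog z : slit z -> hol Clog z.
Proof.
intros Hs. destruct (Cexp_slope (Clog z)) as [q [H1 [H2 H3]]].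
assert (Hc := ccont_Clog z Hs).
assert (Q : ccontC (fun w => q (Clog w)) z) by now apply (ccont_comp q Clog).
assert (Qn : q (Clog z) <> 0) by (rewrite H2; apply Cexp_neq0).
apply hol_ext_loc with (fun w => Clog z + / (if Ceq_dec (q (Clog w)) 0 then 1 else q (Clog w)) * (w - z)).
- near_by (filter_and _ _ (slit_near z Hs) (ccont_neq0 _ z Q Qn)). intros w [Hw Hq].
  destruct (Ceq_dec (q (Clog w)) 0) as [Z|Z]; [easy|].
  assert (E1 := H3 (Clog w)). rewrite !Cexp_Clog in E1 by assumption.
  assert (E2 : w - z = q (Clog w) * (Clog w - Clog z)) by (rewrite E1 at 1; ring).
  rewrite E2. field. assumption.
- exists (fun w => / (if Ceq_dec (q (Clog w)) 0 then 1 else q (Clog w))). split.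
  + apply ccont_ext_loc with (fun w => / q (Clog w)).
    * near_by (ccont_neq0 _ z Q Qn). intros w Hq. now destruct (Ceq_dec (q (Clog w)) 0).
    * now apply ccont_inv.
  + intros w. ring.
Qed.

Lemma hol_cpow a z : slit z -> hol (fun w => cpow w a) z.
Proof.
intros Hs. apply (hol_comp Cexp (fun w => a * Clog w)); [apply hol_Cexp|].
apply hol_mult; [apply hol_const|now apply hol_Clog].
Qed.

(** The logarithm of -1 as seen from the half plane of [z]: the sum of the logarithms of z and
    -1/z. *)
Definition half_turn (z : CC) : CC := if Rlt_dec 0 (Im z) then RtoC PI * Ci else - (RtoC PI * Ci).

Lemma Cexp_half_turn z : Cexp (half_turn z) = - (1).
Proof.
unfold half_turn. destruct (Rlt_dec 0 (Im z)); unfold Cexp; simpl.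
- replace (PI * 0 - 0 * 1)%R with 0%R by ring. replace (PI * 1 + 0 * 0)%R with PI by ring.
  rewrite exp_0, cos_PI, sin_PI. unfold Copp, RtoC; simpl. f_equal; ring.
- replace (- (PI * 0 - 0 * 1))%R with 0%R by ring. replace (- (PI * 1 + 0 * 0))%R with (- PI)%R by ring.
  rewrite exp_0, cos_neg, sin_neg, cos_PI, sin_PI. unfold Copp, RtoC; simpl. f_equal; ring.
Qed.

Lemma off_T_slit z : off_T z -> slit z.
Proof. now left. Qed.

Lemma Im_inv (z : CC) : z <> 0 -> Im (/ z) = (- Im z / (Cmod z * Cmod z))%R.
Proof. intros Hz. rewrite Cmod_sqr. simpl. unfold Re, Im, Rdiv. do 2 f_equal; simpl; ring. Qed.

Lemma off_T_neq0 z : off_T z -> z <> 0.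
Proof. intros H. apply slit_neq0, off_T_slit, H. Qed.

Lemma Im_opp_inv_pos z : off_T z -> (0 < Im (- / z) <-> 0 < Im z)%R.
Proof.
intros H. assert (H0 := off_T_neq0 z H). assert (P : (0 < Cmod z)%R) by now apply Cmod_gt_0.
rewrite im_opp, Im_inv by assumption.
assert (P2 : (0 < / (Cmod z * Cmod z))%R) by (apply Rinv_0_lt_compat; nra).
unfold Rdiv. split; intros; nra.
Qed.

Lemma off_T_opp_inv z : off_T z -> off_T (- / z).
Proof.
intros H. assert (H0 := off_T_neq0 z H). assert (P : (0 < Cmod z)%R) by now apply Cmod_gt_0.
unfold off_T in *. rewrite im_opp, Im_inv by assumption.
assert (P2 : (0 < / (Cmod z * Cmod z))%R) by (apply Rinv_0_lt_compat; nra).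
unfold Rdiv. nra.
Qed.

Lemma Clog_opp_inv z : off_T z -> Clog (- / z) = half_turn z - Clog z.
Proof.
intros H. apply Clog_unique.
- unfold Cminus. rewrite Cexp_plus, Cexp_half_turn.
  assert (E1 := Cexp_opp (Clog z)). rewrite (Cexp_Clog z (off_T_slit z H)) in E1.
  assert (E2 : Cexp (- Clog z) = / z).
  { rewrite <- (Cmult_1_l (/ z)), <- E1. field. now apply off_T_neq0. }
  rewrite E2. ring.
- assert (B := arg_bound z). apply Rabs_def2 in B. unfold half_turn, off_T in *.
  destruct (Rlt_dec 0 (Im z)) as [P|P].
  + assert (A := arg_Im_pos z P).
    replace (Im (RtoC PI * Ci - Clog z)) with (PI - Im (Clog z))%R by (unfold Cminus; rewrite im_plus, im_opp; simpl; ring).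
    apply Rabs_def1; lra.
  + assert (A := arg_Im_neg z ltac:(lra)).
    replace (Im (- (RtoC PI * Ci) - Clog z)) with (- PI - Im (Clog z))%R by (unfold Cminus; rewrite im_plus, im_opp; simpl; ring).
    apply Rabs_def1; lra.
Qed.

Lemma half_turn_opp_inv z : off_T z -> half_turn (- / z) = half_turn z.
Proof.
intros H. unfold half_turn. assert (Q := Im_opp_inv_pos z H).
destruct (Rlt_dec 0 (Im (- / z))), (Rlt_dec 0 (Im z)); tauto.
Qed.

Lemma cpow_opp_inv z a : off_T z -> cpow z a * cpow (- / z) a = Cexp (a * half_turn z).
Proof. intros H. unfold cpow. rewrite Clog_opp_inv, <- Cexp_plus by assumption. f_equal. ring. Qed.

Lemma off_T_plus1 z : off_T z -> off_T (z + 1).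
Proof. unfold off_T. now rewrite Im_plus_1. Qed.

Lemma arg_diff_same_side z w : off_T z -> (0 < Im z <-> 0 < Im w)%R -> off_T w ->
  (Rabs (Im (Clog z) - Im (Clog w)) < PI)%R.
Proof.
intros Hz H Hw. assert (B1 := arg_bound z). assert (B2 := arg_bound w). apply Rabs_def2 in B1. apply Rabs_def2 in B2.
unfold off_T in *. destruct (Rlt_dec 0 (Im z)) as [P|P].
- assert (A1 := arg_Im_pos z P). assert (A2 := arg_Im_pos w (proj1 H P)). apply Rabs_def1; lra.
- assert (A1 := arg_Im_neg z ltac:(lra)).
  assert (Im w < 0)%R by (destruct (Rlt_dec 0 (Im w)) as [X|X]; [tauto|lra]).
  assert (A2 := arg_Im_neg w ltac:(lra)). apply Rabs_def1; lra.
Qed.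

(** The cocycle identity behind the three-term equation; no branch jump occurs, as z and z + 1 lie
    in the same half plane. *)
Lemma cpow_div_plus1 z a : off_T z -> cpow (z + 1) a * cpow (z / (z + 1)) a = cpow z a.
Proof.
intros H. assert (H1 := off_T_plus1 z H).
rewrite cpow_div; auto using off_T_slit.
- replace (cpow (z + 1) a * (cpow z a * cpow (z + 1) (- a))) with (cpow z a * (cpow (z + 1) a * cpow (z + 1) (- a))) by ring.
  rewrite cpow_opp'. ring.
- apply arg_diff_same_side; auto. now rewrite Im_plus_1.
Qed.

Lemma cpow_sqr z a : (0 < Re z)%R -> cpow (z * z) a = cpow z (a + a).
Proof.
intros H. assert (B := arg_Re_pos z H). apply Rabs_def2 in B.
rewrite cpow_mult, cpow_plus; auto using Re_pos_slit. apply Rabs_def1; lra.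
Qed.

(** * Hyperfunctions on the projective line and the action of the modular group *)

Lemma holo_on_hol U f z : holo_on U f -> U z -> hol f z.
Proof. intros [_ H] Hz. now apply hol_ex_derive, H. Qed.

Lemma holo_on_intro U f : (forall z, U z -> nearC z U) -> (forall z, U z -> hol f z) -> holo_on U f.
Proof. intros H1 H2. split; [exact H1|]. intros z Hz. now apply hol_ex_derive, H2. Qed.

Lemma near_Cmod_lt (z : CC) (r : R) : (Cmod z < r)%R -> nearC z (fun w => (Cmod w < r)%R).
Proof. intros H. exact (nearC_lt Cmod z r (rcont_Cmod z) H). Qed.

Lemma near_Cmod_gt (z : CC) (r : R) : (r < Cmod z)%R -> nearC z (fun w => (r < Cmod w)%R).
Proof. intros H. exact (nearC_gt Cmod z r (rcont_Cmod z) H). Qed.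

Lemma Cmod_inv_gt (u : CC) M : u <> 0 -> (Cmod u < / (Rabs M + 1))%R -> (M < Cmod (/ u))%R.
Proof.
intros Hu H. rewrite Cmod_inv by assumption. assert (P : (0 < Cmod u)%R) by now apply Cmod_gt_0.
assert (Q := Rle_abs M). assert (Q2 := Rabs_pos M).
apply Rle_lt_trans with (Rabs M); [assumption|]. apply Rlt_trans with (Rabs M + 1)%R; [lra|].
rewrite <- (Rinv_inv (Rabs M + 1)). apply Rinv_lt_contravar; [|assumption].
apply Rmult_lt_0_compat; [assumption|]. apply Rinv_0_lt_compat; lra.
Qed.

Lemma Cmod_inv_lt (z : CC) r : (0 < r)%R -> (/ r < Cmod z)%R -> (Cmod (/ z) < r)%R.
Proof.
intros Hr H. assert (P : (0 < / r)%R) by now apply Rinv_0_lt_compat.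
rewrite Cmod_inv by (apply Cmod_gt_0; lra). rewrite <- (Rinv_inv r). apply Rinv_lt_contravar; [|assumption].
apply Rmult_lt_0_compat; lra.
Qed.

Lemma off_T_inv z : off_T z -> off_T (/ z).
Proof.
intros H. replace (/ z) with (- (- / z)) by ring. assert (Q := off_T_opp_inv z H).
unfold off_T in *. rewrite im_opp. lra.
Qed.

(** Local vanishing is enough: the real germs glue to one function [G], and the germ in the
    coordinate 1/z supplies a whole neighbourhood of infinity on which [G] is holomorphic. *)
Lemma hyp_eq_local f1 f2 : hyp_eq f1 f2 <->
  (forall x : R, ext (fun z => f1 z - f2 z) (RtoC x)) /\ ext (fun u => f1 (/ u) - f2 (/ u)) 0.
Proof.
split.
- intros [V [g [[V1 [V2 [M V3]]] [[Hg [c [r [Hr Hc]]]] He]]]]. split.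
  + intros x. exists g. near_by (V1 _ (V2 x)). intros z Hz. split; [now apply (holo_on_hol V)|auto].
  + exists (chart_oo c g).
    assert (N1 := near_Cmod_lt (RtoC 0) r ltac:(now rewrite Cmod_0)).
    assert (N2 := near_Cmod_lt (RtoC 0) (/ (Rabs M + 1)) ltac:(rewrite Cmod_0; apply Rinv_0_lt_compat; assert (Q := Rabs_pos M); lra)).
    near_by (filter_and _ _ N1 N2). intros u [U1 U2]. split.
    * exact (holo_on_hol _ _ u Hc U1).
    * intros Ho. assert (Hu := off_T_neq0 u Ho). unfold chart_oo.
      destruct (excluded_middle_informative (@eq CC u 0)) as [Z|_]; [easy|].
      apply He; [|now apply off_T_inv]. apply V3. now apply Cmod_inv_gt.
- intros [H1 [k Hk]]. destruct (ext_glue _ H1) as [G [G1 G2]].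
  apply nearC_spec in Hk. destruct Hk as [r [Hr Hk]].
  assert (Hk' : forall u, (Cmod u < r)%R -> hol k u /\ (off_T u -> f1 (/ u) - f2 (/ u) = k u)).
  { intros u Hu. apply Hk. now replace (u - RtoC 0) with u by ring. }
  (* At real points [G] is already holomorphic; at nonreal ones near infinity it coincides with
     k(1/z). *)
  assert (GV : forall z, (/ r < Cmod z)%R -> nearC z (fun w => hol G w)).
  { intros z Hz. destruct (Req_dec (Im z) 0) as [E0|E0].
    - replace z with (RtoC (Re z)) by (destruct z; simpl in *; unfold RtoC; f_equal; auto). apply G1.
    - assert (Hz0 : z <> 0) by now apply off_T_neq0.
      assert (N : nearC z (fun w => off_T w /\ (/ r < Cmod w)%R)).
      { apply filter_and; [|now apply near_Cmod_gt].
        near_by (near_Im_gt z 0 ltac:(now apply Rabs_pos_lt)). intros w Hw.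
        unfold off_T. intros Q. rewrite Q, Rabs_R0 in Hw. lra. }
      apply locally_locally in N. near_by N. intros w Hw.
      assert (Hw0 := locally_singleton _ _ Hw). destruct Hw0 as [W1 W2].
      apply hol_ext_loc with (fun v => k (/ v)).
      + near_by Hw. intros v [A B]. rewrite G2 by assumption.
        destruct (Hk' (/ v)) as [_ K]; [now apply Cmod_inv_lt|].
        rewrite <- K by now apply off_T_inv.
        change CC in v. replace (/ / v) with v; [reflexivity|]. field. now apply off_T_neq0.
      + apply (hol_comp k Cinv).
        * apply Hk'. now apply Cmod_inv_lt.
        * apply hol_inv; [apply hol_id|now apply off_T_neq0]. }
  exists (fun z => nearC z (fun w => hol G w)), G. split; [split; [|split]|split; [split|]].
  + intros z Hz. now apply locally_locally.
  + exact G1.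
  + exists (/ r)%R. exact GV.
  + apply holo_on_intro; [intros z Hz; now apply locally_locally|]. intros z Hz. exact (locally_singleton _ _ Hz).
  + exists (k 0), r. split; [assumption|]. apply holo_on_intro.
    * intros u Hu. now apply near_Cmod_lt.
    * assert (Q : forall u, (Cmod u < r)%R -> k u = chart_oo (k 0) G u).
      { intros u Hu. unfold chart_oo. destruct (excluded_middle_informative (@eq CC u 0)) as [->|Z]; [reflexivity|].
        apply (ccont_eq_off_T k (fun u => G (/ u))).
        - apply hol_cont, Hk', Hu.
        - apply hol_cont, (hol_comp G Cinv); [|apply hol_inv; [apply hol_id|assumption]].
          apply (locally_singleton _ _ (GV (/ u) ltac:(rewrite Cmod_inv by assumption; apply Rinv_lt_contravar; [apply Rmult_lt_0_compat; [now apply Cmod_gt_0|lra]|lra]))).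
        - near_by (near_Cmod_lt u r Hu). intros v Hv Ho.
          rewrite G2 by now apply off_T_inv. symmetry. now apply Hk'. }
      intros u Hu. apply hol_ext_loc with k; [|now apply Hk'].
      near_by (near_Cmod_lt u r Hu). exact Q.
  + intros z _ Hz. now rewrite G2.
Qed.

Lemma near_hol_affine (p q : R) (z : CC) : hol (fun u => RtoC p * u + RtoC q) z.
Proof. apply hol_plus; [|apply hol_const]. holo. Qed.

Lemma affine_neq0 (r t : R) u : off_T u -> (r <> 0 \/ t <> 0)%R -> RtoC r * u + RtoC t <> 0.
Proof.
intros Hu Hrt Q. assert (Q1 := f_equal fst Q). assert (Q2 := f_equal snd Q). unfold off_T in Hu. destruct u as [x y]; simpl in *.
assert (r * y = 0)%R by lra. apply Rmult_integral in H. destruct H as [->|H]; [|contradiction]. destruct Hrt; [easy|]. lra.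
Qed.

Lemma off_T_mobius (p q r t : R) u : off_T u -> (p * t - q * r <> 0)%R ->
  off_T ((RtoC p * u + RtoC q) / (RtoC r * u + RtoC t)).
Proof.
intros Hu Hd. assert (Hn : RtoC r * u + RtoC t <> 0).
{ apply affine_neq0; [assumption|]. destruct (Req_dec r 0) as [->|]; [right; intros ->; apply Hd; ring|now left]. }
intros HI. set (m := (RtoC p * u + RtoC q) / (RtoC r * u + RtoC t)) in *.
assert (E1 : RtoC p * u + RtoC q = RtoC (Re m) * (RtoC r * u + RtoC t)).
{ replace (RtoC (Re m)) with m by (destruct m; simpl in *; unfold RtoC; f_equal; auto). unfold m. field. assumption. }
assert (Q1 := f_equal fst E1). assert (Q2 := f_equal snd E1). set (x := Re m) in *. clearbody x.
unfold off_T in Hu. destruct u as [a b]; simpl in *.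
assert (P1 : (p = x * r)%R) by (apply (Rmult_eq_reg_r b); [lra|assumption]).
subst p. apply Hd. assert (q = x * t)%R by lra. subst q. ring.
Qed.

(** * The homogeneous lift and invariance in frames *)

Section Hyperfunctions.
Variable nu : CC.
Local Notation s := ((1 + nu) / 2).

(** Homogeneous lift of degree [-1-nu]: [SL_2] acts on it by linear substitution. *)
Definition Phi (f : CC -> CC) (z w : CC) : CC := cpow (z * z + w * w) (- s) * f (z / w).

(** [Phi f] along the line [(p u + q, r u + t)], a chart of [P^1(C)] centred at the boundary point [q/t]. *)
Definition PhiF f (p q r t : R) (u : CC) : CC := Phi f (RtoC p * u + RtoC q) (RtoC r * u + RtoC t).

Lemma near_Re_sumsq (p q r t : R) : (q <> 0 \/ t <> 0)%R ->
  nearC 0 (fun u => (0 < Re ((RtoC p * u + RtoC q) * (RtoC p * u + RtoC q) + (RtoC r * u + RtoC t) * (RtoC r * u + RtoC t)))%R).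
Proof.
intros H.
apply (nearC_gt (fun u => Re ((RtoC p * u + RtoC q) * (RtoC p * u + RtoC q) + (RtoC r * u + RtoC t) * (RtoC r * u + RtoC t)))).
- apply (rcont_comp_C Re); [apply rcont_Re|]. apply hol_cont. holo.
- simpl. assert (0 < q * q + t * t)%R; [|lra]. destruct H; nra.
Qed.

Lemma near_hol_sumsq_pow a (p q r t : R) : (q <> 0 \/ t <> 0)%R ->
  nearC 0 (fun u => hol (fun u => cpow ((RtoC p * u + RtoC q) * (RtoC p * u + RtoC q) + (RtoC r * u + RtoC t) * (RtoC r * u + RtoC t)) a) u).
Proof.
intros H. near_by (near_Re_sumsq p q r t H). intros u Hu.
apply (hol_comp (fun w => cpow w a)); [now apply hol_cpow, Re_pos_slit|].
holo.
Qed.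

Lemma det_row2 (p q r t : R) : (p * t - q * r = 1)%R -> (r <> 0 \/ t <> 0)%R.
Proof. intros H. destruct (Req_dec r 0) as [->|]; [|now left]. right. intros ->. lra. Qed.

Lemma det_col2 (p q r t : R) : (p * t - q * r = 1)%R -> (q <> 0 \/ t <> 0)%R.
Proof. intros H. destruct (Req_dec q 0) as [->|]; [|now left]. right. intros ->. lra. Qed.

Lemma affine_near_neq0 (r t : R) : t <> 0%R -> nearC 0 (fun u => RtoC r * u + RtoC t <> 0).
Proof.
intros Ht. apply (ccont_neq0 (T := C_UniformSpace) (fun u => RtoC r * u + RtoC t)).
- apply hol_cont, near_hol_affine.
- intros Q. apply (f_equal fst) in Q. simpl in Q. lra.
Qed.

(** The germ at q/t, or at infinity if t = 0, is pulled back by a real Moebius map. The power is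
    holomorphic near u = 0, since the sum of squares there is close to q^2 + t^2 > 0. *)
Lemma hyp_eq_frame f1 f2 p q r t : hyp_eq f1 f2 -> (p * t - q * r = 1)%R ->
  ext (fun u => PhiF f1 p q r t u - PhiF f2 p q r t u) 0.
Proof.
intros H Hdet. apply hyp_eq_local in H. destruct H as [H1 H2].
set (D := fun z => f1 z - f2 z) in *.
apply ext_eq with (fun u => cpow ((RtoC p * u + RtoC q) * (RtoC p * u + RtoC q) + (RtoC r * u + RtoC t) * (RtoC r * u + RtoC t)) (- s)
   * D ((RtoC p * u + RtoC q) / (RtoC r * u + RtoC t))).
{ apply filter_forall. intros u _. unfold PhiF, Phi, D. ring. }
apply ext_mul; [apply near_hol_sumsq_pow, (det_col2 p q r t Hdet)|].
destruct (Req_dec t 0) as [Ht|Ht].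
- assert (Hq : q <> 0%R) by (intros ->; subst t; lra).
  apply ext_eq with (fun u => (fun v => D (/ v)) ((RtoC r * u + RtoC t) / (RtoC p * u + RtoC q))).
  + near_by (affine_near_neq0 p q Hq). intros u Hu Ho. cbv beta. f_equal.
    assert (Hw := affine_neq0 r t u Ho (det_row2 p q r t Hdet)). field. now split.
  + apply (ext_comp (fun v => D (/ v)) (fun u => (RtoC r * u + RtoC t) / (RtoC p * u + RtoC q))).
    * near_by (affine_near_neq0 p q Hq). intros u Hu. apply hol_div; auto; apply near_hol_affine.
    * apply filter_forall. intros u Hu. apply off_T_mobius; [assumption|lra].
    * replace ((RtoC r * RtoC 0 + RtoC t) / (RtoC p * RtoC 0 + RtoC q)) with (RtoC 0); [exact H2|].
      rewrite Ht. field. intros Q. apply (f_equal fst) in Q. simpl in Q. lra.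
- apply (ext_comp D (fun u => (RtoC p * u + RtoC q) / (RtoC r * u + RtoC t))).
  + near_by (affine_near_neq0 r t Ht). intros u Hu. apply hol_div; auto; apply near_hol_affine.
  + apply filter_forall. intros u Hu. apply off_T_mobius; [assumption|lra].
  + replace ((RtoC p * RtoC 0 + RtoC q) / (RtoC r * RtoC 0 + RtoC t)) with (RtoC (q / t)); [apply H1|].
    rewrite RtoC_div by assumption. field. intros Q. apply (f_equal fst) in Q. simpl in Q. lra.
Qed.

(** The line model of the principal series: [pi_nu] acts on [lm f] by plain powers of [c z + d]. *)
Definition lm (f : CC -> CC) (z : CC) : CC := cpow (z * z + 1) (- s) * f z.

Lemma Phi_eq f z w z' w' : z = z' -> w = w' -> Phi f z w = Phi f z' w'.
Proof. now intros -> ->. Qed.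

Lemma Phi_lm f z : Phi f z 1 = lm f z.
Proof. unfold Phi, lm. f_equal; [do 2 f_equal; ring|]. f_equal. field. Qed.

Lemma PhiF_lm f x u : PhiF f 1 x 0 1 u = lm f (u + RtoC x).
Proof. rewrite <- Phi_lm. apply Phi_eq; ring. Qed.

Lemma PhiF_oo f u : PhiF f 0 (-1) 1 0 u = Phi f (- (1)) u.
Proof. apply Phi_eq; apply C_eq; destruct u; simpl; ring. Qed.

Lemma ext_shift D x : ext (fun u => D (u + RtoC x)) 0 <-> ext D (RtoC x).
Proof.
split; intros H.
- apply ext_eq with (fun z => (fun u => D (u + RtoC x)) (z - RtoC x)).
  + apply filter_forall. intros z _. change CC in z. cbv beta. f_equal. ring.
  + apply (ext_comp (fun u => D (u + RtoC x)) (fun z => z - RtoC x)).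
    * apply filter_forall. intros z. holo.
    * apply filter_forall. intros z Hz. unfold off_T in *. unfold Cminus. rewrite im_plus, im_opp, im_RtoC. lra.
    * now replace (RtoC x - RtoC x) with (RtoC 0) by ring.
- apply (ext_comp D (fun u => u + RtoC x)).
  + apply filter_forall. intros z. holo.
  + apply filter_forall. intros z Hz. unfold off_T in *. rewrite im_plus, im_RtoC. lra.
  + now replace (RtoC 0 + RtoC x) with (RtoC x) by ring.
Qed.

Lemma near_Re_sqr (x c : R) : (c < x * x)%R -> nearC x (fun z => (c < Re (z * z))%R).
Proof.
intros H. apply (nearC_gt (fun z => Re (z * z))).
- apply (rcont_comp_C Re (fun z => z * z)); [apply rcont_Re|]. apply ccont_mult; apply ccont_id.
- simpl. lra.
Qed.

Lemma near_hol_sq1_pow (x : R) a : nearC x (fun z => hol (fun z => cpow (z * z + 1) a) z).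
Proof.
near_by (near_Re_sqr x (-1) ltac:(nra)). intros z Hz.
apply (hol_comp (fun w => cpow w a)).
- apply hol_cpow, Re_pos_slit. rewrite re_plus, re_RtoC. lra.
- holo.
Qed.

Lemma line_model_hyp_eq f1 f2 : (forall x : R, ext (fun z => lm f1 z - lm f2 z) x) ->
  ext (fun u => Phi f1 (- (1)) u - Phi f2 (- (1)) u) 0 -> hyp_eq f1 f2.
Proof.
intros H1 H2. apply hyp_eq_local.
assert (K : forall X a b, cpow X s * (cpow X (- s) * a - cpow X (- s) * b) = a - b).
{ intros X a b. transitivity (cpow X s * cpow X (- s) * (a - b)); [ring|]. rewrite cpow_opp'. ring. }
split.
- intros x. apply ext_eq with (fun z => cpow (z * z + 1) s * (lm f1 z - lm f2 z)).
  + apply filter_forall. intros z _. apply K.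
  + apply ext_mul; [apply near_hol_sq1_pow|apply H1].
(* [Phi f (- (1)) u] evaluates [f] at -1/u, whereas [hyp_eq_local] uses 1/z; hence u = -z. *)
- apply ext_eq with (fun z => cpow (z * z + 1) s * (fun u => Phi f1 (- (1)) u - Phi f2 (- (1)) u) (- z)).
  + apply filter_forall. intros z Hz. assert (Hn := off_T_neq0 z Hz). change CC in z. unfold Phi.
    replace (- (1) * - (1) + - z * - z) with (z * z + 1) by ring. replace (- (1) / - z) with (/ z) by (field; assumption).
    apply K.
  + apply ext_mul; [apply near_hol_sq1_pow|]. apply (ext_comp (fun u => Phi f1 (- (1)) u - Phi f2 (- (1)) u) (fun z => - z)).
    * apply filter_forall. intros z. apply hol_opp, hol_id.
    * apply filter_forall. intros z Hz. unfold off_T in *. rewrite im_opp. lra.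
    * now replace (- RtoC 0) with (RtoC 0) by ring.
Qed.

(** The frame is multiplied on the left by the inverse matrix (d, -b; -c, a). *)
Definition PhiG f (a b c d : Z) (p q r t : R) : CC -> CC :=
  PhiF f (IZR d * p - IZR b * r) (IZR d * q - IZR b * t) (- IZR c * p + IZR a * r) (- IZR c * q + IZR a * t).

(** Quantifying over all frames makes the property multiplicative: group elements act on frames, and
    no power has to be split again. *)
Definition invariant f (a b c d : Z) : Prop := forall p q r t, (p * t - q * r = 1)%R ->
  ext (fun u => PhiG f a b c d p q r t u - PhiF f p q r t u) 0.

Lemma det_frame (a b c d : Z) (p q r t : R) : (a * d - b * c = 1)%Z -> (p * t - q * r = 1)%R ->
  ((IZR d * p - IZR b * r) * (- IZR c * q + IZR a * t) - (IZR d * q - IZR b * t) * (- IZR c * p + IZR a * r) = 1)%R.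
Proof.
intros H1 H2. apply (f_equal IZR) in H1. rewrite minus_IZR, !mult_IZR in H1.
transitivity ((IZR a * IZR d - IZR b * IZR c) * (p * t - q * r))%R; [ring|]. rewrite H1, H2. ring.
Qed.

(** [jfac] is the quotient of the sums of squares before and after the substitution. Near u = 0 both
    have positive real part, so the principal power of the quotient splits and one factor
    cancels. *)
Lemma PhiF_pi f a b c d p q r t : (a * d - b * c = 1)%Z -> (p * t - q * r = 1)%R ->
  nearC 0 (fun u => off_T u -> PhiF (pi_nu nu a b c d f) p q r t u = PhiG f a b c d p q r t u).
Proof.
intros Hg Hf. assert (Hgf := det_frame a b c d p q r t Hg Hf).
assert (N1 := near_Re_sumsq p q r t (det_col2 _ _ _ _ Hf)).
assert (N2 := near_Re_sumsq (IZR d * p - IZR b * r) (IZR d * q - IZR b * t) (- IZR c * p + IZR a * r)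
  (- IZR c * q + IZR a * t) (det_col2 _ _ _ _ Hgf)).
near_by (filter_and _ _ N1 N2). intros u [U1 U2] Hu.
assert (W1 := affine_neq0 r t u Hu (det_row2 _ _ _ _ Hf)).
assert (W2 := affine_neq0 (- IZR c * p + IZR a * r) (- IZR c * q + IZR a * t) u Hu (det_row2 _ _ _ _ Hgf)).
unfold PhiG, PhiF, Phi, pi_nu.
set (z := RtoC p * u + RtoC q) in *. set (w := RtoC r * u + RtoC t) in *.
assert (Ez : RtoC (IZR d * p - IZR b * r) * u + RtoC (IZR d * q - IZR b * t) = ZC d * z - ZC b * w).
{ unfold ZC, z, w. rewrite !RtoC_minus, !RtoC_mult. ring. }
assert (Ew : RtoC (- IZR c * p + IZR a * r) * u + RtoC (- IZR c * q + IZR a * t) = - ZC c * z + ZC a * w).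
{ unfold ZC, z, w. rewrite !RtoC_plus, !RtoC_mult, RtoC_opp. ring. }
rewrite Ez, Ew in *. set (z' := ZC d * z - ZC b * w) in *. set (w' := - ZC c * z + ZC a * w) in *.
assert (J : jfac a b c d (z / w) = (z * z + w * w) / (z' * z' + w' * w')).
{ unfold jfac. assert (Y : z' * z' + w' * w' <> 0) by now apply slit_neq0, Re_pos_slit.
  replace ((ZC c * (z / w) - ZC a) * (ZC c * (z / w) - ZC a) + (ZC d * (z / w) - ZC b) * (ZC d * (z / w) - ZC b))
    with ((z' * z' + w' * w') / (w * w)) by (unfold z', w'; field; assumption).
  field. split; assumption. }
assert (M : (ZC d * (z / w) - ZC b) / (- ZC c * (z / w) + ZC a) = z' / w').
{ replace (ZC d * (z / w) - ZC b) with (z' / w) by (unfold z'; field; assumption).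
  replace (- ZC c * (z / w) + ZC a) with (w' / w) by (unfold w'; field; assumption). field. split; assumption. }
rewrite J, M.
assert (B1 := arg_Re_pos _ U1). assert (B2 := arg_Re_pos _ U2). apply Rabs_def2 in B1. apply Rabs_def2 in B2.
rewrite cpow_div; [|now apply Re_pos_slit|now apply Re_pos_slit|apply Rabs_def1; lra].
set (X := z * z + w * w). rewrite !Cmult_assoc. f_equal. rewrite cpow_opp. ring.
Qed.

Lemma hyp_eq_invariant f a b c d : (a * d - b * c = 1)%Z -> hyp_eq (pi_nu nu a b c d f) f -> invariant f a b c d.
Proof.
intros Hg H p q r t Hf.
apply ext_eq with (fun u => PhiF (pi_nu nu a b c d f) p q r t u - PhiF f p q r t u); [|now apply hyp_eq_frame].
near_by (PhiF_pi f a b c d p q r t Hg Hf). intros u Hu Ho. now rewrite Hu.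
Qed.

Lemma invariant_hyp_eq f a b c d : (a * d - b * c = 1)%Z ->
  (forall x : R, ext (fun u => PhiG f a b c d 1 x 0 1 u - PhiF f 1 x 0 1 u) 0) ->
  ext (fun u => PhiG f a b c d 0 (-1) 1 0 u - PhiF f 0 (-1) 1 0 u) 0 ->
  hyp_eq (pi_nu nu a b c d f) f.
Proof.
intros Hg H1 H2. apply line_model_hyp_eq.
- intros x. apply (proj1 (ext_shift (fun z => lm (pi_nu nu a b c d f) z - lm f z) x)).
  apply ext_eq with (2 := H1 x). near_by (PhiF_pi f a b c d 1 x 0 1 Hg ltac:(ring)).
  intros u Hu Ho. now rewrite <- Hu, !PhiF_lm.
- apply ext_eq with (2 := H2). near_by (PhiF_pi f a b c d 0 (-1) 1 0 Hg ltac:(ring)).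
  intros u Hu Ho. now rewrite <- Hu, !PhiF_oo.
Qed.

(** Telescoping: the second invariance is used at the frame moved by the inverse of the first
    element. *)
Lemma invariant_mul f a1 b1 c1 d1 a2 b2 c2 d2 : invariant f a1 b1 c1 d1 -> invariant f a2 b2 c2 d2 -> (a1 * d1 - b1 * c1 = 1)%Z ->
  invariant f (a1 * a2 + b1 * c2) (a1 * b2 + b1 * d2) (c1 * a2 + d1 * c2) (c1 * b2 + d1 * d2).
Proof.
intros H1 H2 Hd p q r t Hf.
assert (K1 := H1 p q r t Hf). assert (K2 := H2 _ _ _ _ (det_frame a1 b1 c1 d1 p q r t Hd Hf)).
assert (K := ext_plus _ _ _ K2 K1). revert K. apply ext_eq. apply filter_forall. intros u _.
unfold PhiG. rewrite !plus_IZR, !mult_IZR.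
match goal with |- PhiF f ?A ?B ?C0 ?D0 u - _ + (_ - _) = PhiF f ?A' ?B' ?C' ?D' u - _ =>
  replace A' with A by ring; replace B' with B by ring; replace C' with C0 by ring; replace D' with D0 by ring end.
ring.
Qed.

Lemma invariant_inverse f a b c d : (a * d - b * c = 1)%Z -> invariant f a b c d -> invariant f d (- b) (- c) a.
Proof.
intros Hd H p q r t Hf.
assert (Hd' : (d * a - (- b) * (- c) = 1)%Z) by lia.
assert (K := H _ _ _ _ (det_frame d (- b) (- c) a p q r t Hd' Hf)).
apply ext_mul with (k := fun _ => - (1)) in K; [|apply filter_forall; intros; apply hol_const].
revert K. apply ext_eq. apply filter_forall. intros u _. unfold PhiG. rewrite !opp_IZR.
assert (Hr : (IZR a * IZR d - IZR b * IZR c = 1)%R) by (rewrite <- !mult_IZR, <- minus_IZR, Hd; reflexivity).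
cbv beta.
match goal with |- _ * (PhiF f ?A ?B ?C0 ?D0 u - _) = _ =>
  replace A with p by (transitivity ((IZR a * IZR d - IZR b * IZR c) * p)%R; [rewrite Hr|]; ring);
  replace B with q by (transitivity ((IZR a * IZR d - IZR b * IZR c) * q)%R; [rewrite Hr|]; ring);
  replace C0 with r by (transitivity ((IZR a * IZR d - IZR b * IZR c) * r)%R; [rewrite Hr|]; ring);
  replace D0 with t by (transitivity ((IZR a * IZR d - IZR b * IZR c) * t)%R; [rewrite Hr|]; ring) end.
ring.
Qed.
End Hyperfunctions.

(** * Induction over the modular group from its generators *)

Section SL2Z.
Variable G : Z -> Z -> Z -> Z -> Prop.
Open Scope Z_scope.
Hypothesis Gmul : forall a1 b1 c1 d1 a2 b2 c2 d2, G a1 b1 c1 d1 -> G a2 b2 c2 d2 -> a1 * d1 - b1 * c1 = 1 ->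
  G (a1 * a2 + b1 * c2) (a1 * b2 + b1 * d2) (c1 * a2 + d1 * c2) (c1 * b2 + d1 * d2).
Hypothesis GS : G 0 (-1) 1 0.
Hypothesis GT : G 1 1 0 1.
Hypothesis GT' : G 1 (-1) 0 1.

Lemma G_eq a b c d a' b' c' d' : a = a' -> b = b' -> c = c' -> d = d' -> G a b c d -> G a' b' c' d'.
Proof. now intros -> -> -> ->. Qed.

Lemma G_one : G 1 0 0 1.
Proof. apply (G_eq _ _ _ _ _ _ _ _) with (5 := Gmul _ _ _ _ _ _ _ _ GT GT' ltac:(reflexivity)); reflexivity. Qed.

Lemma G_Tnat (n : nat) : G 1 (Z.of_nat n) 0 1 /\ G 1 (- Z.of_nat n) 0 1.
Proof.
induction n as [|n [IH1 IH2]]; [split; apply G_one|]. rewrite Nat2Z.inj_succ. split.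
- apply G_eq with (5 := Gmul _ _ _ _ _ _ _ _ GT IH1 ltac:(reflexivity)); lia.
- apply G_eq with (5 := Gmul _ _ _ _ _ _ _ _ GT' IH2 ltac:(reflexivity)); lia.
Qed.

Lemma G_T n : G 1 n 0 1.
Proof.
destruct (Z_le_dec 0 n) as [H|H].
- rewrite <- (Z2Nat.id n H). apply G_Tnat.
- replace n with (- Z.of_nat (Z.to_nat (- n))) by lia. apply G_Tnat.
Qed.

(** Euclid's algorithm on the first column: with a = k c + m, the matrix is T^k S times one whose
    first column is (c, -m). A further factor S brings the remainder [m] into the lower left
    entry. *)
Lemma SL2Z_ind_bound (n : nat) : forall a b c d, (Z.to_nat (Z.abs c) < n)%nat -> a * d - b * c = 1 -> G a b c d.
Proof.
induction n as [|n IH]; intros a b c d Hn Hdet; [lia|].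
destruct (Z.eq_dec c 0) as [->|Hc].
- assert (Had : a * d = 1) by lia.
  destruct (Z.mul_eq_1 a d Had) as [->| ->].
  + assert (d = 1) as -> by lia. apply G_T.
  + assert (d = -1) as -> by lia.
    (* S^2 = -1 accounts for the negative sign on the diagonal. *)
    assert (M := Gmul _ _ _ _ _ _ _ _ GS GS ltac:(reflexivity)). simpl in M.
    apply G_eq with (5 := Gmul _ _ _ _ _ _ _ _ M (G_T (- b)) ltac:(reflexivity)); lia.
- assert (Hm := Z.div_mod a c Hc). assert (Hb := Z.mod_bound_abs a c Hc).
  set (k := a / c) in *. set (m := a mod c) in *.
  assert (Q : G c d (- m) (- (b - k * d))) by (apply IH; [lia|nia]).
  assert (R1 := Gmul _ _ _ _ _ _ _ _ GS Q ltac:(lia)).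
  apply G_eq with (5 := Gmul _ _ _ _ _ _ _ _ (G_T k) R1 ltac:(lia)); lia.
Qed.

Lemma SL2Z_ind a b c d : a * d - b * c = 1 -> G a b c d.
Proof. apply (SL2Z_ind_bound (S (Z.to_nat (Z.abs c)))). lia. Qed.
End SL2Z.

(** * The period function *)

Section Period.
Variable nu : CC.
Local Notation s := ((1 + nu) / 2).
Local Notation lm := (lm nu).

Definition tpow (z : CC) : CC := cpow z (- (1 + nu)).
Local Notation j := tpow.

Lemma s_double : - s + - s = - (1 + nu).
Proof. field. Qed.

Lemma Phi_opp f z (w : CC) : w <> 0 -> Phi nu f (- z) (- w) = Phi nu f z w.
Proof.
intros H. unfold Phi. f_equal; [do 2 f_equal; ring|]. f_equal. field. assumption.
Qed.

(** Homogeneity of degree -1-nu, in the range where the principal power of the product splits; it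
    treats translation at infinity. *)
Lemma Phi_scale f l z w : (0 < Re l)%R -> (0 < Re (l * l))%R -> (0 < Re (z * z + w * w))%R -> w <> 0 ->
  Phi nu f (l * z) (l * w) = j l * Phi nu f z w.
Proof.
intros Hl Hll HX Hw. unfold Phi, tpow. rewrite <- s_double, <- cpow_sqr by assumption.
assert (Hl0 : l <> 0) by now apply slit_neq0, Re_pos_slit.
replace (l * z * (l * z) + l * w * (l * w)) with (l * l * (z * z + w * w)) by ring.
replace (l * z / (l * w)) with (z / w) by (field; auto).
assert (B1 := arg_Re_pos _ Hll). assert (B2 := arg_Re_pos _ HX). apply Rabs_def2 in B1. apply Rabs_def2 in B2.
rewrite cpow_mult; [ring|now apply Re_pos_slit|now apply Re_pos_slit|apply Rabs_def1; lra].
Qed.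

Lemma off_T_plus_R z (x : R) : off_T z -> off_T (z + RtoC x).
Proof. unfold off_T. rewrite im_plus, im_RtoC. lra. Qed.

Lemma PhiG_S_lm f (x : R) u : off_T u -> PhiG nu f 0 (-1) 1 0 1 x 0 1 u = Phi nu f (- (1)) (u + RtoC x).
Proof.
intros Hu. assert (Hz := off_T_neq0 _ (off_T_plus_R u x Hu)).
rewrite <- Phi_opp by assumption. apply Phi_eq; apply C_eq; destruct u; simpl; ring.
Qed.

Lemma PhiG_S_oo f u : PhiG nu f 0 (-1) 1 0 0 (-1) 1 0 u = lm f u.
Proof. rewrite <- Phi_lm. apply Phi_eq; apply C_eq; destruct u; simpl; ring. Qed.

Lemma PhiG_Tinv_lm f (x : R) u : PhiG nu f 1 (-1) 0 1 1 x 0 1 u = lm f (u + RtoC x + 1).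
Proof. rewrite <- Phi_lm. apply Phi_eq; apply C_eq; destruct u; simpl; ring. Qed.

Lemma PhiG_Tinv_oo f u : PhiG nu f 1 (-1) 0 1 0 (-1) 1 0 u = Phi nu f (u - 1) u.
Proof. apply Phi_eq; apply C_eq; destruct u; simpl; ring. Qed.

(** [pi_nu] substitutes the inverse matrix, so T^(-1) is what produces z + 1. *)
Lemma automorphic_T f (x : R) : automorphic nu f -> ext (fun z => lm f (z + 1) - lm f z) x.
Proof.
intros [_ H]. assert (K := hyp_eq_invariant nu f 1 (-1) 0 1 eq_refl (H 1 (-1) 0 1 eq_refl)%Z 1 x 0 1 ltac:(ring)).
apply (proj1 (ext_shift (fun z => lm f (z + 1) - lm f z) x)). revert K. apply ext_eq. apply filter_forall. intros u _.
now rewrite PhiG_Tinv_lm, PhiF_lm.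
Qed.

(** The lift is kept on the left because [Phi_j] rewrites it as a power times [lm f (- / z)] only
    where Re z and Re (z * z) are positive; in this form the statement covers every real point. *)
Lemma automorphic_S f (x : R) : automorphic nu f -> ext (fun z => Phi nu f (- (1)) z - lm f z) x.
Proof.
intros [_ H]. assert (K := hyp_eq_invariant nu f 0 (-1) 1 0 eq_refl (H 0 (-1) 1 0 eq_refl)%Z 1 x 0 1 ltac:(ring)).
apply (proj1 (ext_shift (fun z => Phi nu f (- (1)) z - lm f z) x)). revert K. apply ext_eq. apply filter_forall. intros u Hu.
now rewrite PhiG_S_lm, PhiF_lm.
Qed.

Lemma near_Re_gt (z : CC) c : (c < Re z)%R -> nearC z (fun w => (c < Re w)%R).
Proof. intros H. exact (nearC_gt Re z c (rcont_Re z) H). Qed.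
Lemma near_Re_lt (z : CC) c : (Re z < c)%R -> nearC z (fun w => (Re w < c)%R).
Proof. intros H. exact (nearC_lt Re z c (rcont_Re z) H). Qed.

Lemma is_rep_lm f (x : R) : is_rep f -> nearC x (fun z => off_T z -> hol (lm f) z).
Proof.
intros [W [[W1 [W2 _]] Hf]]. near_by (filter_and _ _ (W1 _ (W2 x)) (near_hol_sq1_pow x (- s))).
intros z [A B] Hz. holo. apply (holo_on_hol _ f z Hf). now split.
Qed.

(** Multiplier relating [P] to [psi + psi|S] in the upper and in the lower half plane. *)
Definition kappa (z : CC) : CC := 1 - Cexp (- (1 + nu) * half_turn z).
Definition kappa_up : CC := 1 - Cexp (- (1 + nu) * (RtoC PI * Ci)).
Definition kappa_low : CC := 1 - Cexp (- (1 + nu) * - (RtoC PI * Ci)).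

Lemma kappa_pos z : (0 < Im z)%R -> kappa z = kappa_up.
Proof. intros H. unfold kappa, half_turn. now destruct (Rlt_dec 0 (Im z)). Qed.
Lemma kappa_neg z : (Im z < 0)%R -> kappa z = kappa_low.
Proof. intros H. unfold kappa, half_turn. destruct (Rlt_dec 0 (Im z)); [lra|reflexivity]. Qed.

Hypothesis hnu : forall k : Z, nu <> RtoC (1 + 2 * IZR k).

Lemma kappa_up_neq0 : kappa_up <> 0.
Proof.
intros H. assert (H1 : Cexp (- (1 + nu) * (RtoC PI * Ci)) = 1).
{ unfold kappa_up in H. transitivity (1 - (1 - Cexp (- (1 + nu) * (RtoC PI * Ci)))); [ring|]. rewrite H. ring. }
apply Cexp_eq_1 in H1. destruct H1 as [H1 [k H2]].
destruct nu as [n1 n2] eqn:En. simpl in H1, H2. assert (P := PI_RGT_0).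
(* Comparing - (1 + nu) pi i with 2 k pi i gives nu = -1 - 2 k = 1 + 2 (-k - 1). *)
apply (hnu (- k - 1)). rewrite minus_IZR, opp_IZR. unfold RtoC.
assert (n2 = 0)%R by nra. assert (n1 = -1 - 2 * IZR k)%R by nra. f_equal; lra.
Qed.

Lemma kappa_up_low : (1 - kappa_up) * (1 - kappa_low) = 1.
Proof.
unfold kappa_up, kappa_low. replace (1 - (1 - Cexp (- (1 + nu) * (RtoC PI * Ci)))) with (Cexp (- (1 + nu) * (RtoC PI * Ci))) by ring.
replace (1 - (1 - Cexp (- (1 + nu) * - (RtoC PI * Ci)))) with (Cexp (- (1 + nu) * - (RtoC PI * Ci))) by ring.
rewrite <- Cexp_plus. rewrite <- Cexp_0. f_equal. ring.
Qed.

Lemma kappa_low_neq0 : kappa_low <> 0.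
Proof.
intros H. apply kappa_up_neq0. assert (K := kappa_up_low). rewrite H in K.
transitivity (1 - (1 - kappa_up) * (1 - 0)); [ring|]. rewrite K. ring.
Qed.

(** Expanding [kappa_up_low] shows that the sum of the multipliers equals their product. *)
Lemma kappa_sum_neq0 : kappa_up + kappa_low <> 0.
Proof.
assert (K := kappa_up_low). intros H. apply (Cmult_neq_0 kappa_up kappa_low kappa_up_neq0 kappa_low_neq0).
transitivity ((1 - kappa_up) * (1 - kappa_low) - 1 + (kappa_up + kappa_low)); [ring|]. rewrite K, H. ring.
Qed.

Lemma kappa_neq0 z : off_T z -> kappa z <> 0.
Proof.
intros H. unfold off_T in H. destruct (Rlt_dec 0 (Im z)).
- rewrite kappa_pos by assumption. apply kappa_up_neq0.
- rewrite kappa_neg by lra. apply kappa_low_neq0.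
Qed.

(** The last relation is the vanishing of the sum of the limits of [Scomb], which is [kappa] times
    [P]; it also pins down the additive constant of [P]. *)
Definition normalized_rep (f P : CC -> CC) : Prop :=
  (forall z, off_T z -> hol P z) /\ (forall z, off_T z -> P (z + 1) = P z) /\
  (forall x : R, ext (fun z => lm f z - P z) x) /\
  exists L1 L2, ilim 1 P L1 /\ ilim (-1) P L2 /\ kappa_up * L1 + kappa_low * L2 = 0.

Lemma normalized_rep_exists f : automorphic nu f -> exists P, normalized_rep f P.
Proof.
intros Hf. destruct (periodic_rep (lm f)) as [P [L1 [L2 [H1 [H2 [H3 [H4 H5]]]]]]].
{ intros x. apply is_rep_lm, Hf. }
{ intros x. now apply automorphic_T. }
assert (K := kappa_sum_neq0). set (c := - ((kappa_up * L1 + kappa_low * L2) / (kappa_up + kappa_low))).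
exists (fun z => 1 * P z + c). split; [|split; [|split]].
- intros z Hz. apply hol_plus; [apply hol_mult; [apply hol_const|auto]|apply hol_const].
- intros z _. now rewrite H2.
- intros x. apply ext_eq with (fun z => lm f z - P z - (fun _ => c) z).
  + apply filter_forall. intros z _. ring.
  + apply ext_minus; [apply H3|]. apply ext_hol, filter_forall. intros; apply hol_const.
- exists (1 * L1 + c), (1 * L2 + c). split; [|split].
  + now apply ilim_lin, ilim_const.
  + now apply ilim_lin, ilim_const.
  + unfold c. field. assumption.
Qed.

Lemma normalized_rep_lin lam f1 f2 P1 P2 : normalized_rep f1 P1 -> normalized_rep f2 P2 ->
  normalized_rep (fun z => lam * f1 z + f2 z) (fun z => lam * P1 z + P2 z).
Proof.
intros [A1 [B1 [C1 [L1 [M1 [D1 [E1 F1]]]]]]] [A2 [B2 [C2 [L2 [M2 [D2 [E2 F2]]]]]]].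
split; [|split; [|split]].
- intros z Hz. holo.
- intros z Hz. now rewrite B1, B2.
- intros x. apply ext_eq with (fun z => (fun _ => lam) z * (lm f1 z - P1 z) + (lm f2 z - P2 z)).
  + apply filter_forall. intros z _. unfold lm. ring.
  + apply ext_plus; [|apply C2]. apply ext_mul; [|apply C1]. apply filter_forall. intros; holo.
- exists (lam * L1 + L2), (lam * M1 + M2). split; [|split].
  + now apply ilim_lin.
  + now apply ilim_lin.
  + transitivity (lam * (kappa_up * L1 + kappa_low * M1) + (kappa_up * L2 + kappa_low * M2)); [ring|]. rewrite F1, F2. ring.
Qed.

Lemma near_off_T z : off_T z -> nearC z off_T.
Proof.
intros H. near_by (near_Im_gt z 0 ltac:(now apply Rabs_pos_lt)). intros w Hw Q.
rewrite Q, Rabs_R0 in Hw. lra.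
Qed.

Lemma C_real z : ~ off_T z -> z = RtoC (Re z).
Proof.
intros H. unfold off_T in H. destruct (Req_dec (Im z) 0) as [Q|Q]; [|contradiction].
destruct z; simpl in *. unfold RtoC. now f_equal.
Qed.

Lemma off_T_dec z : off_T z \/ ~ off_T z.
Proof. unfold off_T. destruct (Req_dec (Im z) 0); [right|left]; auto. Qed.

(** The difference is entire and periodic with limits at both ends, hence a constant [c], and
    the normalisation gives [(kappa_up + kappa_low) c = 0]; this is where odd [nu] is excluded. *)
Lemma normalized_rep_unique f1 f2 P1 P2 : normalized_rep f1 P1 -> normalized_rep f2 P2 -> (forall x : R, ext (fun z => lm f1 z - lm f2 z) x) ->
  forall z, off_T z -> P1 z = P2 z.
Proof.
intros [A1 [B1 [C1 [L1 [M1 [D1 [E1 F1]]]]]]] [A2 [B2 [C2 [L2 [M2 [D2 [E2 F2]]]]]]] He.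
destruct (ext_glue (fun z => P1 z - P2 z)) as [G [G1 G2]].
{ intros x. apply ext_eq with (fun z => (lm f1 z - lm f2 z) - (lm f1 z - P1 z) + (lm f2 z - P2 z)).
  - apply filter_forall. intros z _. ring.
  - apply ext_plus; [|apply C2]. apply ext_minus; [apply He|apply C1]. }
assert (HG : forall z, hol G z).
{ intros z. destruct (off_T_dec z) as [Hz|Hz].
  - apply hol_ext_loc with (fun z => P1 z - P2 z); [|apply hol_minus; auto].
    near_by (near_off_T z Hz). intros w Hw. now rewrite G2.
  - rewrite (C_real z Hz). apply (locally_singleton _ _ (G1 (Re z))). }
assert (Hm : forall z, hol (fun z => z + 1) z) by (intros; apply hol_plus; [apply hol_id|apply hol_const]).
assert (HP : forall z, G (z + 1) = G z).
{ intros z. apply (ccont_eq_off_T (fun z => G (z + 1)) G).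
  - apply hol_cont, (hol_comp G (fun z => z + 1)); auto.
  - apply hol_cont, HG.
  - apply filter_forall. intros w Hw. rewrite !G2, B1, B2 by (auto using off_T_plus1). reflexivity. }
assert (T : forall e L L', ilim e P1 L -> ilim e P2 L' -> (e <> 0)%R -> ilim e G (-(1) * L' + L)).
{ intros e L L' T1 T2 He0. apply ilim_ext with (2 := ilim_lin e (-(1)) _ _ _ _ T2 T1) (c := 0%R). intros z Hz.
  rewrite G2 by (unfold off_T; nra). ring. }
assert (Bt := T _ _ _ E1 E2 ltac:(lra)).
assert (Cst := periodic_entire_top G _ _ HG HP (T _ _ _ D1 D2 ltac:(lra)) Bt).
set (c := -(1) * L2 + L1) in *. set (c' := -(1) * M2 + M1) in *.
assert (Ec : c = c').
{ apply Ceq_minus. apply (Cmod_le_all_0 _ 1). intros e Hpe. destruct (Bt e Hpe) as [M K].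
  specialize (K (0%R, (- M - 1)%R) ltac:(simpl; lra)). rewrite Cst in K. lra. }
assert (K : (kappa_up + kappa_low) * c = 0).
{ transitivity ((kappa_up * L1 + kappa_low * M1) - (kappa_up * L2 + kappa_low * M2) + kappa_low * (c - c')); [unfold c, c'; ring|].
  rewrite F1, F2, Ec. ring. }
assert (c = 0).
{ destruct (Ceq_dec c 0) as [Q|Q]; [exact Q|]. exfalso. now apply (Cmult_neq_0 _ _ kappa_sum_neq0 Q). }
intros z Hz. apply Ceq_minus. rewrite <- G2 by assumption. now rewrite Cst.
Qed.

Lemma hyp_eq_lm f1 f2 (x : R) : hyp_eq f1 f2 -> ext (fun z => lm f1 z - lm f2 z) x.
Proof.
intros H. apply (proj1 (ext_shift (fun z => lm f1 z - lm f2 z) x)).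
assert (K := hyp_eq_frame nu f1 f2 1 x 0 1 H ltac:(ring)). revert K. apply ext_eq, filter_forall.
intros u _. now rewrite !PhiF_lm.
Qed.

(** Factor z^2 + 1 as z^2 times 1/z^2 + 1; under these positivity conditions every argument involved
    is below pi/2. *)
Lemma Phi_j f z : (0 < Re z)%R -> (0 < Re (z * z))%R -> Phi nu f (- (1)) z = j z * lm f (- / z).
Proof.
intros H1 H2. assert (Hz : z <> 0) by now apply slit_neq0, Re_pos_slit.
assert (Hs : slit (z * z + 1)) by (apply Re_pos_slit; rewrite re_plus, re_RtoC; lra).
unfold Phi, tpow, lm. rewrite <- s_double, <- cpow_sqr by assumption.
replace (- (1) / z) with (- / z) by (field; assumption). rewrite Cmult_assoc. f_equal.
replace (- (1) * - (1) + z * z) with (z * z + 1) by ring.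
replace (- / z * - / z + 1) with ((z * z + 1) / (z * z)) by (field; assumption).
assert (B1 := arg_Re_pos _ H2). assert (B2 := arg_Re_pos (z * z + 1) ltac:(rewrite re_plus, re_RtoC; lra)).
apply Rabs_def2 in B1. apply Rabs_def2 in B2.
rewrite cpow_div; [|assumption|now apply Re_pos_slit|apply Rabs_def1; lra].
replace (- - s) with s by ring.
replace (cpow (z * z) (- s) * (cpow (z * z + 1) (- s) * cpow (z * z) s)) with
  (cpow (z * z + 1) (- s) * (cpow (z * z) (- s) * cpow (z * z) s)) by ring.
rewrite cpow_opp. ring.
Qed.

Lemma hol_opp_inv (z : CC) : z <> 0 -> hol (fun z => - / z) z.
Proof. intros H. apply hol_opp, hol_inv; [apply hol_id|assumption]. Qed.

Lemma near_neq0 (z : CC) : z <> 0 -> nearC z (fun w => w <> RtoC 0).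
Proof. intros H. apply (ccont_neq0 (T := C_UniformSpace) (fun w => w)); [apply ccont_id|assumption]. Qed.

Lemma RtoC_neq0 (x : R) : x <> 0%R -> RtoC x <> 0.
Proof. intros H Q. apply H. now apply RtoC_inj. Qed.

Lemma RtoC_opp_inv (x : R) : x <> 0%R -> - / RtoC x = RtoC (- / x).
Proof. intros H. now rewrite RtoC_opp, RtoC_inv. Qed.

Lemma ext_opp_inv D (x : R) : x <> 0%R -> ext D (RtoC (- / x)) -> ext (fun z => D (- / z)) x.
Proof.
intros Hx H. assert (Hx' := RtoC_neq0 x Hx).
apply (ext_comp D (fun z => - / z)).
- near_by (near_neq0 _ Hx'). intros w Hw. now apply hol_opp_inv.
- apply filter_forall. intros w Hw. now apply off_T_opp_inv.
- now rewrite RtoC_opp_inv.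
Qed.

Lemma hol_j z : slit z -> hol j z.
Proof. apply hol_cpow. Qed.

Lemma near_slit_pos (x : R) : (0 < x)%R -> nearC x slit.
Proof. intros H. apply slit_near, Re_pos_slit. exact H. Qed.

(** The function is a combination of three vanishing germs: S-invariance at x, [lm f - P] at x, and
    [lm f - P] at -1/x. Positivity of x keeps the power off its cut. *)
Lemma period_ext f P (x : R) : automorphic nu f -> normalized_rep f P -> (0 < x)%R ->
  ext (fun z => P z - j z * P (- / z)) x.
Proof.
intros Hf [_ [_ [HP _]]] Hx.
apply ext_eq with (fun z => - (1) * (Phi nu f (- (1)) z - lm f z) - (lm f z - P z) + j z * (lm f (- / z) - P (- / z))).
- near_by (filter_and _ _ (near_Re_gt (RtoC x) 0 Hx) (near_Re_sqr x 0 ltac:(nra))).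
  intros z [Z1 Z2] _. rewrite Phi_j by assumption. ring.
- assert (Hc : forall c z, hol (fun _ => c) z) by (intros; apply hol_const).
  apply ext_plus; [apply ext_minus|].
  + apply (ext_mul (fun _ => - (1))); [apply filter_forall; auto|now apply automorphic_S].
  + apply HP.
  + apply ext_mul.
    * near_by (near_slit_pos x Hx). apply hol_j.
    * apply (ext_opp_inv (fun z => lm f z - P z)); [lra|apply HP].
Qed.

Definition periodfun (P psi : CC -> CC) : Prop := forall z, off_T z -> psi z = P z - j z * P (- / z).

Lemma opp_inv_invol (z : CC) : z <> 0 -> - / - / z = z.
Proof. intros H. field. assumption. Qed.

Lemma j_opp_inv z : off_T z -> j z * j (- / z) = 1 - kappa z.
Proof. intros H. unfold tpow. rewrite cpow_opp_inv by assumption. unfold kappa. ring. Qed.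

(** The terms in P(-1/z) cancel, leaving 1 - j(z) j(-1/z) = kappa. *)
Lemma Scomb_periodfun P psi z : periodfun P psi -> off_T z -> Scomb nu psi z = kappa z * P z.
Proof.
intros H Hz. unfold Scomb. fold (j z). rewrite !H by (try apply off_T_opp_inv; assumption).
rewrite opp_inv_invol by now apply off_T_neq0.
transitivity (P z * (1 - j z * j (- / z))); [ring|]. rewrite j_opp_inv by assumption. ring.
Qed.

Lemma slit_plus1 z : slit z -> slit (z + 1).
Proof. unfold slit. rewrite Im_plus_1, re_plus, re_RtoC. lra. Qed.

Lemma slit_div_plus1 z : slit z -> slit (z / (z + 1)).
Proof.
intros H. apply Clog_div; [assumption|now apply slit_plus1|].
destruct (off_T_dec z) as [Hz|Hz].
- apply arg_diff_same_side; [assumption| |now apply off_T_plus1]. now rewrite Im_plus_1.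
- assert (Hr : (0 < Re z)%R) by (unfold slit, off_T in *; lra).
  assert (B1 := arg_Re_pos z Hr). assert (B2 := arg_Re_pos (z + 1) ltac:(rewrite re_plus, re_RtoC; lra)).
  apply Rabs_def2 in B1. apply Rabs_def2 in B2. apply Rabs_def1; lra.
Qed.

Lemma off_T_div_plus1 z : off_T z -> off_T (z / (z + 1)).
Proof.
intros H. assert (H1 := off_T_plus1 z H). assert (H2 := off_T_opp_inv _ H1).
replace (z / (z + 1)) with (- / (z + 1) + 1) by (field; now apply off_T_neq0). now apply off_T_plus1.
Qed.

(** Since z/(z+1) = 1 - 1/(z+1) and -(z+1)/z = -1 - 1/z, periodicity reduces all terms to P(z),
    P(-1/(z+1)) and P(-1/z); the middle ones cancel. *)
Lemma three_term_off_T P psi z : (forall z, off_T z -> P (z + 1) = P z) -> periodfun P psi -> off_T z ->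
  psi z = psi (z + 1) + j (z + 1) * psi (z / (z + 1)).
Proof.
intros HP H Hz. assert (H1 := off_T_plus1 z Hz). assert (H2 := off_T_opp_inv _ H1). assert (H3 := off_T_div_plus1 z Hz).
assert (N1 := off_T_neq0 _ Hz). assert (N2 := off_T_neq0 _ H1).
rewrite !H by assumption. rewrite (HP z Hz).
assert (E1 : P (z / (z + 1)) = P (- / (z + 1))).
{ rewrite <- (HP _ H2). f_equal. field. assumption. }
assert (E2 : P (- / (z / (z + 1))) = P (- / z)).
{ rewrite <- (HP _ (off_T_opp_inv _ H3)). f_equal. field. split; assumption. }
rewrite E1, E2. assert (J := cpow_div_plus1 z (- (1 + nu)) Hz). fold (j (z + 1)) (j (z / (z + 1))) (j z) in J.
rewrite <- J. ring.
Qed.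

Lemma periodfun_exists f P : automorphic nu f -> normalized_rep f P -> exists psi, in_Psi_mod nu psi /\ periodfun P psi.
Proof.
intros Hf HR. assert (HR' := HR). destruct HR' as [A [B [_ [L1 [L2 [T [Bt K]]]]]]].
destruct (ext_glue_on (fun z => P z - j z * P (- / z)) (fun x => 0 < x)%R) as [psi [G1 G2]].
{ intros x Hx. now apply near_Re_gt. }
{ intros x Hx. now apply period_ext with f. }
exists psi. split; [|exact G2].
assert (Hh : forall z, slit z -> hol psi z).
{ intros z Hz. destruct (off_T_dec z) as [Ho|Ho].
  - apply hol_ext_loc with (fun z => P z - j z * P (- / z)).
    + near_by (near_off_T z Ho). intros w Hw. now rewrite G2.
    + apply hol_minus; [auto|]. apply hol_mult; [now apply hol_j|].
      apply (hol_comp P (fun z => - / z)); [apply A; now apply off_T_opp_inv|]. now apply hol_opp_inv, off_T_neq0.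
  - rewrite (C_real z Ho). apply (locally_singleton _ _ (G1 (Re z) ltac:(unfold slit, off_T in *; lra))). }
split; [|split].
- apply holo_on_intro; [apply slit_near|exact Hh].
- intros t Ht. replace (- nu - 1) with (- (1 + nu)) by ring. fold (j (t + 1)).
  assert (N : t + 1 <> 0) by now apply slit_neq0, slit_plus1.
  assert (Hm : hol (fun z => z + 1) t) by (apply hol_plus; [apply hol_id|apply hol_const]).
  apply (ccont_eq_off_T psi (fun t => psi (t + 1) + j (t + 1) * psi (t / (t + 1)))).
  + apply hol_cont, Hh, Ht.
  + apply hol_cont. holo.
    * apply (hol_comp psi (fun z => z + 1)); [apply Hh, slit_plus1, Ht|exact Hm].
    * apply (hol_comp j (fun z => z + 1)); [apply hol_j, slit_plus1, Ht|exact Hm].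
    * apply (hol_comp psi (fun z => z / (z + 1))); [apply Hh, slit_div_plus1, Ht|].
      apply hol_div; [apply hol_id|exact Hm|assumption].
  + apply filter_forall. intros w Hw. now apply three_term_off_T with P.
- assert (HS : forall e c L, (e <> 0)%R -> ilim e P L -> (forall z, (0 < e * Im z)%R -> kappa z = c) ->
    ilim e (Scomb nu psi) (c * L)).
  { intros e c L He0 HL Hc. apply ilim_ext with (2 := ilim_scal e c _ _ HL) (c := 0%R). intros z Hz.
    rewrite (Scomb_periodfun P) by (auto; unfold off_T; nra). now rewrite Hc. }
  exists (kappa_up * L1), (kappa_low * L2). split; [|split; [|exact K]].
  + intros e He. destruct (HS 1%R kappa_up L1 ltac:(lra) T ltac:(intros; apply kappa_pos; lra) e He) as [M HM].
    exists M. intros t Ht. apply HM. lra.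
  + intros e He. destruct (HS (-1)%R kappa_low L2 ltac:(lra) Bt ltac:(intros; apply kappa_neg; lra) e He) as [M HM].
    exists M. intros t Ht. apply HM. lra.
Qed.

Lemma in_Psi_hol psi z : in_Psi_mod nu psi -> slit z -> hol psi z.
Proof. intros [H _] Hz. now apply (holo_on_hol slit). Qed.

Lemma slit_eq_off_T g1 g2 : (forall z, slit z -> hol g1 z) -> (forall z, slit z -> hol g2 z) ->
  (forall z, off_T z -> g1 z = g2 z) -> forall z, slit z -> g1 z = g2 z.
Proof.
intros H1 H2 H z Hz. apply ccont_eq_off_T; [now apply hol_cont, H1|now apply hol_cont, H2|].
now apply filter_forall.
Qed.

Lemma periodfun_inj P1 P2 psi1 psi2 : periodfun P1 psi1 -> periodfun P2 psi2 ->
  (forall z, slit z -> psi1 z = psi2 z) -> forall z, off_T z -> P1 z = P2 z.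
Proof.
intros H1 H2 H z Hz. assert (K := kappa_neq0 z Hz).
assert (E1 := Scomb_periodfun P1 psi1 z H1 Hz). assert (E2 := Scomb_periodfun P2 psi2 z H2 Hz).
assert (E3 : Scomb nu psi1 z = Scomb nu psi2 z).
{ unfold Scomb. rewrite !H; [reflexivity|now apply off_T_slit, off_T_opp_inv|now apply off_T_slit]. }
rewrite E1, E2 in E3. replace (P1 z) with (kappa z * P1 z / kappa z) by (field; assumption).
rewrite E3. field. assumption.
Qed.

(** Equal representatives control the real line only; S-invariance carries the germ at infinity to
    0. *)
Lemma normalized_rep_inj f1 f2 P1 P2 : automorphic nu f1 -> automorphic nu f2 -> normalized_rep f1 P1 -> normalized_rep f2 P2 ->
  (forall z, off_T z -> P1 z = P2 z) -> hyp_eq f1 f2.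
Proof.
intros Hf1 Hf2 [_ [_ [C1 _]]] [_ [_ [C2 _]]] HP.
assert (L : forall x : R, ext (fun z => lm f1 z - lm f2 z) x).
{ intros x. apply ext_eq with (fun z => (lm f1 z - P1 z) - (lm f2 z - P2 z)).
  - apply filter_forall. intros z Hz. rewrite HP by assumption. ring.
  - apply ext_minus; auto. }
apply line_model_hyp_eq with nu; [exact L|].
apply ext_eq with (fun z => (Phi nu f1 (- (1)) z - lm f1 z) - (Phi nu f2 (- (1)) z - lm f2 z) + (lm f1 z - lm f2 z)).
- apply filter_forall. intros u _. ring.
- apply ext_plus; [apply ext_minus; now apply automorphic_S|apply L].
Qed.
End Period.

(** * From period functions to automorphic hyperfunctions *)

Section Surjectivity.
Variable nu : CC.
Hypothesis hnu : forall k : Z, nu <> RtoC (1 + 2 * IZR k).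
Variable psi : CC -> CC.
Hypothesis Hpsi : in_Psi_mod nu psi.
Local Notation s := ((1 + nu) / 2).
Local Notation j := (tpow nu).

Definition Per (z : CC) : CC := Scomb nu psi z / kappa nu z.

Lemma kappa_near z : off_T z -> nearC z (fun w => kappa nu w = kappa nu z).
Proof.
intros H. unfold off_T in H. destruct (Rlt_dec 0 (Im z)).
- near_by (nearC_gt Im z 0 (rcont_Im z) r). intros w Hw. now rewrite !kappa_pos.
- near_by (nearC_lt Im z 0 (rcont_Im z) ltac:(lra)).
  intros w Hw. rewrite !kappa_neg; [reflexivity|lra|lra].
Qed.

Lemma psi_hol z : slit z -> hol psi z.
Proof. now apply in_Psi_hol with nu. Qed.

Lemma Scomb_hol z : off_T z -> hol (Scomb nu psi) z.
Proof.
intros H. assert (Hs := off_T_slit z H). apply hol_plus; [now apply psi_hol|]. apply hol_mult; [now apply hol_cpow|].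
apply (hol_comp psi (fun z => - / z)); [now apply psi_hol, off_T_slit, off_T_opp_inv|]. now apply hol_opp_inv, off_T_neq0.
Qed.

Lemma Per_hol z : off_T z -> hol Per z.
Proof.
intros H. apply hol_ext_loc with (fun w => Scomb nu psi w / kappa nu z).
- near_by (kappa_near z H). intros w Hw. unfold Per. now rewrite Hw.
- apply hol_div; [now apply Scomb_hol|apply hol_const|now apply kappa_neq0].
Qed.

Lemma psi_three_term z : slit z -> psi z = psi (z + 1) + j (z + 1) * psi (z / (z + 1)).
Proof.
intros H. destruct Hpsi as [_ [T _]]. unfold tpow. replace (- (1 + nu)) with (- nu - 1) by ring. now apply T.
Qed.

(** The three-term equation is used twice, at z and at -1/(z+1), and combined by the cocycle
    identity. *)
Lemma Per_period z : off_T z -> Per (z + 1) = Per z.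
Proof.
intros H. assert (H1 := off_T_plus1 z H). assert (H2 := off_T_opp_inv _ H1).
assert (N := off_T_neq0 z H). assert (N1 := off_T_neq0 _ H1).
unfold Per. replace (kappa nu (z + 1)) with (kappa nu z) by (unfold kappa, half_turn; now rewrite Im_plus_1).
f_equal. unfold Scomb. change (cpow z (- (1 + nu))) with (j z). change (cpow (z + 1) (- (1 + nu))) with (j (z + 1)).
assert (T1 := psi_three_term z (off_T_slit z H)). assert (T2 := psi_three_term _ (off_T_slit _ H2)).
replace (- / (z + 1) + 1) with (z / (z + 1)) in T2 by (field; assumption).
replace (- / (z + 1) / (z / (z + 1))) with (- / z) in T2 by (field; auto).
assert (J := cpow_div_plus1 z (- (1 + nu)) H). change (j (z + 1) * j (z / (z + 1)) = j z) in J.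
rewrite T2, T1, <- J. ring.
Qed.

Lemma Per_periodfun : periodfun nu Per psi.
Proof.
intros z H. assert (H1 := off_T_opp_inv z H). assert (N := off_T_neq0 z H). assert (K := kappa_neq0 nu hnu z H).
unfold Per. replace (kappa nu (- / z)) with (kappa nu z) by (unfold kappa; now rewrite half_turn_opp_inv).
unfold Scomb. change (cpow z (- (1 + nu))) with (j z). change (cpow (- / z) (- (1 + nu))) with (j (- / z)).
rewrite opp_inv_invol by assumption.
replace ((psi z + j z * psi (- / z)) / kappa nu z - j z * ((psi (- / z) + j (- / z) * psi z) / kappa nu z))
  with ((1 - j z * j (- / z)) * psi z / kappa nu z) by (field; assumption).
rewrite j_opp_inv by assumption. field. assumption.
Qed.

Lemma Per_limits : exists L1 L2, ilim 1 Per L1 /\ ilim (-1) Per L2 /\ kappa_up nu * L1 + kappa_low nu * L2 = 0.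
Proof.
destruct Hpsi as [_ [_ [L1 [L2 [T [B S]]]]]].
assert (K1 := kappa_up_neq0 nu hnu). assert (K2 := kappa_low_neq0 nu hnu).
assert (HS : forall e c L, ilim e (Scomb nu psi) L -> (forall z, (0 < e * Im z)%R -> kappa nu z = c) -> ilim e Per (/ c * L)).
{ intros e c L HL Hc. apply ilim_ext with (2 := ilim_scal e (/ c) _ _ HL) (c := 0%R). intros z Hz.
  unfold Per. rewrite Hc by assumption. unfold Cdiv. ring. }
exists (/ kappa_up nu * L1), (/ kappa_low nu * L2). split; [|split].
- apply HS; [|intros; apply kappa_pos; lra]. intros e He. destruct (T e He) as [M HM]. exists M. intros; apply HM; lra.
- apply HS; [|intros; apply kappa_neg; lra]. intros e He. destruct (B e He) as [M HM]. exists M. intros; apply HM; lra.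
- transitivity (L1 + L2); [field; auto|exact S].
Qed.

(** [Per] moved back from the line model to that of [pi_nu], where S has [jfac] equal to 1 and so
    acts by mere substitution of -1/z. [jump] is the failure of [rep_line] to be S-symmetric. *)
Definition rep_line (z : CC) : CC := cpow (z * z + 1) s * Per z.
Definition jump (z : CC) : CC := cpow (z * z + 1) s * psi z.

(** z^2 + 1 meets the cut only for z = i y with |y| >= 1. *)
Lemma slit_sq1 z : (Re z <> 0 \/ Rabs (Im z) < 1)%R -> slit (z * z + 1).
Proof.
intros H. unfold slit. rewrite Im_plus_1, re_plus, re_RtoC, re_mult, im_mult.
destruct (Req_dec (Im z) 0) as [E0|E0]; [right; rewrite E0; nra|].
destruct (Req_dec (Re z) 0) as [E1|E1].
- right. rewrite E1. destruct H as [H|H]; [easy|]. apply Rabs_def2 in H. nra.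
- left. replace (Re z * Im z + Im z * Re z)%R with (2 * (Re z * Im z))%R by ring.
  repeat apply Rmult_integral_contrapositive_currified; auto.
Qed.

Lemma Re_inv (z : CC) : z <> 0 -> Re (/ z) = (Re z / (Cmod z * Cmod z))%R.
Proof. intros Hz. rewrite Cmod_sqr. simpl. unfold Re, Im, Rdiv. do 2 f_equal; simpl; ring. Qed.

Lemma Re_inv_pos (z : CC) : (0 < Re z)%R -> (0 < Re (/ z))%R.
Proof.
intros H. assert (N : z <> 0) by now apply slit_neq0, Re_pos_slit. rewrite Re_inv by assumption.
apply Cmod_gt_0 in N. apply Rdiv_lt_0_compat; nra.
Qed.

Lemma rep_line_opp_inv z : off_T z -> (0 < Re z)%R -> rep_line z - rep_line (- / z) = jump z.
Proof.
intros Ho Hr. assert (Hz := off_T_neq0 z Ho).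
assert (O1 : off_T (z * z)).
{ unfold off_T in *. rewrite im_mult. replace (Re z * Im z + Im z * Re z)%R with (2 * (Re z * Im z))%R by ring.
  repeat apply Rmult_integral_contrapositive_currified; lra. }
unfold rep_line, jump. replace (- / z * - / z + 1) with ((z * z + 1) / (z * z)) by (field; assumption).
rewrite cpow_div; [|now apply off_T_slit, off_T_plus1|now apply off_T_slit|
  apply arg_diff_same_side; [now apply off_T_plus1|now rewrite Im_plus_1|assumption]].
rewrite cpow_sqr by assumption. replace (- s + - s) with (- (1 + nu)) by field.
change (cpow z (- (1 + nu))) with (j z). rewrite (Per_periodfun z Ho). ring.
Qed.

Lemma hol_pow_sq1 a z : (Re z <> 0 \/ Rabs (Im z) < 1)%R -> hol (fun z => cpow (z * z + 1) a) z.
Proof. intros H. apply (hol_comp (fun w => cpow w a)); [now apply hol_cpow, slit_sq1|holo]. Qed.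

Lemma opp_inv_of_neg z : z <> RtoC 0 -> - / z = / - z.
Proof. intros H. field. assumption. Qed.

(** [form] represents the sought hyperfunction on [-1 <= t <= 1] and its transform under [S : t -> -1/t] elsewhere;
    the Cauchy integrals [a1 - a2 = jump] make the two agree near [1], hence also near [S 1 = -1]. *)
Lemma global_rep : exists f, is_rep f /\
  (forall x : R, (Rabs x <= 1)%R -> ext (fun z => lm nu f z - Per z) x) /\
  (forall x : R, nearC x (fun z => off_T z -> f (- / z) = f z)).
Proof.
destruct (cousin jump) as [a1 [a2 [A1 [A2 [A3 [A4 [k [A5 A6]]]]]]]].
{ intros z Z1 Z2. apply hol_mult; [apply hol_pow_sq1; left; lra|apply psi_hol, Re_pos_slit; lra]. }
(* On [Q] one has form(z) - form(-1/z) = jump(z) - a1(z) + a2(z) = 0, because [a1] and [a2] agree at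
   -1/z, whose real part is negative. *)
set (form := fun z => rep_line z - a1 z - a2 (- / z)).
(* S exchanges inside and outside of the unit circle, so symmetry is automatic off the circle; on it
   both z and -1/z fall in the second branch, and symmetry of [form] is needed. *)
set (f := fun z => if Rlt_dec (Cmod z) 1 then form z else form (- / z)).
set (Q := fun z => (/ 2 < Re z < / 2 + 1)%R /\ (Rabs (Im z) < / 2)%R).
assert (SQ : forall z, off_T z -> Q z -> form (- / z) = form z).
{ intros z Ho [Hr Hi]. assert (Hz := off_T_neq0 z Ho). unfold form. rewrite opp_inv_invol by assumption.
  assert (J := rep_line_opp_inv z Ho ltac:(lra)). rewrite <- A3 in J by (try (apply Rabs_def2 in Hi); lra).
  rewrite (A4 (- / z)).
  - replace (rep_line z) with (rep_line z - rep_line (- / z) + rep_line (- / z)) by ring. rewrite J. ring.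
  - left. assert (P := Re_inv_pos z ltac:(lra)). rewrite re_opp. lra. }
assert (SQ' : forall z, off_T z -> Q (- / z) -> form (- / z) = form z).
{ intros z Ho H. symmetry. rewrite <- (opp_inv_invol z) at 1 by now apply off_T_neq0. apply SQ; [now apply off_T_opp_inv|assumption]. }
assert (Fo : forall z : CC, z <> 0 -> Cmod (- / z) = (/ Cmod z)%R) by (intros; now rewrite Cmod_opp, Cmod_inv).
assert (Fi : forall z, off_T z -> (Cmod z <> 1%R \/ form (- / z) = form z) -> f (- / z) = f z).
{ intros z Ho H. assert (Hz := off_T_neq0 z Ho). assert (P : (0 < Cmod z)%R) by now apply Cmod_gt_0.
  unfold f. rewrite Fo, opp_inv_invol by assumption.
  destruct (Rlt_dec (Cmod z) 1) as [L|L]; destruct (Rlt_dec (/ Cmod z) 1) as [L'|L']; try reflexivity.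
  - apply Rinv_lt_contravar in L; [|lra]. rewrite Rinv_1 in L. lra.
  - destruct H as [H|H]; [|now rewrite H]. exfalso. apply L'. rewrite <- Rinv_1. apply Rinv_lt_contravar; lra. }
assert (OQ : forall z, Q z -> nearC z Q).
{ intros z [[H1 H2] H3]. repeat apply filter_and; [now apply near_Re_gt|now apply near_Re_lt|now apply near_Im_lt]. }
assert (Cinv' : forall z : CC, z <> 0 -> ccontC (fun z => - / z) z) by (intros; apply hol_cont, hol_opp_inv; assumption).
(* On this part of the circle (Re z)^2 > 24/25, so z or -1/z lies in the square [Q] around 1. *)
assert (Seam : forall z, Cmod z = 1%R -> (Rabs (Im z) < / 5)%R -> nearC z (fun w => off_T w -> form (- / w) = form w)).
{ intros z H1 H2. assert (S2 := Cmod_sqr z). rewrite H1 in S2.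
  assert (Hz : z <> 0) by (intros ->; rewrite Cmod_0 in H1; lra).
  assert (I2 : (Im z * Im z < / 25)%R) by (apply Rabs_def2 in H2; nra).
  destruct (Rlt_dec 0 (Re z)) as [P|P].
  - near_by (OQ z ltac:(split; [split; nra|lra])). auto.
  - assert (Qs : Q (- / z)).
    { split; [rewrite re_opp, Re_inv, H1 by assumption; split; nra|].
      rewrite im_opp, Im_inv, H1, Rabs_Ropp by assumption. replace (- Im z / (1 * 1))%R with (- Im z)%R by field.
      rewrite Rabs_Ropp. lra. }
    near_by (near_comp (fun z => - / z) Q z (Cinv' z Hz) (OQ _ Qs)). auto. }
(* the poles of [a2 (- / z)] inside the unit disc have |Im z| >= 1/5 *)
assert (Ha2 : forall z : CC, z <> 0 -> (Cmod z <= 1)%R -> (Rabs (Im z) < / 5)%R -> hol (fun z => a2 (- / z)) z).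
{ intros z Hz H1 H2. apply (hol_comp a2 (fun z => - / z)); [|now apply hol_opp_inv]. apply A2.
  assert (P : (0 < Cmod z)%R) by now apply Cmod_gt_0.
  assert (S2 := Cmod_sqr (- / z)). rewrite Fo in S2 by assumption.
  assert (L : (1 <= / Cmod z * / Cmod z)%R).
  { rewrite <- Rinv_mult. rewrite <- Rinv_1 at 1. apply Rinv_le_contravar; nra. }
  assert (Ei : Im z = (Im (- / z) / (/ Cmod z * / Cmod z))%R).
  { rewrite im_opp, Im_inv by assumption. field. lra. }
  rewrite S2 in L, Ei. set (u := Re (- / z)) in *. set (v := Im (- / z)) in *. clearbody u v.
  rewrite Ei in H2. apply Rabs_def2 in H2.
  assert (H3 : (v < / 5 * (u * u + v * v) /\ - (/ 5 * (u * u + v * v)) < v)%R).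
  { destruct H2 as [H2 H3]. split.
    - apply (Rmult_lt_compat_r (u * u + v * v)) in H2; [|lra]. unfold Rdiv in H2. rewrite Rmult_assoc, Rinv_l in H2; lra.
    - apply (Rmult_lt_compat_r (u * u + v * v)) in H3; [|lra]. unfold Rdiv in H3. rewrite Rmult_assoc, Rinv_l in H3; lra. }
  destruct (Rlt_dec u (/ 2)) as [U|U]; [tauto|]. destruct (Rlt_dec (/ 2 + 1) u) as [U'|U']; [tauto|].
  destruct (Rlt_dec (/ 2) (Rabs v)) as [V|V]; [tauto|]. left.
  assert (V1 : (- / 2 <= v <= / 2)%R) by (apply Rabs_le_between; lra).
  (* On the horizontal sides |v| = 1/2 and u <= 3/2 give |Im z| >= (1/2) / (9/4 + 1/4) = 1/5, the
     corner value; on the left side u = 1/2, the bound u^2 + v^2 >= 1 contradicts |v| <= 1/2. *)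
  destruct (Req_dec v (/ 2)) as [->|V2]; [nra|]. destruct (Req_dec v (- / 2)) as [->|V3]; [nra|].
  split; [|lra]. destruct (Req_dec u (/ 2)) as [->|]; nra. }
assert (Ha1 : forall z, (Cmod z <= 1)%R -> hol a1 z).
{ intros z H. apply A1. left. assert (B := Re_le_Cmod z). apply Rabs_le_between in B; lra. }
assert (Hf : forall z, off_T z -> (Cmod z <= 1)%R -> (Rabs (Im z) < / 5)%R -> hol form z).
{ intros z Ho H1 H2. apply hol_minus; [apply hol_minus; [|now apply Ha1]|now apply Ha2; [apply off_T_neq0|..]].
  apply hol_mult; [apply hol_pow_sq1; lra|now apply Per_hol]. }
assert (F1 : forall z, (Cmod z <= 1)%R -> (Rabs (Im z) < / 5)%R -> nearC z (fun w => off_T w -> f w = form w)).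
{ intros z H1 H2. destruct (Rlt_dec (Cmod z) 1) as [L|L].
  - near_by (near_Cmod_lt z 1 L). intros w Hw _. unfold f. now destruct (Rlt_dec (Cmod w) 1).
  - near_by (Seam z ltac:(lra) H2). intros w Hw Ho. unfold f. destruct (Rlt_dec (Cmod w) 1); [reflexivity|auto]. }
exists f. split; [|split].
(* S maps |z| > 5 into |z| < 1/5, hence into the strip where [form] is holomorphic. *)
- exists (fun z => (Rabs (Im z) < / 5)%R \/ (5 < Cmod z)%R).
  assert (OW : forall z, (Rabs (Im z) < / 5 \/ 5 < Cmod z)%R -> nearC z (fun z => (Rabs (Im z) < / 5)%R \/ (5 < Cmod z)%R)).
  { intros z [H|H]; [near_by (near_Im_lt z _ H)|near_by (near_Cmod_gt z _ H)]; tauto. }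
  split; [split; [exact OW|split]|].
  + intros x. left. rewrite im_RtoC, Rabs_R0. lra.
  + exists 5%R. tauto.
  + apply holo_on_intro.
    * intros z [H1 H2]. apply filter_and; [now apply OW|now apply near_off_T].
    * intros z [H1 H2]. assert (Hz := off_T_neq0 z H2).
      destruct (Rle_dec (Cmod z) 1) as [L|L].
      -- assert (H3 : (Rabs (Im z) < / 5)%R) by lra. apply hol_ext_loc with form; [|now apply Hf].
         near_by (filter_and _ _ (F1 z L H3) (near_off_T z H2)). intros w [W1 W2]. symmetry. auto.
      -- apply hol_ext_loc with (fun z => form (- / z)).
         ++ near_by (near_Cmod_gt z 1 ltac:(lra)). intros w Hw. unfold f. destruct (Rlt_dec (Cmod w) 1); [lra|reflexivity].
         ++ assert (Li : (/ Cmod z < 1)%R) by (rewrite <- Rinv_1; apply Rinv_lt_contravar; lra).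
            apply (hol_comp form (fun z => - / z)); [|now apply hol_opp_inv].
            apply Hf; [now apply off_T_opp_inv|rewrite Fo by assumption; lra|].
            rewrite im_opp, Rabs_Ropp. destruct H1 as [H1|H1].
            ** rewrite Im_inv by assumption. unfold Rdiv. rewrite Rabs_mult, Rabs_Ropp, Rinv_mult, (Rabs_pos_eq (/ Cmod z * / Cmod z)).
               --- assert (Pz : (0 < / Cmod z)%R) by (apply Rinv_0_lt_compat; lra). assert (Pi := Rabs_pos (Im z)). nra.
               --- assert (Pz : (0 < / Cmod z)%R) by (apply Rinv_0_lt_compat; lra). nra.
            ** eapply Rle_lt_trans; [apply Im_le_Cmod|]. rewrite Cmod_inv by assumption. apply Rinv_lt_contravar; lra.
- intros x Hx. assert (Hc : (Cmod x <= 1)%R) by now rewrite Cmod_R.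
  assert (Hi : (Rabs (Im x) < / 5)%R) by (rewrite im_RtoC, Rabs_R0; lra).
  apply ext_eq with (fun z => cpow (z * z + 1) (- s) * (- a1 z - a2 (- / z))).
  + near_by (F1 x Hc Hi). intros z Hz Ho. unfold lm. rewrite Hz by assumption. unfold form, rep_line.
    transitivity (cpow (z * z + 1) (- s) * cpow (z * z + 1) s * Per z + cpow (z * z + 1) (- s) * (- a1 z - a2 (- / z)) - Per z);
      [rewrite cpow_opp|]; ring.
  + apply ext_mul; [apply near_hol_sq1_pow|]. apply ext_minus.
    * apply ext_hol. assert (B := near_Re_lt x (/ 2 + 1)). rewrite re_RtoC in B. apply Rabs_le_between in Hx.
      near_by (B ltac:(lra)). intros z Hz. apply hol_opp, A1. lra.
    (* At 0 this is [a2] at infinity, given by [k]. For 0 < |x| <= 1 the point -1/x is negative or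
       at least 1, so it avoids the left side of the square; [a2] is holomorphic across the right
       one. *)
    * destruct (Req_dec x 0) as [->|Nx].
      -- assert (Cn : ccontC Copp (RtoC 0)) by (apply hol_cont, hol_opp, hol_id). assert (E0 : - RtoC 0 = RtoC 0) by ring.
         exists (fun z => k (- z)). rewrite <- E0 in A5, A6.
         near_by (filter_and _ _ (near_comp Copp _ (RtoC 0) Cn A5) (near_comp Copp _ (RtoC 0) Cn A6)). intros u [U1 U2]. split.
         ++ apply (hol_comp k Copp); [exact U1|apply hol_opp, hol_id].
         ++ intros Ho. assert (N := off_T_neq0 u Ho). rewrite opp_inv_of_neg by assumption. apply U2.
            intros E1. apply N. replace u with (- - u) by ring. rewrite E1. ring.
      -- assert (Nx' := RtoC_neq0 x Nx). apply (ext_opp_inv a2); [assumption|]. apply ext_hol.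
         assert (Na := near_Im_lt (RtoC (- / x)) (/ 2) ltac:(rewrite im_RtoC, Rabs_R0; lra)).
         assert (Hb : (- / x < / 2 \/ / 2 < - / x)%R).
         { destruct (Rlt_dec 0 x) as [P|P]; [left; assert (U := Rinv_0_lt_compat x P); lra|right].
           rewrite <- Rinv_opp. apply Rinv_lt_contravar; apply Rabs_le_between in Hx; lra. }
         destruct Hb as [Hb|Hb].
         ++ near_by (near_Re_lt (RtoC (- / x)) (/ 2) Hb). intros z Hz. apply A2. tauto.
         ++ near_by (filter_and _ _ Na (near_Re_gt (RtoC (- / x)) (/ 2) Hb)). intros z [Z1 Z2]. apply A2.
            left. apply Rabs_def2 in Z1. lra.
- intros x. destruct (Req_dec (Rabs x) 1) as [E0|E0].
  + near_by (Seam x ltac:(now rewrite Cmod_R) ltac:(rewrite im_RtoC, Rabs_R0; lra)). intros z Hz Ho. apply Fi; auto.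
  + assert (N : nearC x (fun z => Cmod z <> 1%R)).
    { rewrite <- Cmod_R in E0. destruct (Rlt_dec (Cmod x) 1) as [L|L].
      - near_by (near_Cmod_lt x 1 L). intros; lra.
      - near_by (near_Cmod_gt x 1 ltac:(lra)). intros; lra. }
    near_by N. intros z Hz Ho. apply Fi; auto.
Qed.

Lemma Phi_S_invariant f z : f (- / z) = f z -> z <> 0 -> Phi nu f (- (1)) z = lm nu f z.
Proof.
intros H Hz. unfold Phi, lm. replace (- (1) / z) with (- / z) by (field; assumption). rewrite H.
f_equal. f_equal. ring.
Qed.

(** For [|x| > 1] the germ at [x] is the transform of the one at [-1/x]. *)
Lemma ext_line f (x : R) : (forall x : R, nearC x (fun z => off_T z -> f (- / z) = f z)) -> (1 < Rabs x)%R ->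
  ext (fun z => lm nu f z - Per z) (RtoC (- / x)) -> ext (fun z => lm nu f z - Per z) x.
Proof.
intros HS Hx1 F2. destruct (Rlt_dec 0 x) as [Hx|Hx'].
- apply ext_eq with (fun z => j z * (fun w => lm nu f w - Per w) (- / z) - psi z).
  + near_by (filter_and _ _ (HS x) (filter_and _ _ (near_Re_gt x 0 Hx) (near_Re_sqr x 0 ltac:(nra)))).
    intros z [Z0 [Z1 Z2]] Ho. rewrite <- (Phi_S_invariant f z) by (auto; now apply off_T_neq0).
    rewrite Phi_j, (Per_periodfun z Ho) by assumption. ring.
  + apply ext_minus.
    * apply (ext_mul j); [near_by (near_slit_pos x Hx); apply hol_j|].
      apply (ext_opp_inv (fun w => lm nu f w - Per w)); [lra|exact F2].
    * apply ext_hol. near_by (near_slit_pos x Hx). exact psi_hol.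
- assert (Hx : (x < 0)%R) by (destruct (Req_dec x 0) as [->|]; [rewrite Rabs_R0 in Hx1|]; lra).
  (* For x < 0 the period relation is used at -1/z, which has positive real part, and the power at
     -z; there j(-z) j(-1/z) = 1 without a branch correction. *)
  apply ext_eq with (fun z => j (- z) * (fun w => lm nu f w - Per w) (- / z) + j (- z) * psi (- / z)).
  + near_by (filter_and _ _ (HS x) (filter_and _ _ (near_Re_lt x 0 Hx) (near_Re_sqr x 0 ltac:(nra)))).
    intros z [Z0 [Z1 Z2]] Ho.
    assert (N := off_T_neq0 z Ho). assert (O1 := off_T_opp_inv z Ho).
    assert (Rz : (0 < Re (- z))%R) by (rewrite re_opp; lra).
    assert (E1 : lm nu f z = j (- z) * lm nu f (- / z)).
    { rewrite <- (Phi_S_invariant f z) by auto.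
      (* [Phi_j] requires a positive real part, so it is applied at -z to the reflected function. *)
      pose (g := fun w => f (- w)).
      assert (E2 := Phi_j nu g (- z) Rz). replace (- z * - z) with (z * z) in E2 by ring. specialize (E2 Z2).
      transitivity (Phi nu g (- (1)) (- z)).
      - unfold Phi, g. replace (- z * - z) with (z * z) by ring.
        replace (- (- (1) / - z)) with (- (1) / z) by (field; assumption). reflexivity.
      - rewrite E2. unfold lm, g. replace (- / - z) with (/ z) by (field; assumption).
        replace (/ z * / z) with (- / z * - / z) by ring. reflexivity. }
    rewrite E1, (Per_periodfun _ O1), opp_inv_invol by assumption.
    assert (E3 : j (- z) * j (- / z) = 1).
    { unfold tpow. rewrite opp_inv_of_neg, cpow_inv by (try apply Re_pos_slit; assumption). apply cpow_opp'. }
    transitivity (j (- z) * lm nu f (- / z) - (j (- z) * j (- / z)) * Per z); [ring|]. rewrite E3. ring.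
  + assert (Hj : nearC x (fun z => hol (fun z => j (- z)) z)).
    { near_by (near_Re_lt x 0 Hx). intros z Hz.
      apply (hol_comp j Copp); [apply hol_j, Re_pos_slit; rewrite re_opp; lra|apply hol_opp, hol_id]. }
    apply ext_plus.
    * apply (ext_mul (fun z => j (- z))); [exact Hj|]. apply (ext_opp_inv (fun w => lm nu f w - Per w)); [lra|exact F2].
    * apply ext_hol. near_by (filter_and _ _ Hj (near_Re_lt x 0 Hx)). intros z [Z1 Z2]. change CC in z.
      assert (N : z <> 0) by (intros ->; simpl in Z2; lra).
      apply hol_mult; [exact Z1|]. apply (hol_comp psi (fun z => - / z)); [|now apply hol_opp_inv].
      rewrite opp_inv_of_neg by assumption. apply psi_hol, Re_pos_slit, Re_inv_pos. rewrite re_opp. lra.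
Qed.

Lemma automorphic_of_period : exists f, automorphic nu f /\ normalized_rep nu f Per.
Proof.
destruct global_rep as [f [F1 [F0 HS]]]. exists f.
assert (F2 : forall x : R, ext (fun z => lm nu f z - Per z) x).
{ intros x. destruct (Rle_dec (Rabs x) 1) as [L|L]; [now apply F0|]. apply ext_line; [exact HS|lra|]. apply F0.
  rewrite Rabs_Ropp, Rabs_inv, <- Rinv_1. apply Rinv_le_contravar; lra. }
assert (HP : forall x : R, nearC x (fun z => off_T z -> Phi nu f (- (1)) z = lm nu f z)).
{ intros x. near_by (HS x). intros z Hz Ho. apply Phi_S_invariant; [auto|now apply off_T_neq0]. }
(* S-symmetry identifies the germ at infinity with the one at 0. *)
assert (F3 : ext (fun u => Phi nu f (- (1)) u - Per u) 0).
{ apply ext_eq with (2 := F2 0%R). near_by (HP 0%R). intros z Hz Ho. now rewrite Hz. }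
assert (HR : normalized_rep nu f Per) by (split; [exact Per_hol|split; [exact Per_period|split; [exact F2|exact Per_limits]]]).
split; [|exact HR]. split; [exact F1|].
assert (Hm : forall x z, hol (fun u => u + RtoC x) z) by (intros; apply hol_plus; [apply hol_id|apply hol_const]).
(* Invariance is checked in the standard charts and passes through [hyp_eq] to all frames, as the
   group law requires. *)
assert (IT : invariant nu f 1 (-1) 0 1).
{ apply hyp_eq_invariant; [reflexivity|]. apply invariant_hyp_eq; [reflexivity| |].
  - intros x. assert (K := proj2 (ext_shift (fun z => lm nu f (z + 1) - lm nu f z) x)). cbv beta in K.
    match type of K with ?A -> ?B => assert (K' : A) end.
    + apply ext_eq with (fun z => (fun w => lm nu f w - Per w) (z + 1) - (lm nu f z - Per z)).
      * apply filter_forall. intros z Hz. cbv beta. rewrite Per_period by assumption. ring.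
      * apply ext_minus; [|apply F2]. apply (ext_comp (fun w => lm nu f w - Per w) (fun z => z + 1)).
        -- apply filter_forall. exact (Hm 1%R).
        -- apply filter_forall. intros z. apply off_T_plus1.
        -- rewrite <- RtoC_plus. apply F2.
    + generalize (K K'). apply ext_eq, filter_forall. intros u _. now rewrite PhiG_Tinv_lm, PhiF_lm.
  (* At infinity the translated lift runs along (u - 1, u), which is 1 - u times (-1, u/(1-u)). The
     defect is then [j (1 - u) * psi (/ (1 - u))] by the period relation at 1/(1-u) and periodicity
     of [Per]; it is holomorphic, as [psi] is near 1. *)
  - assert (E0 : RtoC 0 / (1 - RtoC 0) = RtoC 0) by (field; replace (1 - 0) with (RtoC 1) by ring; apply C1_nz).
    assert (Q1 : hol (fun u => 1 - u) (RtoC 0)) by (apply hol_minus; [apply hol_const|apply hol_id]).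
    assert (N1 : nearC 0 (fun u => (0 < Re (1 - u))%R)).
    { apply (nearC_gt (fun u => Re (1 - u))); [|simpl; lra].
      apply (rcont_comp_C Re (fun u => 1 - u)); [apply rcont_Re|apply hol_cont, Q1]. }
    assert (N2 : nearC 0 (fun u => (0 < Re ((1 - u) * (1 - u)))%R)).
    { apply (nearC_gt (fun u => Re ((1 - u) * (1 - u)))); [|simpl; lra].
      apply (rcont_comp_C Re (fun u => (1 - u) * (1 - u))); [apply rcont_Re|]. apply hol_cont, hol_mult; exact Q1. }
    assert (Q2 : nearC 0 (fun u => hol (fun u => u / (1 - u)) u)).
    { near_by N1. intros u Hu. apply hol_div; [apply hol_id|apply hol_minus; [apply hol_const|apply hol_id]|].
      now apply slit_neq0, Re_pos_slit. }
    assert (N3 : nearC 0 (fun u => (0 < Re (- (1) * - (1) + (u / (1 - u)) * (u / (1 - u))))%R)).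
    { apply (nearC_gt (fun u => Re (- (1) * - (1) + (u / (1 - u)) * (u / (1 - u))))).
      - apply (rcont_comp_C Re (fun u => - (1) * - (1) + (u / (1 - u)) * (u / (1 - u)))); [apply rcont_Re|].
        apply hol_cont. apply hol_plus; [apply hol_const|]. apply hol_mult; apply (locally_singleton _ _ Q2).
      - rewrite E0. simpl. lra. }
    assert (Oq : forall u, off_T u -> off_T (u / (1 - u))).
    { intros u Hu. replace u with (RtoC 1 * u + RtoC 0) at 1 by ring.
      replace (1 - u) with (RtoC (-1) * u + RtoC 1) by (apply C_eq; destruct u; simpl; ring).
      apply off_T_mobius; [assumption|lra]. }
    apply ext_eq with (fun u => j (1 - u) * (fun v => Phi nu f (- (1)) v - Per v) (u / (1 - u))
       + j (1 - u) * psi (/ (1 - u)) - (Phi nu f (- (1)) u - Per u)).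
    + near_by (filter_and _ _ N1 (filter_and _ _ N2 N3)). intros u [U1 [U2 U3]] Ho.
      rewrite PhiG_Tinv_oo, PhiF_oo. change CC in u. cbv beta.
      assert (Hn : 1 - u <> 0) by now apply slit_neq0, Re_pos_slit.
      assert (Hs := Re_pos_slit _ U1).
      assert (O1 := Oq u Ho). assert (N := off_T_neq0 _ O1).
      assert (E1 : Phi nu f (u - 1) u = j (1 - u) * Phi nu f (- (1)) (u / (1 - u))).
      { rewrite <- Phi_scale by assumption. apply Phi_eq; [ring|field; assumption]. }
      rewrite E1.
      assert (O2 : off_T (/ (1 - u))).
      { replace (/ (1 - u)) with (u / (1 - u) + 1) by (field; assumption). now apply off_T_plus1. }
      rewrite (Per_periodfun _ O2).
      assert (E2 : Per (/ (1 - u)) = Per (u / (1 - u))).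
      { replace (/ (1 - u)) with (u / (1 - u) + 1) by (field; assumption). now apply Per_period. }
      assert (E3 : Per (- / / (1 - u)) = Per u).
      { assert (Ho' : off_T (- / / (1 - u))) by now apply off_T_opp_inv.
        rewrite <- (Per_period _ Ho'). f_equal. field. assumption. }
      rewrite E2, E3.
      assert (E4 : j (1 - u) * j (/ (1 - u)) = 1).
      { unfold tpow. rewrite cpow_inv by assumption. apply cpow_opp'. }
      transitivity (j (1 - u) * Phi nu f (- (1)) (u / (1 - u)) - (j (1 - u) * j (/ (1 - u))) * Per u - (Phi nu f (- (1)) u - Per u)); [ring|].
      rewrite E4. ring.
    + assert (Hj : nearC 0 (fun u => hol (fun u => j (1 - u)) u)).
      { near_by N1. intros u Hu. apply (hol_comp j (fun u => 1 - u)); [now apply hol_j, Re_pos_slit|].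
        holo. }
      apply ext_minus; [apply ext_plus|exact F3].
      * apply (ext_mul (fun u => j (1 - u))); [exact Hj|].
        apply (ext_comp (fun v => Phi nu f (- (1)) v - Per v) (fun u => u / (1 - u))); [exact Q2|apply filter_forall; exact Oq|].
        now rewrite E0.
      * apply ext_hol. near_by (filter_and _ _ Hj N1). intros u [U1 U2]. holo.
        apply (hol_comp psi (fun u => / (1 - u))); [now apply psi_hol, Re_pos_slit, Re_inv_pos|].
        apply hol_inv; [apply hol_minus; [apply hol_const|apply hol_id]|now apply slit_neq0, Re_pos_slit]. }
assert (IS : invariant nu f 0 (-1) 1 0).
{ apply hyp_eq_invariant; [reflexivity|]. apply invariant_hyp_eq; [reflexivity| |].
  - intros x. apply ext_eq with (fun u => (fun z => Phi nu f (- (1)) z - lm nu f z) (u + RtoC x)).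
    + apply filter_forall. intros u Hu. now rewrite PhiG_S_lm, PhiF_lm.
    + apply (proj2 (ext_shift (fun z => Phi nu f (- (1)) z - lm nu f z) x)).
      apply ext_eq with (fun _ => 0); [near_by (HP x)|apply ext_hol, filter_forall; intros; apply hol_const].
      intros z Hz Ho. rewrite Hz by assumption. ring.
  - apply ext_eq with (fun _ => 0); [near_by (HP 0%R)|apply ext_hol, filter_forall; intros; apply hol_const].
    intros u Hu Ho. rewrite PhiG_S_oo, PhiF_oo, Hu by assumption. ring. }
assert (IT' : invariant nu f 1 1 0 1) by exact (invariant_inverse nu f 1 (-1) 0 1 eq_refl IT).
intros a b c d Hdet.
assert (I := SL2Z_ind (invariant nu f) (invariant_mul nu f) IS IT' IT a b c d Hdet).
apply invariant_hyp_eq; [assumption| |].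
- intros x. apply I. ring.
- apply I. ring.
Qed.
End Surjectivity.

(* A linear bijection A^nu_{-omega}(PSL_2(Z)) -> Psi_mod(nu), expressed on
   representatives: F is constant on hyperfunction classes, linear,
   lands in Psi_mod(nu), injective on classes and surjective. *)
Theorem theorem5p11 (nu : CC) (hnu : forall k : Z, nu <> RtoC (1 + 2 * IZR k)) :
  exists F : (CC -> CC) -> (CC -> CC),
    (forall f, automorphic nu f -> in_Psi_mod nu (F f)) /\
    (forall f1 f2, automorphic nu f1 -> automorphic nu f2 -> hyp_eq f1 f2 ->
       forall t, slit t -> F f1 t = F f2 t) /\
    (forall (lam : CC) f1 f2 f3,
       automorphic nu f1 -> automorphic nu f2 -> automorphic nu f3 ->
       hyp_eq f3 (fun z => lam * f1 z + f2 z) ->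
       forall t, slit t -> F f3 t = lam * F f1 t + F f2 t) /\
    (forall f1 f2, automorphic nu f1 -> automorphic nu f2 ->
       (forall t, slit t -> F f1 t = F f2 t) -> hyp_eq f1 f2) /\
    (forall psi, in_Psi_mod nu psi ->
       exists f, automorphic nu f /\ forall t, slit t -> F f t = psi t).
Proof.
(* [F f] is any function related to [f] through some normalised [P]. Values off the slit plane
   remain arbitrary, and on it uniqueness of [P] makes the choice canonical. *)
pose (R f psi := exists P, normalized_rep nu f P /\ periodfun nu P psi /\ in_Psi_mod nu psi).
exists (fun f => epsilon (inhabits (fun _ : CC => RtoC 0)) (R f)).
assert (HF : forall f, automorphic nu f -> R f (epsilon (inhabits (fun _ : CC => RtoC 0)) (R f))).
{ intros f Hf. apply epsilon_spec. destruct (normalized_rep_exists nu hnu f Hf) as [P HP].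
  destruct (periodfun_exists nu f P Hf HP) as [psi [H1 H2]]. exists psi, P. auto. }
set (F := fun f => epsilon (inhabits (fun _ : CC => RtoC 0)) (R f)) in *.
(* The same combination of the normalised representatives is normalised for the combined
   hyperfunction, so it must be the one attached to [f3]. *)
assert (Lin : forall lam f1 f2 f3, automorphic nu f1 -> automorphic nu f2 -> automorphic nu f3 ->
  hyp_eq f3 (fun z => lam * f1 z + f2 z) -> forall t, slit t -> F f3 t = lam * F f1 t + F f2 t).
{ intros lam f1 f2 f3 A1 A2 A3 H.
  destruct (HF f1 A1) as [P1 [R1 [Q1 I1]]]. destruct (HF f2 A2) as [P2 [R2 [Q2 I2]]]. destruct (HF f3 A3) as [P3 [R3 [Q3 I3]]].
  fold (F f1) in *. fold (F f2) in *. fold (F f3) in *.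
  assert (U := normalized_rep_unique nu hnu _ _ _ _ R3 (normalized_rep_lin nu lam f1 f2 P1 P2 R1 R2) (fun x => hyp_eq_lm nu _ _ x H)).
  apply slit_eq_off_T.
  - intros z. now apply in_Psi_hol with nu.
  - intros z Hz. apply hol_plus; [apply hol_mult; [apply hol_const|]|]; now apply in_Psi_hol with nu.
  - intros z Hz. rewrite Q1, Q2, Q3, !U by (try apply off_T_opp_inv; assumption). ring. }
split; [|split; [|split; [|split]]].
- intros f Hf. destruct (HF f Hf) as [P [_ [_ H]]]. exact H.
- intros f1 f2 A1 A2 H t Ht.
  destruct (HF f1 A1) as [P1 [R1 [Q1 I1]]]. destruct (HF f2 A2) as [P2 [R2 [Q2 I2]]]. fold (F f1) in *. fold (F f2) in *.
  assert (U := normalized_rep_unique nu hnu _ _ _ _ R1 R2 (fun x => hyp_eq_lm nu _ _ x H)).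
  revert t Ht. apply slit_eq_off_T.
  + intros z. now apply in_Psi_hol with nu.
  + intros z. now apply in_Psi_hol with nu.
  + intros z Hz. rewrite Q1, Q2, !U by (try apply off_T_opp_inv; assumption). reflexivity.
- exact Lin.
- intros f1 f2 A1 A2 H.
  destruct (HF f1 A1) as [P1 [R1 [Q1 I1]]]. destruct (HF f2 A2) as [P2 [R2 [Q2 I2]]].
  apply (normalized_rep_inj nu f1 f2 P1 P2 A1 A2 R1 R2). now apply (periodfun_inj nu hnu P1 P2 (F f1) (F f2)).
- intros psi Hpsi. destruct (automorphic_of_period nu hnu psi Hpsi) as [f [Hf HR]]. exists f. split; [exact Hf|].
  destruct (HF f Hf) as [P1 [R1 [Q1 I1]]]. fold (F f) in *.
  assert (U := normalized_rep_unique nu hnu _ _ _ _ R1 HR).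
  assert (U' : forall z, off_T z -> P1 z = Per nu psi z).
  { apply U. intros x. apply ext_hol, filter_forall. intros z.
    apply hol_ext_loc with (fun _ => 0); [apply filter_forall; intros w; ring|apply hol_const]. }
  apply slit_eq_off_T.
  + intros z. now apply in_Psi_hol with nu.
  + intros z. now apply in_Psi_hol with nu.
  + intros z Hz. rewrite Q1, !U' by (try apply off_T_opp_inv; assumption). symmetry. now apply Per_periodfun.
Qed.
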